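(* Let $\mathcal{X}=[0,1]^d$, let $(P,Q)\in\mathcal{P}_{H^2}(\mathcal{X})$, let $f_{H^2}:=1-\big(\frac{dP}{dQ}\big)^{-\frac12}$, and let $X^n=(X_1,\dots,X_n)$ and $Y^n=(Y_1,\dots,Y_n)$ be i.i.d. samples from $P$ and $Q$, respectively. For any $\alpha>0$: (i) If $f_{H^2}\in\mathsf{C}(\mathcal{X})$ (continuous on $\mathcal{X}$), then for $\{k_n,t_{k_n}\}_{n\in\mathbb{N}}$ such that $k_n\to\infty$, $t_{k_n}>0$, $t_{k_n}\to0$, and $k_n^{\frac32}t_{k_n}^{-2}=O\big(n^{(1-\alpha)/2}\big)$, $$\hat H^2_{\tilde{\mathcal{G}}^{(1)}_{k_n,t_{k_n}}}(X^n,Y^n)\xrightarrow[n\to\infty]{}H^2(P,Q),\quad\mathbb{P}\text{-a.s.}$$ (ii) Suppose there exists $M$ such that $f_{H^2}\in\mathcal{I}_{H^2}(M)$. Then, for $k,n$ with $\sqrt k\log^3k=O\big(n^{(1-\alpha)/2}\big)$, $m_k=0.5\log k$ and $t_k=\log^{-1}k=1/\log k$, $$\mathbb{E}\Big[\big|\hat H^2_{\tilde{\mathcal{G}}^{(2)}_{k,m_k,t_k}}(X^n,Y^n)-H^2(P,Q)\big|\Big]=O\big(k^{-\frac12}\log k\big)+O\big(\sqrt k\,\log^3k\;n^{-\frac12}\big).$$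
   Context: For $P\ll Q$ in $\mathcal{P}(\mathcal{X})$ (Borel probability measures on $\mathcal{X}$), $H^2(P,Q)=\mathbb{E}_Q\Big[\big(\sqrt{\tfrac{dP}{dQ}}-1\big)^2\Big]$. $\mathcal{P}_{H^2}(\mathcal{X})$ is the set of pairs $(P,Q)\in\mathcal{P}(\mathcal{X})\times\mathcal{P}(\mathcal{X})$ with $P\ll Q$. Neural network classes: let $\phi(x)=\frac{1}{1+e^{-x}}$. For $k\in\mathbb{N}$ and $\mathbf{a}=(a_1,a_2,a_3)\in\mathbb{R}^3_{\ge0}$, $\mathcal{G}_k(\mathbf{a})$ is the set of functions $g:\mathbb{R}^d\to\mathbb{R}$ of the form $g(x)=\sum_{i=1}^k\beta_i\phi(w_i\cdot x+b_i)+b_0$ with $w_i\in\mathbb{R}^d$, $b_0,b_i,\beta_i\in\mathbb{R}$, $\max_{i=1,\dots,k,\,j=1,\dots,d}\{|w_{i,j}|,|b_i|\}\le a_1$, $|\beta_i|\le a_2$ for $i=1,\dots,k$, and $|b_0|\le a_3$. For $t>0$, $\tilde{\mathcal{G}}_k(\mathbf{a},t):=\{g:\ g(x)=(1-t)\wedge\tilde g(x),\ \tilde g\in\mathcal{G}_k(\mathbf{a})\}$. Set $\tilde{\mathcal{G}}^{(1)}_{k,t}:=\tilde{\mathcal{G}}_k((1,1,1),t)$ and $\tilde{\mathcal{G}}^{(2)}_{k,m,t}:=\tilde{\mathcal{G}}_k\big((\sqrt k\log k,2k^{-1}m,m),t\big)$. Neural estimator: $\hat H^2_{\mathcal{G}}(X^n,Y^n):=\sup_{g\in\mathcal{G}}\frac1n\sum_{i=1}^n\Big[g(X_i)-\frac{g(Y_i)}{1-g(Y_i)}\Big]$.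 Barron class: for $f:\mathbb{R}^d\to\mathbb{R}$ having a Fourier representation $f(x)=\int_{\mathbb{R}^d}e^{i\omega\cdot x}\tilde F(d\omega)$, with $\tilde F$ a complex Borel measure on $\mathbb{R}^d$ with magnitude $F$, set $B(f):=\int_{\mathbb{R}^d}\sup_{x\in\mathcal{X}}|\omega\cdot x|\,F(d\omega)$. For $c\ge0$, $\mathcal{B}_c$ is the set of such $f$ with $B(f)\vee|f(0)|\le c$. For $\tilde f:\mathcal{X}\to\mathbb{R}$, $c_B^\star(\tilde f):=\inf\{c:\exists f\in\mathcal{B}_c,\ \tilde f=f|_{\mathcal{X}}\}$ (with $\inf\emptyset=\infty$). $\mathcal{I}_{H^2}(m):=\{f:\mathcal{X}\to\mathbb{R}:\ c_B^\star(f)\vee\|(1-f)^{-1}\|_\infty\vee\|f\|_\infty\le m\}$, with $\|\cdot\|_\infty$ the sup norm on $\mathcal{X}$, $a\vee b=\max\{a,b\}$, $a\wedge b=\min\{a,b\}$. Constants implied by $O(\cdot)$ do not depend on $k,n$. *)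

(* Defs.v *)
From HB Require Import structures.
From mathcomp Require Import all_boot all_order all_algebra finmap.
From mathcomp Require Import all_classical all_reals all_analysis.
Import Order.TTheory GRing.Theory Num.Theory.
Import numFieldNormedType.Exports.

Set Implicit Arguments.
Unset Strict Implicit.
Unset Printing Implicit Defensive.

Local Open Scope classical_set_scope.
Local Open Scope charge_scope.
Local Open Scope ring_scope.

(* R^d with its Borel sigma-algebra; as a type it is convertible to 'rV[R]_d. *)
Notation borel_rV R d := (g_sigma_algebraType (@open 'rV[R]_d)).

Definition dot (R : realType) (d : nat) (w x : 'rV[R]_d) : R :=
  \sum_(j < d) w ord0 j * x ord0 j.

Definition cube (R : realType) (d : nat) : set 'rV[R]_d :=
  [set x | forall j, 0 <= x ord0 j <= 1].

(* A Borel probability measure on [0,1]^d is encoded as a Borel probability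
   measure on R^d giving mass 1 to the cube. *)
Definition on_cube (R : realType) (d : nat) (P : probability (borel_rV R d) R) :
  Prop := P (@cube R d) = 1%E.

(* dP/dQ; only determined up to a Q-null set. *)
Definition density (R : realType) (d : nat) (P Q : probability (borel_rV R d) R)
  : 'rV[R]_d -> \bar R := 'd (charge_of_finite_measure P) '/d Q.

(* The pairs (P, Q) in the class P_{H^2}([0,1]^d). *)
Definition hellinger_pair (R : realType) (d : nat)
    (P Q : probability (borel_rV R d) R) : Prop :=
  [/\ on_cube P, on_cube Q & P `<< Q].

Definition hellinger2 (R : realType) (d : nat)
    (P Q : probability (borel_rV R d) R) : \bar R :=
  ('E_Q[(fun x => (Num.sqrt (fine (density P Q x)) - 1) ^+ 2)%R])%E.

(* 1 - (dP/dQ)^(-1/2); since 0^-1 = +oo in \bar R, the value is -oo where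
   dP/dQ vanishes. *)
Definition f_hellinger (R : realType) (d : nat)
    (P Q : probability (borel_rV R d) R) (x : 'rV[R]_d) : \bar R :=
  (1 - ((density P Q x) `^ 2^-1)^-1)%E.

(* f is a real-valued version of f_{H^2}, which is a Q-a.e. class. *)
Definition f_hellinger_version (R : realType) (d : nat)
    (P Q : probability (borel_rV R d) R) (f : 'rV[R]_d -> R) : Prop :=
  {ae Q, forall x, f_hellinger P Q x = (f x)%:E}.

Section iid.
Context (dO dT : measure_display) (Omega : measurableType dO)
  (T : measurableType dT) (R : realType).
Variable Pr : probability Omega R.

Definition mutually_independent (X : nat -> {RV Pr >-> T}) : Prop :=
  forall (J : {fset nat}) (A : nat -> set T), (forall i, measurable (A i)) ->
    Pr (\bigcap_(i in [set` J]) (X i @^-1` A i)) =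
    (\prod_(i <- J) Pr (X i @^-1` A i))%E.

Definition iid_from (mu : probability T R) (X : nat -> {RV Pr >-> T}) : Prop :=
  mutually_independent X /\
  forall i A, measurable A -> distribution Pr (X i) A = mu A.

End iid.

Section neural_classes.
Context (R : realType) (d : nat).
Implicit Types (g : 'rV[R]_d -> R) (k : nat) (t m : R).

Definition sigmoid (x : R) : R := (1 + expR (- x))^-1.

Definition nn_class k (a1 a2 a3 : R) : set ('rV[R]_d -> R) :=
  [set g | exists (w : 'I_k -> 'rV[R]_d) (b beta : 'I_k -> R) (b0 : R),
    [/\ forall i j, `|w i ord0 j| <= a1, forall i, `|b i| <= a1,
        forall i, `|beta i| <= a2, `|b0| <= a3 &
        forall x, g x = \sum_(i < k) beta i * sigmoid (dot (w i) x + b i) + b0]].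

Definition nn_class_trunc k (a1 a2 a3 t : R) : set ('rV[R]_d -> R) :=
  [set g | exists2 g', nn_class k a1 a2 a3 g' &
    forall x, g x = Num.min (1 - t) (g' x)].

Definition nn_class1 k t := nn_class_trunc k 1 1 1 t.

Definition nn_class2 k m t :=
  nn_class_trunc k (Num.sqrt k%:R * ln k%:R) (2 * k%:R^-1 * m) m t.

Definition hellinger2_hat (G : set ('rV[R]_d -> R)) (n : nat)
    (x y : 'I_n -> 'rV[R]_d) : \bar R :=
  ereal_sup [set (n%:R^-1 * \sum_(i < n) (g (x i) - g (y i) / (1 - g (y i))))%:E
            | g in G].

End neural_classes.

(* A complex measure, given by its real and imaginary parts, which are finite
   signed measures (charges are finite in the library). *)
Record complex_measure (dT : measure_display) (T : measurableType dT)
    (R : realType) := ComplexMeasure {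
  cm_re : {charge set T -> \bar R} ;
  cm_im : {charge set T -> \bar R} }.

Section complex_measures.
Context (dT : measure_display) (T : measurableType dT) (R : realType).

(* Supremum over the countable measurable partitions of A. *)
Definition cm_total_variation (nu : complex_measure T R) (A : set T) : \bar R :=
  ereal_sup [set s | exists E : (set T)^nat,
    [/\ forall j, measurable (E j), trivIset setT E, \bigcup_j E j = A &
     s = (\sum_(0 <= j <oo)
       (Num.sqrt (fine (cm_re nu (E j)) ^+ 2 + fine (cm_im nu (E j)) ^+ 2))%:E)%E]].

Definition is_magnitude (nu : complex_measure T R)
    (F : {finite_measure set T -> \bar R}) : Prop :=
  forall A, measurable A -> F A = cm_total_variation nu A.

(* Integral against a signed measure, through a Hahn-Jordan decomposition (the
   value does not depend on the one chosen). *)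
Definition charge_integral (nu : {charge set T -> \bar R}) (h : T -> R) : R :=
  let P := cid (Hahn_decomposition nu) in
  let N := cid (svalP P) in
  \int[jordan_pos (svalP N)]_x h x - \int[jordan_neg (svalP N)]_x h x.

End complex_measures.

Section barron.
Context (R : realType) (d : nat).

(* f x is the integral of exp(i omega.x) against nu, the two equations being its
   real and imaginary parts. *)
Definition fourier_representation (nu : complex_measure (borel_rV R d) R)
    (f : 'rV[R]_d -> R) : Prop := forall x : 'rV[R]_d,
  f x = charge_integral (cm_re nu) (fun omega => cos (dot omega x)) -
        charge_integral (cm_im nu) (fun omega => sin (dot omega x)) /\
  0 = charge_integral (cm_re nu) (fun omega => sin (dot omega x)) +
      charge_integral (cm_im nu) (fun omega => cos (dot omega x)).

Definition barron_coef (F : {finite_measure set (borel_rV R d) -> \bar R}) :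
    \bar R :=
  (\int[F]_omega ereal_sup [set `|dot omega x|%:E | x in @cube R d])%E.

Definition barron_class (c : R) : set ('rV[R]_d -> R) :=
  [set f | exists (nu : complex_measure (borel_rV R d) R)
                  (F : {finite_measure set (borel_rV R d) -> \bar R}),
    [/\ is_magnitude nu F, fourier_representation nu f &
        (maxe (barron_coef F) `|f 0|%:E <= c%:E)%E]].

Definition barron_const (f : 'rV[R]_d -> R) : \bar R :=
  ereal_inf [set c%:E | c in [set c : R | 0 <= c /\
    exists2 f', barron_class c f' & forall x, cube x -> f x = f' x]].

Definition sup_norm_cube (f : 'rV[R]_d -> \bar R) : \bar R :=
  ereal_sup [set `|f x|%E | x in @cube R d].

(* The inverse is taken in \bar R, so that f may not take the value 1. *)
Definition hellinger_class (m : R) : set ('rV[R]_d -> R) :=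
  [set f | (maxe (barron_const f)
             (maxe (sup_norm_cube (fun x => (1 - f x)%:E^-1))
                   (sup_norm_cube (fun x => (f x)%:E))) <= m%:E)%E].

End barron.

(* Main.v *)
(** For g < 1 one has, with r = dP/dQ and f = 1 - r^(-1/2),
      H^2(P, Q) = E_P g - E_Q (g / (1 - g)) + E_Q (r (f - g)^2 / (1 - g)),
    so that the error of the estimator is at most the uniform deviation of the two empirical
    means over the class plus the infimum over the class of the last term, the bias.

    Deviations: symmetrisation and contraction reduce them to sign averages of single neurons,
    which chaining over dyadic grids of weights bounds by O(sqrt n); McDiarmid's inequality and
    Borel-Cantelli give the almost sure version.

    Bias in (i): difference quotients of x |-> sigmoid (w . x + b) in w and b show that the
    uniform closure of the span of neurons with small weights contains all polynomials, hence,
    by Bernstein, min (f, 1 - s); the outer weights are made small by repeating neurons.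

    Bias in (ii): a Barron function is a mean of cosines and sines of w . x, hence nearly in the
    closed convex hull of steep sigmoids, and a greedy choice of k neurons decreases the L^2(Q)
    error at the rate k^(-1/2) (Maurey, Jones, Barron). *)

Require Import Defs.
From HB Require Import structures.
From mathcomp Require Import all_boot all_order all_algebra finmap.
From mathcomp Require Import all_classical all_reals all_analysis.
From mathcomp Require Import measurable_realfun ring lra.
Import Order.TTheory GRing.Theory Num.Theory.
Import numFieldNormedType.Exports.
Set Implicit Arguments.
Unset Strict Implicit.
Unset Printing Implicit Defensive.
Local Open Scope classical_set_scope.
Local Open Scope ring_scope.

(** * Bounded measurable functions *)

(** The estimator is a supremum over an uncountable class, so it is only ever bracketed: a bounded
    measurable function built from finitely many grid networks dominates the deviation of every
    network up to an arbitrary delta, and integrals of the estimator are bounded by monotonicity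
    alone.

    In the rate sqrt k log^3 k, the factor log^2 k is the Lipschitz constant t^-2 of v / (1 - v)
    truncated at 1 - t, one log k is the total outer weight, and sqrt k bounds the square root of
    the inner weight bound sqrt k log k, which is what chaining costs.

    In (i) the weight r = (1 - f)^-2 may be unbounded, since f may come close to 1. Hence f is cut
    at 1 - s, and the bias integrand is at most 5 s r, with Q-integral 5 s. In (ii) r <= M^2, so an
    L^2(Q) bound suffices.

    The convex hull in (ii) appears only in dual form, as an inequality tested against every bounded
    function S. This form passes through the Fourier integral by Fubini and is what one greedy step
    consumes. *)

Section bounded_measurable.
Context (R : realType).

(** Stable under all the operations applied to integrands below and integrable for every finite
    measure, so that linearity, monotonicity and Fubini need no integrability argument. The
    exceptions are integrands that contain dP/dQ or the l1 norm of a frequency. *)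
Definition bmf d (T : measurableType d) (f : T -> R) :=
  measurable_fun [set: T] f /\ exists M, forall x, `|f x| <= M.

Context d (T : measurableType d).
Implicit Types (f g : T -> R).

Lemma bmf_cst (r : R) : bmf (fun _ : T => r).
Proof. by split; [exact: measurable_cst | exists `|r|]. Qed.

Lemma bmfD f g : bmf f -> bmf g -> bmf (fun x => f x + g x).
Proof.
move=> [mf [M Mf]] [mg [N Ng]]; split; first exact: measurable_funD.
by exists (M + N) => x; rewrite (le_trans (ler_normD _ _))// lerD.
Qed.

Lemma bmfM f g : bmf f -> bmf g -> bmf (fun x => f x * g x).
Proof.
move=> [mf [M Mf]] [mg [N Ng]]; split; first exact: measurable_funM.
by exists (M * N) => x; rewrite normrM ler_pM.
Qed.

Lemma bmfZ (r : R) f : bmf f -> bmf (fun x => r * f x).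
Proof. exact/bmfM/bmf_cst. Qed.

Lemma bmfN f : bmf f -> bmf (fun x => - f x).
Proof.
move=> bf; rewrite (_ : (fun _ => _) = (fun x => -1 * f x)); first exact: bmfZ.
by apply/funext => x; rewrite mulN1r.
Qed.

Lemma bmfB f g : bmf f -> bmf g -> bmf (fun x => f x - g x).
Proof. by move=> bf bg; exact/bmfD/bmfN. Qed.

Lemma bmf_norm f : bmf f -> bmf (fun x => `|f x|).
Proof.
move=> [mf [M Mf]]; split; first exact: measurableT_comp.
by exists M => x; rewrite normr_id.
Qed.

Lemma bmf_max f g : bmf f -> bmf g -> bmf (fun x => Num.max (f x) (g x)).
Proof.
move=> bf bg; rewrite (_ : (fun _ => _) =
    (fun x => 2^-1 * (f x + g x + `|f x - g x|))).
  exact/bmfZ/bmfD/bmf_norm/bmfB/bg/bf/bmfD.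
by apply/funext => x; rewrite maxr_absE mulrC.
Qed.

Lemma bmf_sum (I : Type) (s : seq I) (F : I -> T -> R) :
  (forall i, bmf (F i)) -> bmf (fun x => \sum_(i <- s) F i x).
Proof.
move=> bF; elim: s => [|i s IH].
  by under eq_fun do rewrite big_nil; exact: bmf_cst.
by under eq_fun do rewrite big_cons; exact: bmfD.
Qed.

Lemma bmf_bigmax (I : Type) (s : seq I) (F : I -> T -> R) f :
  bmf f -> (forall i, bmf (F i)) ->
  bmf (fun x => \big[Num.max/f x]_(i <- s) F i x).
Proof.
move=> bf bF; elim: s => [|i s IH].
  by under eq_fun do rewrite big_nil; exact: bf.
by under eq_fun do rewrite big_cons; exact: bmf_max.
Qed.

Lemma bmf_comp d' (S : measurableType d') (h : S -> T) f :
  measurable_fun [set: S] h -> bmf f -> bmf (fun x => f (h x)).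
Proof.
move=> mh [mf [M Mf]]; split; first exact: measurableT_comp mf mh.
by exists M => x; exact: Mf.
Qed.

Lemma bmf_post (h : R -> R) f : measurable_fun [set: R] h ->
  (forall M, exists N, forall x, `|x| <= M -> `|h x| <= N) ->
  bmf f -> bmf (fun x => h (f x)).
Proof.
move=> mh bh [mf [M Mf]]; split; first exact: measurableT_comp mh mf.
by have [N hN] := bh M; exists N => x; exact/hN/Mf.
Qed.

Lemma bmf_expR f : bmf f -> bmf (fun x => expR (f x)).
Proof.
move=> [mf [M Mf]]; split; first exact: measurableT_comp.
exists (expR M) => x; rewrite ger0_norm ?expR_ge0// ler_expR.
exact: le_trans (ler_norm _) (Mf x).
Qed.

Variable mu : {finite_measure set T -> \bar R}.

Lemma bmf_integrable f : bmf f -> mu.-integrable [set: T] (EFin \o f).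
Proof.
move=> [mf [M Mf]]; apply: measurable_bounded_integrable => //.
  by rewrite -ge0_fin_numE// fin_num_measure.
exists M; split; first exact: num_real.
by move=> x Mx y _; exact: le_trans (Mf y) (ltW Mx).
Qed.

Lemma ERintegral f : bmf f -> (\int[mu]_x (f x)%:E)%E = (\int[mu]_x f x)%:E.
Proof.
move=> /bmf_integrable fi; rewrite /Rintegral fineK//.
exact: integrable_fin_num.
Qed.

Lemma le_RintegralT f g : bmf f -> bmf g -> (forall x, f x <= g x) ->
  \int[mu]_x f x <= \int[mu]_x g x.
Proof. by move=> bf bg fg; apply: le_Rintegral => //; exact: bmf_integrable. Qed.

Lemma RintegralDT f g : bmf f -> bmf g ->
  \int[mu]_x (f x + g x) = \int[mu]_x f x + \int[mu]_x g x.
Proof. by move=> bf bg; apply: RintegralD => //; exact: bmf_integrable. Qed.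

Lemma RintegralBT f g : bmf f -> bmf g ->
  \int[mu]_x (f x - g x) = \int[mu]_x f x - \int[mu]_x g x.
Proof. by move=> bf bg; apply: RintegralB => //; exact: bmf_integrable. Qed.

Lemma RintegralZT r f : bmf f ->
  \int[mu]_x (r * f x) = r * \int[mu]_x f x.
Proof. by move=> bf; apply: RintegralZl => //; exact: bmf_integrable. Qed.

Lemma Rintegral_sumT (I : Type) (s : seq I) (F : I -> T -> R) :
  (forall i, bmf (F i)) ->
  \int[mu]_x (\sum_(i <- s) F i x) = \sum_(i <- s) \int[mu]_x F i x.
Proof.
move=> bF; elim: s => [|i s IH].
  under eq_Rintegral do rewrite big_nil.
  by rewrite big_nil Rintegral_cst// mul0r.
under eq_Rintegral do rewrite big_cons.
by rewrite big_cons RintegralDT ?IH//; exact: bmf_sum.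
Qed.

Lemma normr_RintegralT f : bmf f ->
  `|\int[mu]_x f x| <= \int[mu]_x `|f x|.
Proof. by move=> bf; apply: le_normr_Rintegral => //; exact: bmf_integrable. Qed.

End bounded_measurable.

Section bounded_measurable_prob.
Context (R : realType) d (T : measurableType d) (P : probability T R).

Lemma Rintegral_cstP (r : R) : \int[P]_x r = r.
Proof. by rewrite Rintegral_cst//= probability_setT mulr1. Qed.

Lemma Rintegral_le_cstP (f : T -> R) r : bmf f -> (forall x, f x <= r) ->
  \int[P]_x f x <= r.
Proof.
move=> bf fr; rewrite -[leRHS]Rintegral_cstP.
by apply: le_RintegralT => //; exact: bmf_cst.
Qed.

Lemma Rintegral_norm_leP (f : T -> R) r : bmf f -> (forall x, `|f x| <= r) ->
  `|\int[P]_x f x| <= r.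
Proof.
move=> bf fr; apply: le_trans (normr_RintegralT _ bf) _.
by apply: Rintegral_le_cstP => //; exact: bmf_norm.
Qed.

End bounded_measurable_prob.

Section bounded_fubini.
Context (R : realType) d1 d2 (S : measurableType d1) (T : measurableType d2).
Variables (mu : {finite_measure set S -> \bar R})
          (nu : {finite_measure set T -> \bar R}).
Variable F : S * T -> R.
Hypothesis bF : bmf F.

Lemma bmf_sectionl x : bmf (fun y => F (x, y)).
Proof. by apply: bmf_comp bF; exact: measurable_pair1. Qed.

Lemma bmf_sectionr y : bmf (fun x => F (x, y)).
Proof. by apply: bmf_comp bF; exact: measurable_pair2. Qed.

Let iF : (mu \x nu)%E.-integrable [set: S * T] (EFin \o F).
Proof.
have [mF [M FM]] := bF; apply: measurable_bounded_integrable => //.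
  rewrite -setXTT. rewrite [ltLHS]product_measure1E// ltey_eq fin_numM ?fin_num_measure//.
exists M; split; first exact: num_real.
by move=> x Mx y _; exact: le_trans (FM y) (ltW Mx).
Qed.

Lemma bmf_Rintegral : bmf (fun x => \int[nu]_y F (x, y)).
Proof.
have [mF [M FM]] := bF.
split.
  have := measurable_fubini_F iF.
  move=> mF'; apply/measurable_EFinP; move: mF'.
  congr (measurable_fun _); apply/funext => x.
  by rewrite /fubini_F /= ERintegral//; exact: bmf_sectionl.
exists (M * fine (nu setT)) => x.
rewrite -(Rintegral_cst nu measurableT) (le_trans (normr_RintegralT _ (bmf_sectionl _)))//.
by apply: le_RintegralT => //; [exact/bmf_norm/bmf_sectionl|exact: bmf_cst].
Qed.

Lemma bmf_Rintegralr : bmf (fun y => \int[mu]_x F (x, y)).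
Proof.
have [mF [M FM]] := bF.
split.
  have := measurable_fubini_G iF.
  move=> mF'; apply/measurable_EFinP; move: mF'.
  congr (measurable_fun _); apply/funext => y.
  by rewrite /fubini_G /= ERintegral//; exact: bmf_sectionr.
exists (M * fine (mu setT)) => y.
rewrite -(Rintegral_cst mu measurableT) (le_trans (normr_RintegralT _ (bmf_sectionr _)))//.
by apply: le_RintegralT => //; [exact/bmf_norm/bmf_sectionr|exact: bmf_cst].
Qed.

Lemma Rintegral_prod :
  \int[(mu \x nu)%E]_z F z = \int[mu]_x \int[nu]_y F (x, y).
Proof.
rewrite /Rintegral; congr fine.
rewrite -(integral12_prod_meas1 iF) /fubini_F /=.
by apply: eq_integral => x _; rewrite ERintegral//; exact: bmf_sectionl.
Qed.

End bounded_fubini.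

Lemma Rintegral_Fubini (R : realType) d1 d2 (S : measurableType d1) (T : measurableType d2)
  (mu : {finite_measure set S -> \bar R}) (nu : {finite_measure set T -> \bar R})
  (F : S * T -> R) : bmf F ->
  \int[mu]_x \int[nu]_y F (x, y) = \int[nu]_y \int[mu]_x F (x, y).
Proof.
move=> bF; rewrite /Rintegral; congr fine.
transitivity (\int[mu]_x \int[nu]_y (F (x, y))%:E)%E.
  by apply: eq_integral => x _; rewrite ERintegral//; exact: bmf_sectionl.
transitivity (\int[nu]_y \int[mu]_x (F (x, y))%:E)%E; last first.
  by apply: eq_integral => x _; rewrite ERintegral//; exact: bmf_sectionr.
apply: (Fubini (f := fun z => (F z)%:E)).
have [mF [M FM]] := bF; apply: measurable_bounded_integrable => //.
  by rewrite -setXTT [ltLHS]product_measure1E// ltey_eq fin_numM ?fin_num_measure.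
exists M; split; first exact: num_real.
by move=> x Mx y _; exact: le_trans (FM y) (ltW Mx).
Qed.

(** * Sign averages and chaining *)

Section exp_inequalities.
Context (R : realType).
Implicit Type x : R.

(** The linear term vanishes on averaging a centred variable, which leaves a sub-Gaussian bound;
    both the sign averages and Hoeffding's lemma rest on this. For x <= 1/2 it follows from exp x <=
    1 / (1 - x) <= 1 + x + 2 x^2, and for x > 1/2 from x <= 2 x^2. *)
Lemma expR_le_DexpR_sqr x : expR x <= x + expR (2 * x ^+ 2).
Proof.
have [xh|xh] := leP x 2^-1.
  have x1 : 0 < 1 - x by lra.
  apply: (@le_trans _ _ (1 + x + 2 * x ^+ 2)); last first.
    by have := expR_ge1Dx (2 * x ^+ 2); lra.
  rewrite -(ler_pM2r x1).
  have h : 1 - x <= expR (- x) := expR_ge1Dx (- x).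
  apply: (@le_trans _ _ 1).
    by rewrite -[leRHS](expRxMexpNx_1 x) ler_wpM2l// expR_ge0.
  have : 0 <= x ^+ 2 * (1 - 2 * x) by rewrite mulr_ge0 ?sqr_ge0//; lra.
  by lra.
have : expR x <= expR (2 * x ^+ 2).
  rewrite ler_expR; have : 0 <= (2 * x - 1) * x by apply: mulr_ge0; lra.
  by lra.
by lra.
Qed.

Lemma coshR_le x : (expR x + expR (- x)) / 2 <= expR (2 * x ^+ 2).
Proof.
have := expR_le_DexpR_sqr x; have := expR_le_DexpR_sqr (- x).
by rewrite sqrrN; lra.
Qed.

Lemma ln_le_id x : 0 < x -> ln x <= x.
Proof.
move=> x0; have : ln (1 + (x - 1)) <= x - 1 by apply: le_ln1Dx; lra.
by rewrite addrC subrK; lra.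
Qed.

Lemma ln2_le1 : ln 2 <= 1 :> R.
Proof. by have := @le_ln1Dx R 1; rewrite (_ : 1 + 1 = 2)//; apply; lra. Qed.

Lemma natr_ln_le n : ln (n%:R : R) <= n%:R.
Proof. by case: n => [|n]; [rewrite ln0|rewrite ln_le_id]. Qed.

End exp_inequalities.

Section sign_average.
Context (R : realType).
Implicit Types (F G : seq R -> R) (e v : seq R) (n : nat).

(** Expectation over n independent uniform signs. The recursion needs no probability space and
    matches inductions that treat one sample point at a time. *)
Fixpoint signavg n F : R :=
  if n is n'.+1 then
    (signavg n' (fun e => F (1 :: e)) + signavg n' (fun e => F (-1 :: e))) / 2
  else F [::].

Definition dotp e v : R := \sum_(p <- zip e v) p.1 * p.2.

Definition signs n e := (size e == n) && all (fun x => `|x| == 1) e.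

Lemma dotp_cons a e b v : dotp (a :: e) (b :: v) = a * b + dotp e v.
Proof. by rewrite /dotp /= big_cons. Qed.

Lemma dotp_nill v : dotp [::] v = 0.
Proof. by rewrite /dotp; case: v => [|a v]; rewrite /= big_nil. Qed.

Lemma dotp_nil e : dotp e [::] = 0.
Proof. by rewrite /dotp; case: e => [|a e]; rewrite /= big_nil. Qed.

Lemma le_signavg n F G : (forall e, signs n e -> F e <= G e) ->
  signavg n F <= signavg n G.
Proof.
elim: n F G => [|n IH] F G FG /=; first exact: FG.
rewrite ler_pM2r ?invr_gt0// lerD//; apply: IH => e; rewrite /signs => /andP[/eqP en h].
  by apply: FG; rewrite /signs /= en h normr1 !eqxx.
by apply: FG; rewrite /signs /= en h normrN normr1 !eqxx.
Qed.

Lemma eq_signavg n F G : F =1 G -> signavg n F = signavg n G.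
Proof. by move=> /funext ->. Qed.

Lemma signavgD n F G :
  signavg n (fun e => F e + G e) = signavg n F + signavg n G.
Proof. by elim: n F G => [//|n IH] F G /=; rewrite !IH -mulrDl addrACA. Qed.

Lemma signavgZ n c F : signavg n (fun e => c * F e) = c * signavg n F.
Proof. by elim: n F => [//|n IH] F /=; rewrite !IH -mulrDr mulrA. Qed.

Lemma signavg_cst n c : signavg n (fun=> c) = c.
Proof. by elim: n => [//|n IH] /=; rewrite !IH; lra. Qed.

Lemma signavg_sum n (I : Type) (s : seq I) (F : I -> seq R -> R) :
  signavg n (fun e => \sum_(i <- s) F i e) = \sum_(i <- s) signavg n (F i).
Proof.
elim: s => [|i s IH].
  by under eq_signavg do rewrite big_nil; rewrite signavg_cst big_nil.
by under eq_signavg do rewrite big_cons; rewrite signavgD IH big_cons.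
Qed.

Lemma signavg_expR (l : R) v :
  signavg (size v) (fun e => expR (l * dotp e v)) <=
  expR (2 * l ^+ 2 * \sum_(x <- v) x ^+ 2).
Proof.
elim: v => [|x v IH] /=; first by rewrite dotp_nil big_nil !mulr0.
under eq_signavg do rewrite dotp_cons mulrDr expRD.
under [X in _ + X]eq_signavg do rewrite dotp_cons mulrDr expRD.
rewrite !signavgZ -mulrDl mulrAC big_cons [in leRHS]mulrDr [in leRHS]expRD mul1r mulN1r mulrN.
apply: ler_pM => //.
- rewrite -(signavg_cst (size v) 0); apply: le_signavg => e _; exact: expR_ge0.
- by rewrite -mulrA -exprMn coshR_le.
Qed.

Lemma signavg_expRN (l : R) v :
  signavg (size v) (fun e => expR (- (l * dotp e v))) <=
  expR (2 * l ^+ 2 * \sum_(x <- v) x ^+ 2).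
Proof.
have := signavg_expR (- l) v; rewrite sqrrN; apply: le_trans.
by under [leRHS]eq_signavg do rewrite mulNr.
Qed.

(* To be optimised over [l]. *)
Lemma massart (Z : finType) n (v : Z -> seq R) (s2 l : R) :
  (0 < #|Z|)%N -> (forall z, size (v z) = n) ->
  (forall z, \sum_(x <- v z) x ^+ 2 <= s2) -> 0 < l ->
  signavg n (fun e => \big[Num.max/0]_z `|dotp e (v z)|) <=
  ln (2 * #|Z|%:R) / l + 2 * l * s2.
Proof.
move=> Z0 vn vs l0.
have Z0' : (0 : R) < 2 * #|Z|%:R by rewrite mulr_gt0// ltr0n.
pose B := 2 * #|Z|%:R * expR (2 * l ^+ 2 * s2).
have B0 : 0 < B by rewrite mulr_gt0 ?expR_gt0.
pose M e := \big[Num.max/0]_z `|dotp e (v z)|.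
pose S e := \sum_(z <- enum Z) (expR (l * dotp e (v z)) + expR (- (l * dotp e (v z)))).
have MS e : expR (l * M e) <= S e.
  have S1 z : expR (l * `|dotp e (v z)|) <= S e.
    rewrite /S big_enum /= (bigD1 z)//= -[leLHS]addr0 lerD//; last first.
      by apply: sumr_ge0 => i _; rewrite addr_ge0 ?expR_ge0.
    have [_|_] := ger0P (dotp e (v z)).
      by rewrite lerDl expR_ge0.
    by rewrite mulrN lerDr expR_ge0.
  have [z _] : exists z : Z, true by move: Z0 => /card_gt0P[z _]; exists z.
  have [z0 _ Mz0] := @eq_bigmax _ R Z 0 z xpredT
    (fun z => `|dotp e (v z)|) isT (fun i _ => normr_ge0 _).
  by rewrite /M Mz0; exact: S1.
have avgS : signavg n S <= B.
  rewrite /S signavg_sum big_enum /=.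
  apply: (@le_trans _ _ (\sum_(z in Z) 2 * expR (2 * l ^+ 2 * s2))); last first.
    by rewrite sumr_const /B -[leLHS]mulr_natr [leLHS]mulrAC lexx.
  apply: ler_sum => z _; rewrite signavgD.
  have h : expR (2 * l ^+ 2 * \sum_(x <- v z) x ^+ 2) <= expR (2 * l ^+ 2 * s2).
    by rewrite ler_expR ler_wpM2l ?vs// mulr_ge0 ?sqr_ge0.
  rewrite mulr2n mulrDl mul1r lerD// -(vn z); apply: le_trans h.
    exact: signavg_expR.
  exact: signavg_expRN.
(* The tangent inequality 1 + u <= exp u at u = l M - ln B takes the place of Jensen's inequality:
   averaging S / B then gives at most 1. *)
have key e : l * M e <= ln B + (B^-1 * S e + -1).
  have : 1 + (l * M e - ln B) <= expR (l * M e - ln B) := expR_ge1Dx _.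
  rewrite expRD expRN lnK ?posrE//.
  have : expR (l * M e) / B <= S e / B by rewrite ler_pM2r ?invr_gt0.
  by rewrite [B^-1 * _]mulrC; lra.
have : signavg n (fun e => l * M e) <= ln B.
  apply: le_trans (le_signavg (fun e _ => key e)) _.
  rewrite !signavgD !signavg_cst signavgZ.
  have : B^-1 * signavg n S <= B^-1 * B by rewrite ler_pM2l ?invr_gt0.
  by rewrite mulVf ?gt_eqF//; lra.
rewrite signavgZ /B lnM ?posrE ?expR_gt0// expRK => h.
rewrite -(ler_pM2l l0); apply: le_trans h _.
rewrite mulrDr [l * (_ / l)]mulrC divfK ?gt_eqF// lerD2l le_eqVlt.
by apply/orP; left; apply/eqP; ring.
Qed.

End sign_average.

Section sigmoid_lemmas.
Context (R : realType).
Implicit Types a b v : R.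

Lemma sigmoid_gt0 v : 0 < sigmoid v.
Proof. by rewrite invr_gt0 ltr_pwDl// expR_ge0. Qed.

Lemma sigmoid_lt1 v : sigmoid v < 1.
Proof. by rewrite invf_lt1 ?ltrDl ?expR_gt0// ltr_pwDl// expR_ge0. Qed.

Lemma sigmoidN v : sigmoid (- v) = 1 - sigmoid v.
Proof.
rewrite /sigmoid opprK.
have e0 : expR v != 0 by rewrite gt_eqF// expR_gt0.
have e1 : 1 + expR v != 0 by rewrite gt_eqF// ltr_pwDl// expR_ge0.
have e2 : expR v + 1 != 0 by rewrite addrC.
by rewrite expRN; field; rewrite ?e0 ?e1 ?e2.
Qed.

Lemma sigmoid_le_expR v : sigmoid v <= expR v.
Proof.
have p : 0 < 1 + expR (- v) by rewrite ltr_pwDl// expR_ge0.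
by rewrite -[leRHS]invrK -expRN lef_pV2 ?posrE ?expR_gt0// lerDr.
Qed.

(** Over a common denominator the numerator is exp (-b) - exp (-a) <= (a - b) exp (-b), and the
    denominator exceeds exp (-b). *)
Lemma sigmoid_sub_le a b : b <= a -> 0 <= sigmoid a - sigmoid b <= a - b.
Proof.
move=> ba; have p c : 0 < 1 + expR (- c) by rewrite ltr_pwDl// expR_ge0.
have e : sigmoid a - sigmoid b =
    (expR (- b) - expR (- a)) / ((1 + expR (- a)) * (1 + expR (- b))).
  by rewrite /sigmoid; field; rewrite !gt_eqF.
have h1 : expR (- a) <= expR (- b) by rewrite ler_expR lerN2.
rewrite e; apply/andP; split.
  by rewrite divr_ge0 ?subr_ge0// mulr_ge0// ltW.
rewrite ler_pdivrMr ?mulr_gt0//.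
have h2 : expR (- b) - expR (- a) <= (a - b) * expR (- b).
  have h3 : 1 + (b - a) <= expR (b - a) := expR_ge1Dx _.
  have : (1 + (b - a)) * expR (- b) <= expR (b - a) * expR (- b).
    by rewrite ler_wpM2r// expR_ge0.
  by rewrite -expRD (_ : b - a - b = - a); [lra|ring].
apply: le_trans h2 _; rewrite ler_wpM2l ?subr_ge0//.
have : 0 < expR (- a) * expR (- b) by rewrite mulr_gt0 ?expR_gt0.
have := expR_gt0 (- a).
lra.
Qed.

Lemma sigmoid_lipschitz a b : `|sigmoid a - sigmoid b| <= `|a - b|.
Proof.
have [ba|ab] := leP b a.
  by have /andP[h1 h2] := sigmoid_sub_le ba; rewrite !ger0_norm// subr_ge0.
rewrite distrC [leRHS]distrC.
have /andP[h1 h2] := sigmoid_sub_le (ltW ab).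
by rewrite !ger0_norm// subr_ge0 ltW.
Qed.

Lemma sigmoid_norm v : `|sigmoid v| <= 1.
Proof. by rewrite ger0_norm ltW ?sigmoid_lt1 ?sigmoid_gt0. Qed.

End sigmoid_lemmas.

Section ridge.
Context (R : realType) (D : nat).
Implicit Types (th x : 'I_D -> R).

Definition ridge th x : R := sigmoid (\sum_j th j * x j).

Lemma ridge_lipschitz th th' x delta : (forall j, `|x j| <= 1) ->
  (forall j, `|th j - th' j| <= delta) ->
  `|ridge th x - ridge th' x| <= D%:R * delta.
Proof.
move=> hx hth; apply: le_trans (sigmoid_lipschitz _ _) _.
rewrite -sumrB; apply: le_trans (ler_norm_sum _ _ _) _.
rewrite (_ : D%:R * delta = \sum_(j < D) delta); last first.
  by rewrite sumr_const card_ord mulr_natl.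
apply: ler_sum => j _; rewrite -mulrBl normrM -[leRHS]mulr1.
by rewrite ler_pM.
Qed.

End ridge.

Section chaining.
Context (R : realType) (D : nat) (T : Type) (xi : T -> 'I_D -> R).
Hypothesis xi1 : forall x j, `|xi x j| <= 1.
Variables (a : R) (A : nat).
Hypothesis A0 : (0 < A)%N.

Definition grid (l : nat) := {ffun 'I_D -> 'I_(A * 2 ^ l)}.

(** Mesh 2^-l from -a on, over a length A, so that [-a, a] is covered once A > 2 a. Points beyond a
    are harmless, as the bound on a ridge function does not depend on its weights. *)
Definition gridpt l (z : grid l) (j : 'I_D) : R := (z j)%:R / 2 ^+ l - a.

Lemma half_grid_subproof l (i : 'I_(A * 2 ^ l.+1)) : (i./2 < A * 2 ^ l)%N.
Proof.
by rewrite -ltn_double -[ltnRHS]mul2n mulnCA -expnS (leq_ltn_trans _ (ltn_ord i))//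
  -{2}(odd_double_half i) leq_addl.
Qed.

(** The link of the chain: dropping the last binary digit of each index rounds down to the coarser
    grid. *)
Definition half_grid l (z : grid l.+1) : grid l :=
  [ffun j => Ordinal (half_grid_subproof (z j))].

Lemma half_gridP l (z : grid l.+1) j :
  `|gridpt z j - gridpt (half_grid z) j| <= (2 ^+ l.+1)^-1.
Proof.
rewrite /gridpt ffunE /=.
have -> : (z j)%:R = (odd (z j))%:R + 2 * ((z j)./2)%:R :> R.
  by rewrite -[in LHS](odd_double_half (z j)) natrD -mul2n natrM.
have p : (2 ^+ l : R) != 0 by rewrite gt_eqF// exprn_gt0.
rewrite exprS (_ : _ - _ = (odd (z j))%:R / (2 * 2 ^+ l)); last by field.
have h : 0 < (2 * 2 ^+ l : R) by rewrite mulr_gt0// exprn_gt0.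
rewrite normrM [X in _ * X]gtr0_norm ?invr_gt0// ler_piMl ?invr_ge0 ?(ltW h)//.
by case: odd; rewrite ?normr1 ?normr0.
Qed.

Lemma card_grid l : #|{: grid l}| = ((A * 2 ^ l) ^ D)%N.
Proof. by rewrite card_ffun !card_ord. Qed.

(** Linear growth in [l] is what makes the chaining series with weights 2^-l converge. Bounding ln A
    by A is crude, but costs only a factor sqrt A in the end, which the target rate allows. *)
Lemma ln_card_grid l : ln (2 * #|{: grid l}|%:R : R) <= D.+1%:R * A%:R * (l%:R + 2).
Proof.
have A1 : (1 : R) <= A%:R by rewrite ler1n.
have l2 := ln2_le1 R.
have p2 : (0 : R) < 2 ^+ l by rewrite exprn_gt0.
rewrite card_grid natrX natrM natrX lnM ?posrE ?exprn_gt0 ?mulr_gt0//; try lra.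
rewrite lnXn ?mulr_gt0//; last lra.
rewrite lnM ?posrE//; last lra.
rewrite lnXn// -[_ *+ D]mulr_natl -[_ *+ l]mulr_natl.
have lA : ln (A%:R : R) <= A%:R by exact: natr_ln_le.
have ll : l%:R * ln 2 <= (l%:R : R) by rewrite ler_piMr.
have l0 : (0 : R) <= l%:R by [].
have D0 : (0 : R) <= D%:R by [].
have h : D%:R * (ln A%:R + l%:R * ln 2) <= D%:R * (A%:R * (l%:R + 2) : R).
  by rewrite ler_wpM2l//; nra.
rewrite -[D.+1]addn1 natrD; nra.
Qed.

Definition ridge_sum (th : 'I_D -> R) (xs : seq T) (e : seq R) : R :=
  dotp e [seq ridge th (xi x) | x <- xs].

Lemma dotpB e (f g : T -> R) xs :
  dotp e [seq f x | x <- xs] - dotp e [seq g x | x <- xs] =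
  dotp e [seq f x - g x | x <- xs].
Proof.
elim: e xs => [|b e IH] [|x xs]; rewrite /= ?dotp_nill ?dotp_nil ?subr0//.
by rewrite !dotp_cons -IH; ring.
Qed.

Lemma dotpZ (c : R) e (f : T -> R) xs :
  dotp e [seq c * f x | x <- xs] = c * dotp e [seq f x | x <- xs].
Proof.
elim: e xs => [|b e IH] [|x xs]; rewrite /= ?dotp_nill ?dotp_nil ?mulr0//.
by rewrite !dotp_cons IH; ring.
Qed.

Lemma dotp0 e (xs : seq T) : dotp e [seq (0 : R) | x <- xs] = 0.
Proof.
elim: e xs => [|b e IH] [|x xs]; rewrite /= ?dotp_nill ?dotp_nil//.
by rewrite dotp_cons IH mulr0 addr0.
Qed.

Lemma dotpD e (f g : T -> R) xs :
  dotp e [seq f x | x <- xs] + dotp e [seq g x | x <- xs] =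
  dotp e [seq f x + g x | x <- xs].
Proof.
elim: e xs => [|b e IH] [|x xs]; rewrite /= ?dotp_nill ?dotp_nil ?addr0//.
by rewrite !dotp_cons -IH; ring.
Qed.

Lemma sum_sqr_le (f : T -> R) xs (c : R) : (forall x, `|f x| <= c) ->
  \sum_(y <- [seq f x | x <- xs]) y ^+ 2 <= (size xs)%:R * c ^+ 2.
Proof.
move=> fc; rewrite big_map; elim: xs => [|x xs IH] /=.
  by rewrite big_nil mul0r.
rewrite big_cons -natr1 mulrDl mul1r addrC lerD//.
by rewrite -real_normK ?num_real// ler_pXn2r ?nnegrE// (le_trans _ (fc x)).
Qed.

Let maxsum l xs := signavg (size xs)
  (fun e => \big[Num.max/0]_(z : grid l) `|ridge_sum (gridpt z) xs e|).

Lemma grid_card_gt0 l : (0 < #|{: grid l}|)%N.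
Proof. by rewrite card_grid expn_gt0 muln_gt0 A0 expn_gt0. Qed.

(** Each fine sum is its coarse neighbour plus an increment. The increments take finitely many
    values, and by the Lipschitz bound each of their terms is at most D 2^-(l+1). *)
Lemma chaining_step l xs : (0 < size xs)%N ->
  maxsum l.+1 xs <= maxsum l xs +
    D.+1%:R ^+ 2 * Num.sqrt (size xs)%:R * Num.sqrt A%:R * (l%:R + 5) / 2 ^+ l.+1.
Proof.
move=> n0; set n := (size xs)%:R : R.
have n0' : 0 < n by rewrite ltr0n.
have A0' : (0 : R) < A%:R by rewrite ltr0n.
pose v (z : grid l.+1) :=
  [seq ridge (gridpt z) (xi x) - ridge (gridpt (half_grid z)) (xi x) | x <- xs].
have h1 : maxsum l.+1 xs <= maxsum l xs +
    signavg (size xs) (fun e => \big[Num.max/0]_z `|dotp e (v z)|).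
  rewrite /maxsum -signavgD; apply: le_signavg => e _.
  apply: bigmax_le => [|z _].
    by rewrite addr_ge0// bigmax_ge_id.
  rewrite -[ridge_sum (gridpt z) xs e](subrK (ridge_sum (gridpt (half_grid z)) xs e)).
  apply: le_trans (ler_normD _ _) _; rewrite addrC lerD//.
    by rewrite (le_bigmax 0 (fun z => `|ridge_sum (gridpt z) xs e|) (half_grid z)).
  rewrite /ridge_sum dotpB.
  exact: (le_bigmax 0 (fun z => `|dotp e (v z)|) z).
apply: le_trans h1 _; rewrite lerD2l.
pose d : R := D.+1%:R / 2 ^+ l.+1.
have d0 : 0 < d by rewrite divr_gt0 ?exprn_gt0.
have sn : 0 < Num.sqrt n by rewrite sqrtr_gt0.
have sA : 0 < Num.sqrt A%:R :> R by rewrite sqrtr_gt0.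
(* The parameter of [massart]: with log-cardinality of order A and variance n d^2 it makes both
   terms of the bound of order sqrt (A n) d. The use of D + 1 in place of D keeps [d] positive. *)
have l0 : 0 < Num.sqrt A%:R / (Num.sqrt n * d) by rewrite divr_gt0// mulr_gt0.
have vs z : \sum_(x <- v z) x ^+ 2 <= n * d ^+ 2.
  apply: sum_sqr_le => x.
  apply: (@le_trans _ _ (D%:R * (2 ^+ l.+1)^-1)).
    by apply: ridge_lipschitz => // j; exact: half_gridP.
  by rewrite /d ler_wpM2r ?invr_ge0 ?exprn_ge0// ler_nat.
have vn z : size (v z) = size xs by rewrite size_map.
apply: le_trans (massart (grid_card_gt0 l.+1) vn vs l0) _.
have := ln_card_grid l.+1.
set L := ln _ => hL.
have e1 : n = Num.sqrt n ^+ 2 by rewrite sqr_sqrtr// ltW.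
have eA : A%:R = Num.sqrt A%:R ^+ 2 :> R by rewrite sqr_sqrtr// ltW.
have -> : 2 * (Num.sqrt A%:R / (Num.sqrt n * d)) * (n * d ^+ 2) =
    2 * Num.sqrt n * Num.sqrt A%:R * d.
  rewrite [in X in _ * X]e1; field.
  by rewrite !gt_eqF.
have h2 : L / (Num.sqrt A%:R / (Num.sqrt n * d)) <=
    D.+1%:R * (l%:R + 3) * Num.sqrt n * Num.sqrt A%:R * d.
  rewrite ler_pdivrMr//; apply: le_trans hL _.
  rewrite {1}eA le_eqVlt; apply/orP; left; apply/eqP; rewrite -[l.+1%:R]natr1; field.
  by rewrite !gt_eqF.
apply: le_trans (lerD h2 (lexx _)) _.
have D1 : (1 : R) <= D.+1%:R by rewrite ler1n.
have -> : D.+1%:R ^+ 2 * Num.sqrt n * Num.sqrt A%:R * (l%:R + 5) / 2 ^+ l.+1 =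
   D.+1%:R * (l%:R + 5) * Num.sqrt n * Num.sqrt A%:R * d by rewrite /d; ring.
rewrite (_ : _ + _ = (D.+1%:R * (l%:R + 3) + 2) * Num.sqrt n * Num.sqrt A%:R * d); last by ring.
rewrite !ler_pM2r//.
have : (0:R) <= l%:R by []. 
by nra.
Qed.

Lemma chaining0 xs : (0 < size xs)%N ->
  maxsum 0 xs <= (2 * D.+1%:R + 2) * Num.sqrt (size xs)%:R * Num.sqrt A%:R.
Proof.
move=> n0; set n := (size xs)%:R : R.
have n0' : 0 < n by rewrite ltr0n.
have A0' : (0 : R) < A%:R by rewrite ltr0n.
have sn : 0 < Num.sqrt n by rewrite sqrtr_gt0.
have sA : 0 < Num.sqrt A%:R :> R by rewrite sqrtr_gt0.
have l0 : 0 < Num.sqrt A%:R / Num.sqrt n by rewrite divr_gt0.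
have vs (z : grid 0) : \sum_(x <- [seq ridge (gridpt z) (xi x) | x <- xs]) x ^+ 2 <= n * 1 ^+ 2.
  by apply: sum_sqr_le => x; exact: sigmoid_norm.
have vn (z : grid 0) : size [seq ridge (gridpt z) (xi x) | x <- xs] = size xs.
  by rewrite size_map.
apply: le_trans (massart (grid_card_gt0 0) vn vs l0) _.
have := ln_card_grid 0.
set L := ln _ => hL.
have e1 : n = Num.sqrt n ^+ 2 by rewrite sqr_sqrtr// ltW.
have eA : A%:R = Num.sqrt A%:R ^+ 2 :> R by rewrite sqr_sqrtr// ltW.
have -> : 2 * (Num.sqrt A%:R / Num.sqrt n) * (n * 1 ^+ 2) =
    2 * Num.sqrt n * Num.sqrt A%:R.
  by rewrite [in X in _ * X]e1; field; rewrite !gt_eqF.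
have h2 : L / (Num.sqrt A%:R / Num.sqrt n) <=
    2 * D.+1%:R * Num.sqrt n * Num.sqrt A%:R.
  rewrite ler_pdivrMr//; apply: le_trans hL _.
  rewrite {1}eA le_eqVlt; apply/orP; left; apply/eqP; field.
  by rewrite !gt_eqF.
apply: le_trans (lerD h2 (lexx _)) _.
by rewrite le_eqVlt; apply/orP; left; apply/eqP; ring.
Qed.

(** Dominates 2 (D + 1) + 2 from level 0 plus 6 (D + 1)^2 from all the increments. *)
Definition chain_cst : R := 10 * D.+1%:R ^+ 2.

(* [\sum_(k < l) (k + 5) / 2 ^ k.+1 = 6 - (l + 6) / 2 ^ l] *)
Lemma chaining l xs : (0 < size xs)%N ->
  signavg (size xs)
    (fun e => \big[Num.max/0]_(z : grid l) `|ridge_sum (gridpt z) xs e|) <=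
  chain_cst * Num.sqrt (size xs)%:R * Num.sqrt A%:R.
Proof.
move=> n0; rewrite -/(maxsum l xs).
set c := Num.sqrt (size xs)%:R * Num.sqrt A%:R : R.
have c0 : 0 <= c by rewrite mulr_ge0 ?sqrtr_ge0.
have D1 : (1 : R) <= D.+1%:R by rewrite ler1n.
have h : maxsum l xs <= (2 * D.+1%:R + 2 + D.+1%:R ^+ 2 * (6 - (l%:R + 6) / 2 ^+ l)) * c.
  elim: l => [|l IH].
    by rewrite expr0 divr1 add0r subrr mulr0 addr0 /c mulrA chaining0.
  apply: le_trans (chaining_step _ n0) _; apply: le_trans (lerD IH (lexx _)) _.
  have p : (2 ^+ l : R) != 0 by rewrite gt_eqF// exprn_gt0.
  rewrite le_eqVlt; apply/orP; left; apply/eqP.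
  by rewrite [2 ^+ l.+1]exprS -[l.+1%:R]natr1 /c; field.
apply: le_trans h _; rewrite /chain_cst -[leRHS]mulrA ler_wpM2r//.
have : 0 <= D.+1%:R ^+ 2 * ((l%:R + 6) / 2 ^+ l) :> R.
  by rewrite mulr_ge0 ?sqr_ge0// divr_ge0 ?exprn_ge0// addr_ge0.
by nra.
Qed.

End chaining.

(** * Empirical processes *)

Section iid_law.
Context dO dT (Omega : measurableType dO) (T : measurableType dT) (R : realType).
Variables (Pr : probability Omega R) (P : probability T R).
Variable X : nat -> {RV Pr >-> T}.
Hypothesis hX : iid_from P X.

(** The newest observation comes first, so the head of the tuple is independent of its tail. *)
Fixpoint sample n (w : Omega) : n.-tuple T :=
  if n is n'.+1 then [the n'.+1.-tuple T of X n' w :: sample n' w] else [tuple].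

Lemma measurable_sample n : measurable_fun [set: Omega] (sample n).
Proof.
elim: n => [|n IH] /=; last exact: measurable_cons.
exact: measurable_cst.
Qed.

HB.instance Definition _ n :=
  isMeasurableFun.Build _ _ _ _ (sample n) (@measurable_sample n).

Definition sample_law n : probability (n.-tuple T) R := distribution Pr (sample n).

Let cylinder (A : nat -> set T) (J : {fset nat}) : set Omega :=
  \bigcap_(i in [set` J]) (X i @^-1` A i).

Let measurable_cylinder A J : (forall i, measurable (A i)) ->
  measurable (cylinder A J).
Proof.
move=> mA; apply: fin_bigcap_measurable => // i _.
by rewrite -[X in measurable X]setTI; exact: measurable_funP.
Qed.

Definition pair_sample n (w : Omega) := (X n w, sample n w).

Lemma measurable_pair_sample n : measurable_fun [set: Omega] (pair_sample n).
Proof. by apply: measurable_fun_pair => //; exact: measurable_sample. Qed.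

HB.instance Definition _ n :=
  isMeasurableFun.Build _ _ _ _ (pair_sample n) (@measurable_pair_sample n).

Let Pr_cylinder1 A J n B : (forall i, measurable (A i)) -> measurable B ->
  (forall i, i \in J -> (n < i)%N) ->
  exists A', [/\ forall i, measurable (A' i),
    cylinder A J `&` X n @^-1` B = cylinder A' (n |` J)%fset &
    Pr (cylinder A' (n |` J)%fset) = (Pr (cylinder A J) * P B)%E].
Proof.
move=> mA mB nJ; exists (fun i => if i == n then B else A i).
have nJn : n \notin J by apply/negP => /nJ; rewrite ltnn.
have mA' i : measurable (if i == n then B else A i) by case: ifP.
split=> //.
  rewrite predeqE => w; split => [[h1 h2] i /=|h].
    rewrite !inE => /predU1P[->|hi]; first by rewrite eqxx.
    by rewrite (gtn_eqF (nJ _ hi)); exact: h1.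
  split; last by have := h n; rewrite /= !inE eqxx => /(_ isT).
  move=> i /= hi; have := h i.
  by rewrite /= !inE hi orbT (gtn_eqF (nJ _ hi)) => /(_ isT).
have [indep distr] := hX.
rewrite /cylinder !indep// big_fsetU1//= eqxx muleC; congr (_ * _)%E; last first.
  exact: distr.
by apply: eq_big_seq => i /nJ /gtn_eqF ->.
Qed.

(** Condition [Pr] on the cylinder, unless its probability is 0, and push it forward by
    [pair_sample]. On a rectangle, the constraint on X_n joins the cylinder and the hypothesis at
    [n] applies, so the image agrees there with the product measure, hence everywhere. *)
Let indep_pair n : (forall A J (B : set (n.-tuple T)),
    (forall i, measurable (A i)) -> measurable B ->
    (forall i, i \in J -> (n <= i)%N) ->
    Pr (cylinder A J `&` sample n @^-1` B) =
    (Pr (cylinder A J) * sample_law n B)%E) ->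
  forall A J (B : set (T * n.-tuple T)),
    (forall i, measurable (A i)) -> measurable B ->
    (forall i, i \in J -> (n < i)%N) ->
    Pr (cylinder A J `&` pair_sample n @^-1` B) =
    (Pr (cylinder A J) * (P \x sample_law n) B)%E.
Proof.
move=> IH A J B mA mB nJ.
have mE : measurable (cylinder A J) by exact: measurable_cylinder.
have [E0|E0] := eqVneq (Pr (cylinder A J)) 0%E.
  rewrite E0 mul0e; apply: (@subset_measure0 _ _ _ Pr _ (cylinder A J)) => //.
  apply: measurableI => //; rewrite -[X in measurable X]setTI.
  exact: measurable_pair_sample.
have Efin : Pr (cylinder A J) \is a fin_num by exact: fin_num_measure.
have E_gt0 : (0 < fine (Pr (cylinder A J)))%R.
  by rewrite fine_gt0// lt0e E0 measure_ge0 ltey_eq Efin.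
have c_ge0 : (0 <= (fine (Pr (cylinder A J)))^-1)%R by rewrite invr_ge0 ltW.
pose m'0 : {measure set (T * n.-tuple T) -> \bar R} :=
  mscale (NngNum c_ge0) (pushforward (mrestr Pr mE) (pair_sample n)).
pose m' := m'0 (@measurable_pair_sample n).
have m'E C : m' C = ((fine (Pr (cylinder A J)))^-1%:E *
    Pr (pair_sample n @^-1` C `&` cylinder A J))%E by [].
rewrite -(fineK Efin) setIC.
rewrite (product_measure_unique (m' := m'))//.
  by rewrite m'E muleA -EFinM divff ?mul1e// gt_eqF.
move=> C D mC mD; rewrite m'E.
have [A' [mA' eA' PrA']] := Pr_cylinder1 mA mC nJ.
rewrite setIC (_ : _ `&` _ = cylinder A' (n |` J)%fset `&` sample n @^-1` D); last first.
  by rewrite -eA' -setIA.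
rewrite IH//; last first.
  by move=> i; rewrite !inE => /predU1P[->//|/nJ/ltnW].
by rewrite PrA' -(fineK Efin) !muleA -EFinM mulVf ?mul1e// gt_eqF.
Qed.

(** Independence from every cylinder over the indices from [n] on, and not merely the law of the
    sample, is the invariant that survives the induction: at each step X_n moves from the cylinder
    into the sample. *)
Let indep_sample n : forall A J (B : set (n.-tuple T)),
    (forall i, measurable (A i)) -> measurable B ->
    (forall i, i \in J -> (n <= i)%N) ->
    Pr (cylinder A J `&` sample n @^-1` B) =
    (Pr (cylinder A J) * sample_law n B)%E.
Proof.
elim: n => [|n IH] A J B mA mB nJ.
  have -> : sample_law 0 B = Pr (sample 0 @^-1` B) by [].
  have [h|h] := pselect (B [tuple]).
    rewrite (_ : sample 0 @^-1` B = setT) ?setIT ?probability_setT ?mule1//.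
    by rewrite -subTset.
  rewrite (_ : sample 0 @^-1` B = set0) ?setI0 ?measure0 ?mule0//.
  by rewrite -subset0.
have mB' : measurable ((fun z : T * n.-tuple T => [the n.+1.-tuple T of z.1 :: z.2]) @^-1` B).
  rewrite -[X in measurable X]setTI; apply: measurable_cons => //.
have eB : sample n.+1 @^-1` B = pair_sample n @^-1`
   ((fun z : T * n.-tuple T => [the n.+1.-tuple T of z.1 :: z.2]) @^-1` B) by [].
rewrite eB (indep_pair IH)//; congr (_ * _)%E.
have := indep_pair IH (A := fun=> setT) (J := fset0) _ mB' _.
have -> : sample_law n.+1 B = Pr (pair_sample n @^-1`
   ((fun z : T * n.-tuple T => [the n.+1.-tuple T of z.1 :: z.2]) @^-1` B)) by [].
rewrite (_ : cylinder _ _ = setT) ?setTI; last first.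
  by rewrite -subTset => w _ i /=; rewrite inE.
by rewrite probability_setT mul1e => ->.
Qed.

Lemma pair_law n (B : set (T * n.-tuple T)) : measurable B ->
  Pr (pair_sample n @^-1` B) = (P \x sample_law n)%E B.
Proof.
move=> mB; have := indep_pair (@indep_sample n) (A := fun=> setT) (J := fset0) _ mB _.
rewrite (_ : cylinder _ _ = setT) ?setTI; last first.
  by rewrite -subTset => w _ i /=; rewrite inE.
by rewrite probability_setT mul1e => ->.
Qed.

Lemma Rintegral_sample_law n (F : n.-tuple T -> R) : bmf F ->
  \int[sample_law n]_s F s = \int[Pr]_w F (sample n w).
Proof.
move=> bF; rewrite /Rintegral; congr fine.
have [mF _] := bF.
rewrite integral_pushforward//; first exact/measurable_EFinP.
apply: bmf_integrable.
by apply: bmf_comp bF; exact: measurable_sample.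
Qed.

Lemma measurable_consp n : measurable_fun [set: T * n.-tuple T]
  (fun z : T * n.-tuple T => [the n.+1.-tuple T of z.1 :: z.2]).
Proof. exact: measurable_cons. Qed.

Lemma bmf_cons n (F : n.+1.-tuple T -> R) : bmf F ->
  bmf (fun z : T * n.-tuple T => F [the n.+1.-tuple T of z.1 :: z.2]).
Proof. by move=> bF; apply: bmf_comp bF; exact: measurable_consp. Qed.

Lemma sample_lawS n (F : n.+1.-tuple T -> R) : bmf F ->
  \int[sample_law n.+1]_s F s =
  \int[P]_x \int[sample_law n]_s F [the n.+1.-tuple T of x :: s].
Proof.
move=> bF; rewrite -(Rintegral_prod P (sample_law n) (bmf_cons bF)).
rewrite Rintegral_sample_law//.
transitivity (\int[distribution Pr (pair_sample n)]_z
    F [the n.+1.-tuple T of z.1 :: z.2]).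
  rewrite /Rintegral; congr fine.
  rewrite integral_pushforward//.
  - by apply/measurable_EFinP; case: (bmf_cons bF).
  - apply: bmf_integrable.
    by apply: bmf_comp bF; exact: (@measurable_sample n.+1).
rewrite /Rintegral; congr fine; apply: eq_measure_integral => B mB _.
exact: pair_law.
Qed.

End iid_law.

(** * Finite maxima, contraction and symmetrisation *)

Section fmax.
Context (R : realType) (I : finType) (i0 : I).
Implicit Types F G : I -> R.

(** Starting from the value at [i0] rather than from 0 keeps the maximum attained even when all
    values are negative; the contraction argument compares maximisers. *)
Definition fmax F := \big[Num.max/F i0]_i F i.

Lemma le_fmax F i : F i <= fmax F.
Proof. exact: le_bigmax. Qed.

Lemma fmax_le F c : (forall i, F i <= c) -> fmax F <= c.
Proof. by move=> Fc; apply: bigmax_le. Qed.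

Lemma fmax_attained F : exists i, fmax F = F i.
Proof.
rewrite /fmax; apply: (big_ind (fun r => exists i, r = F i)); first by exists i0.
  by move=> _ _ [i ->] [j ->]; rewrite maxEle; case: ifP => _; [exists j|exists i].
by move=> i _; exists i.
Qed.

Lemma le_fmax2 F G c : (forall i, F i <= G i + c) -> fmax F <= fmax G + c.
Proof. by move=> FG; apply: fmax_le => i; rewrite (le_trans (FG i))// lerD2r le_fmax. Qed.

End fmax.

Lemma bmf_fmax (R : realType) d (T : measurableType d) (I : finType) (i0 : I)
  (F : I -> T -> R) : (forall i, bmf (F i)) -> bmf (fun x => fmax i0 (F ^~ x)).
Proof. by move=> bF; exact: bmf_bigmax. Qed.

Lemma bmf_tuple_sum (R : realType) d (T : measurableType d) n (k : T -> R) :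
  bmf k -> bmf (fun s : n.-tuple T => \sum_(y <- s) k y).
Proof.
move=> bk; under eq_fun do rewrite big_tuple.
by apply: bmf_sum => i; apply: bmf_comp bk; exact: measurable_tnth.
Qed.

Definition lipschitz_cst (R : realType) (phi : R -> R) (L : R) :=
  forall u v, `|phi u - phi v| <= L * `|u - v|.

(* [C + phi v] and [C - phi v] cannot both profit from [phi] unless the two maximisers are
   far apart. *)
Lemma contraction_step (R : realType) (I : finType) (i0 : I) (C v : I -> R) phi L :
  0 <= L -> lipschitz_cst phi L ->
  fmax i0 (fun i => C i + phi (v i)) + fmax i0 (fun i => C i - phi (v i)) <=
  fmax i0 (fun i => C i + L * v i) + fmax i0 (fun i => C i - L * v i).
Proof.
move=> L0 phiL.
have [i ->] := fmax_attained i0 (fun i => C i + phi (v i)).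
have [j ->] := fmax_attained i0 (fun i => C i - phi (v i)).
have := phiL (v i) (v j); rewrite ler_norml => /andP[_ hL].
have [vij|vij] := leP (v j) (v i).
  have h1 := le_fmax i0 (fun i => C i + L * v i) i.
  have h2 := le_fmax i0 (fun i => C i - L * v i) j.
  by rewrite ger0_norm ?subr_ge0// in hL; lra.
have h1 := le_fmax i0 (fun i => C i + L * v i) j.
have h2 := le_fmax i0 (fun i => C i - L * v i) i.
by rewrite ltr0_norm ?subr_lt0// in hL; lra.
Qed.

(** All that the empirical process bounds use of the i.i.d. assumption: one coordinate at a time can
    be integrated out against [P]. *)
Definition iterated_law (R : realType) d (T : measurableType d) (P : probability T R)
    (L : forall n, probability (n.-tuple T) R) :=
  forall n (F : n.+1.-tuple T -> R), bmf F ->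
    \int[L n.+1]_s F s = \int[P]_x \int[L n]_s F [the n.+1.-tuple T of x :: s].

Section empirical_process.
Context (R : realType) d (T : measurableType d) (P : probability T R).
Variable Lw : forall n, probability (n.-tuple T) R.
Hypothesis LwS : iterated_law P Lw.

Lemma bmf_consz n (F : n.+1.-tuple T -> R) : bmf F ->
  bmf (fun z : T * n.-tuple T => F [the n.+1.-tuple T of z.1 :: z.2]).
Proof. by move=> bF; apply: bmf_comp bF; exact: measurable_consp. Qed.

Lemma iterated_lawC n (F : n.+1.-tuple T -> R) : bmf F ->
  \int[Lw n.+1]_s F s = \int[Lw n]_s \int[P]_x F [the n.+1.-tuple T of x :: s].
Proof. by move=> bF; rewrite LwS// (Rintegral_Fubini _ _ (bmf_consz bF)). Qed.

Section symmetrization.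
Variables (I : finType) (i0 : I) (g : I -> T -> R) (phi : R -> R) (L : R).
Hypotheses (bg : forall i, bmf (g i)) (L0 : 0 <= L) (phiL : lipschitz_cst phi L).
Hypothesis bphi : forall i, bmf (fun x => phi (g i x)).

Let m i := \int[P]_x phi (g i x).
Let dev i x := phi (g i x) - m i.

Let bdev i : bmf (dev i).
Proof. exact/bmfB/bmf_cst. Qed.

Let bmf_gmax (C : I -> R) c : bmf (fun x => fmax i0 (fun i => C i + c * g i x)).
Proof. by apply: bmf_fmax => i; apply: bmfD; [exact: bmf_cst|exact: bmfZ]. Qed.

Let bmf_phimax (C : I -> R) c : bmf (fun x => fmax i0 (fun i => C i + c * phi (g i x))).
Proof. by apply: bmf_fmax => i; apply: bmfD; [exact: bmf_cst|exact: bmfZ]. Qed.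

Let bmf_devmax (C : I -> R) : bmf (fun x => fmax i0 (fun i => C i + dev i x)).
Proof. by apply: bmf_fmax => i; apply: bmfD; [exact: bmf_cst|exact: bdev]. Qed.

Let symm x (C : I -> R) := 2^-1 * (fmax i0 (fun i => C i + (2 * L) * g i x) +
      fmax i0 (fun i => C i + (- (2 * L)) * g i x)).

(* Splitting [C + phi - m] as the mean of [C + 2 phi] and [C - 2 m] symmetrises without a
   ghost sample. *)
Lemma symmetrization_step (C : I -> R) :
  \int[P]_x fmax i0 (fun i => C i + dev i x) <= \int[P]_x symm x C.
Proof.
pose A := \int[P]_x fmax i0 (fun i => C i + - 2 * phi (g i x)).
have bA := bmf_phimax C (- 2).
have b2 := bmf_phimax C 2.
apply: (@le_trans _ _ (\int[P]_x (2^-1 * (fmax i0 (fun i => C i + 2 * phi (g i x)) + A)))).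
  apply: le_RintegralT => //; first by apply/bmfZ/bmfD; [exact: b2|exact: bmf_cst].
  move=> x; apply: fmax_le => i.
  have h1 := le_fmax i0 (fun i => C i + 2 * phi (g i x)) i.
  have h2 : C i - 2 * m i <= A.
    rewrite /m -RintegralZT// -[X in X - _](Rintegral_cstP P) -RintegralBT//; last 2 first.
    - exact: bmf_cst.
    - exact: bmfZ.
    apply: le_RintegralT => //.
      by apply: bmfB; [exact: bmf_cst|exact: bmfZ].
    move=> y; have := le_fmax i0 (fun i => C i + - 2 * phi (g i y)) i.
    by rewrite mulNr.
  by rewrite /dev; lra.
rewrite RintegralZT ?RintegralDT ?Rintegral_cstP//; [|exact: bmf_cst|exact/bmfD/bmf_cst].
rewrite /A -RintegralDT// -RintegralZT//; last exact: bmfD.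
apply: le_RintegralT; [exact/bmfZ/bmfD|exact/bmfZ/bmfD|].
move=> x; rewrite /symm ler_pM2l//.
have L20 : 0 <= 2 * L by rewrite mulr_ge0.
have phiL2 : lipschitz_cst (fun u => 2 * phi u) (2 * L).
  by move=> u v; rewrite -mulrBr normrM ger0_norm// -mulrA ler_wpM2l.
have := contraction_step i0 C (g ^~ x) L20 phiL2.
rewrite /=.
have e1 : (fun i => C i - 2 * phi (g i x)) = (fun i => C i + - 2 * phi (g i x)).
  by apply/funext => i; rewrite mulNr.
have e2 : (fun i => C i - 2 * L * g i x) = (fun i => C i + (- (2 * L)) * g i x).
  by apply/funext => i; rewrite mulNr.
by rewrite e1 e2.
Qed.

Let bmf_sampmax n (C : I -> R) :
  bmf (fun s : n.-tuple T => fmax i0 (fun i => C i + \sum_(y <- s) dev i y)).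
Proof.
by apply: bmf_fmax => i; apply: bmfD; [exact: bmf_cst|exact: bmf_tuple_sum].
Qed.

Let shift c x (C : I -> R) := fun i => C i + c * g i x.

(** Integrating out one sample point replaces each offset C by the mean over the two shifts C + 2 L
    g(x) and C - 2 L g(x), that is, over one sign. A single offset would not be stable under this,
    so the induction carries a list, which doubles in length at each step while K doubles too. *)
Lemma symmetrization n (cs : seq (I -> R)) K :
  (forall xs, size xs = n -> \sum_(C <- cs) signavg n (fun e =>
     fmax i0 (fun i => C i + 2 * L * dotp e [seq g i x | x <- xs])) <= K) ->
  \sum_(C <- cs) \int[Lw n]_s fmax i0 (fun i => C i + \sum_(y <- s) dev i y) <= K.
Proof.
elim: n cs K => [|n IH] cs K h.
  have := h [::] erefl; apply: le_trans; apply: ler_sum => C _ /=.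
  apply: Rintegral_le_cstP => [|s]; first exact: bmf_sampmax.
  rewrite (tuple0 s) /=.
  apply: fmax_le => i; rewrite big_nil dotp_nil mulr0.
  exact: (le_fmax i0 (fun i => C i + 0)).
pose G (C : I -> R) (z : T * n.-tuple T) :=
  2^-1 * (fmax i0 (fun i => shift (2 * L) z.1 C i + \sum_(y <- z.2) dev i y) +
          fmax i0 (fun i => shift (- (2 * L)) z.1 C i + \sum_(y <- z.2) dev i y)).
have b1 c C i : bmf (fun z : T * n.-tuple T =>
    shift c z.1 C i + \sum_(y <- z.2) dev i y).
  apply: bmfD; last exact: (bmf_comp measurable_snd (bmf_tuple_sum n (bdev i))).
  by apply: bmfD; [exact: bmf_cst|apply: bmfZ; exact: (bmf_comp measurable_fst (bg i))].
have bG C : bmf (G C) by apply/bmfZ/bmfD; exact: bmf_fmax.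
have step C : \int[Lw n.+1]_s fmax i0 (fun i => C i + \sum_(y <- s) dev i y) <=
    \int[P]_x \int[Lw n]_s G C (x, s).
  rewrite iterated_lawC//.
  rewrite (Rintegral_Fubini P (Lw n) (bG C)).
  have bF := bmf_consz (@bmf_sampmax n.+1 C).
  apply: le_RintegralT.
  - exact: (bmf_Rintegralr P (Lw n) bF).
  - exact: (bmf_Rintegralr P (Lw n) (bG C)).
  move=> s.
  have -> : (fun x => fmax i0 (fun i => C i + \sum_(y <- x :: s) dev i y)) =
            (fun x => fmax i0 (fun i => (C i + \sum_(y <- s) dev i y) + dev i x)).
    apply/funext => x; congr (fmax i0); apply/funext => i.
    by rewrite big_cons addrA addrAC.
  apply: le_trans (symmetrization_step _) _; rewrite le_eqVlt; apply/orP; left.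
  apply/eqP; apply: eq_Rintegral => x _; rewrite /symm /G /shift /=.
  by congr (_ * (_ + _)); congr (fmax i0); apply/funext => i; rewrite addrAC.
apply: le_trans (ler_sum _ (fun C _ => step C)) _.
have bGP C : bmf (fun x => \int[Lw n]_s G C (x, s)) := bmf_Rintegral P (Lw n) (bG C).
rewrite -Rintegral_sumT//; apply: Rintegral_le_cstP; first exact: bmf_sum.
move=> x.
have bS c C : bmf (fun s : n.-tuple T =>
    fmax i0 (fun i => shift c x C i + \sum_(y <- s) dev i y)) by exact: bmf_sampmax.
have -> : \sum_(C <- cs) \int[Lw n]_s G C (x, s) = 2^-1 *
  \sum_(C <- [seq shift (2 * L) x C | C <- cs] ++ [seq shift (- (2 * L)) x C | C <- cs])
    \int[Lw n]_s fmax i0 (fun i => C i + \sum_(y <- s) dev i y).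
  rewrite big_cat /= !big_map -big_split mulr_sumr; apply: eq_bigr => C _ /=.
  by rewrite -RintegralDT// -RintegralZT//; exact: bmfD.
rewrite mulrC ler_pdivrMr// IH// => xs xsn.
rewrite big_cat /= !big_map -big_split /= -ler_pdivrMr// mulr_suml.
have := h (x :: xs); rewrite /= xsn => /(_ erefl); apply: le_trans.
rewrite le_eqVlt; apply/orP; left; apply/eqP; apply: eq_bigr => C _.
congr ((_ + _) / _); apply: eq_signavg => e; congr (fmax i0);
  apply/funext => i; rewrite /shift dotp_cons; ring.
Qed.

End symmetrization.
End empirical_process.

Section mcdiarmid.
Context (R : realType) d (T : measurableType d) (P : probability T R).
Variable Lw : forall n, probability (n.-tuple T) R.
Hypothesis LwS : iterated_law P Lw.

(** The oscillation bound gives |V - m| <= c for the mean m, and in [expR_le_DexpR_sqr] the linear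
    term integrates to 0. *)
Lemma hoeffding_lemma (V : T -> R) c l : bmf V -> (forall x y, `|V x - V y| <= c) ->
  \int[P]_x expR (l * (V x - \int[P]_y V y)) <= expR (2 * (l ^+ 2 * c ^+ 2)).
Proof.
move=> bV Vc; set m := \int[P]_y V y.
have bVm : bmf (fun x => V x - m) by apply: bmfB; [|exact: bmf_cst].
have blVm : bmf (fun x => l * (V x - m)) by exact: bmfZ.
have Vm x : `|V x - m| <= c.
  rewrite /m -[X in X - _](Rintegral_cstP P) -RintegralBT//; last exact: bmf_cst.
  by apply: Rintegral_norm_leP => //; apply: bmfB => //; exact: bmf_cst.
apply: (@le_trans _ _ (\int[P]_x (l * (V x - m) + expR (2 * (l ^+ 2 * c ^+ 2))))).
  apply: le_RintegralT; [exact: bmf_expR|by apply: bmfD; [|exact: bmf_cst]|].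
  move=> x; apply: le_trans (expR_le_DexpR_sqr _) _; rewrite lerD2l ler_expR ler_pM2l//.
  rewrite exprMn ler_wpM2l ?sqr_ge0// -(real_normK (num_real (V x - m))).
  by rewrite ler_pXn2r ?nnegrE// (le_trans _ (Vm x)).
rewrite RintegralDT//; last exact: bmf_cst.
rewrite RintegralZT// RintegralBT//; last exact: bmf_cst.
by rewrite !Rintegral_cstP subrr mulr0 add0r.
Qed.

Definition bounded_differences n (F : n.-tuple T -> R) c :=
  forall (t t' : n.-tuple T) s1 x y s2, t = s1 ++ x :: s2 :> seq T ->
    t' = s1 ++ y :: s2 :> seq T -> `|F t - F t'| <= c.

(** Martingale argument by induction: for a fixed tail, Hoeffding's lemma handles the fluctuation of
    F around its mean G over the first coordinate, and G inherits the bounded differences. *)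
Lemma mcdiarmid n (F : n.-tuple T -> R) c l : bmf F -> bounded_differences F c ->
  \int[Lw n]_s expR (l * (F s - \int[Lw n]_s F s)) <=
  expR (2 * (l ^+ 2 * c ^+ 2) * n%:R).
Proof.
elim: n F => [|n IH] F bF Fc.
  have cF : F = cst (F [tuple]) by apply/funext => s; rewrite (tuple0 s).
  rewrite {2}cF Rintegral_cstP mulr0 expR0.
  rewrite (_ : (fun _ => _) = cst 1) ?Rintegral_cstP//.
  by apply/funext => s; rewrite cF subrr mulr0 expR0.
pose G (s : n.-tuple T) := \int[P]_x F [the n.+1.-tuple T of x :: s].
have bG : bmf G := bmf_Rintegralr P (Lw n) (bmf_consz bF).
have bFs (s : n.-tuple T) : bmf (fun x => F [the n.+1.-tuple T of x :: s]) :=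
  bmf_sectionr (bmf_consz bF) s.
have EG : \int[Lw n.+1]_s F s = \int[Lw n]_s G s by rewrite (iterated_lawC LwS).
have Gc : bounded_differences G c.
  move=> t t' s1 x y s2 et et'; rewrite /G -RintegralBT//.
  apply: Rintegral_norm_leP => [|z]; first exact: bmfB.
  by apply: (Fc _ _ (z :: s1) x y s2) => /=; rewrite ?et ?et'.
rewrite EG; set m := \int[Lw n]_s G s.
have bE : bmf (fun s : n.+1.-tuple T => expR (l * (F s - m))).
  by apply/bmf_expR/bmfZ/bmfB => //; exact: bmf_cst.
rewrite (iterated_lawC LwS)//.
have bEG : bmf (fun s => expR (l * (G s - m))).
  by apply/bmf_expR/bmfZ/bmfB => //; exact: bmf_cst.
apply: (@le_trans _ _ (\int[Lw n]_s
    (expR (2 * (l ^+ 2 * c ^+ 2)) * expR (l * (G s - m))))).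
  apply: le_RintegralT.
  - exact: (bmf_Rintegralr P (Lw n) (bmf_consz bE)).
  - exact: bmfZ.
  move=> s.
  have -> : (fun x => expR (l * (F [the n.+1.-tuple T of x :: s] - m))) =
     (fun x => expR (l * (G s - m)) * expR (l * (F [the n.+1.-tuple T of x :: s] - G s))).
    by apply/funext => x; rewrite -expRD; congr expR; ring.
  rewrite RintegralZT; last by apply/bmf_expR/bmfZ/bmfB => //; exact: bmf_cst.
  rewrite mulrC ler_pM2r ?expR_gt0//; apply: hoeffding_lemma => // x y.
  exact: (Fc _ _ [::] x y s).
rewrite RintegralZT// -[n.+1]addn1 natrD mulrDr mulr1 addrC expRD.
by rewrite ler_pM2l ?expR_gt0//; exact: IH.
Qed.

Lemma mcdiarmid_tail n (F : n.-tuple T -> R) c eta : (0 < n)%N -> 0 < c -> 0 <= eta ->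
  bmf F -> bounded_differences F c ->
  (Lw n [set s | (\int[Lw n]_s F s + eta <= F s)%R] <=
   (expR (- (eta ^+ 2 / (8 * (c ^+ 2 * n%:R)))))%:E)%E.
Proof.
move=> n0 c0 eta0 bF Fc; set m := \int[Lw n]_s F s.
pose A := [set s | m + eta <= F s].
have mA : measurable A.
  have [mF _] := bF.
  rewrite (_ : A = F @^-1` `[m + eta, +oo[%classic); last first.
    by apply/seteqP; split => s /=; rewrite in_itv/= andbT.
  by rewrite -[X in measurable X]setTI; exact: mF.
(* Minimises - l eta + 2 l^2 c^2 n, with minimum - eta^2 / (8 c^2 n). *)
pose l := eta / (4 * (c ^+ 2 * n%:R)).
have n0' : (0 : R) < n%:R by rewrite ltr0n.
have cn : 0 < c ^+ 2 * n%:R by rewrite mulr_gt0 ?exprn_gt0.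
have l0 : 0 <= l by rewrite divr_ge0// mulr_ge0// ltW.
have bind : bmf (\1_A : _ -> R).
  split; first exact: measurable_indic.
  by exists 1 => s; rewrite indicE; case: (s \in A); rewrite ?normr1 ?normr0.
have bE : bmf (fun s => expR (l * (F s - m))).
  by apply/bmf_expR/bmfZ/bmfB => //; exact: bmf_cst.
have -> : Lw n A = (\int[Lw n]_s (\1_A s))%:E.
  by rewrite -ERintegral// integral_indic// setIT.
rewrite lee_fin.
apply: (@le_trans _ _ (\int[Lw n]_s (expR (- (l * eta)) * expR (l * (F s - m))))).
  apply: le_RintegralT => //; first exact: bmfZ.
  move=> s; rewrite indicE; case: (boolP (s \in A)) => [|_]; last first.
    by rewrite mulr_ge0 ?expR_ge0.
  rewrite inE /A /= => h; rewrite -expRD -[leLHS]expR0 ler_expR.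
  by have : l * eta <= l * (F s - m); [rewrite ler_wpM2l//; lra|lra].
rewrite RintegralZT//.
apply: (@le_trans _ _ (expR (- (l * eta)) * expR (2 * (l ^+ 2 * c ^+ 2) * n%:R))).
  by rewrite ler_wpM2l ?expR_ge0//; exact: mcdiarmid.
rewrite -expRD ler_expR le_eqVlt; apply/orP; left; apply/eqP.
rewrite /l; field.
by rewrite !gt_eqF.
Qed.

End mcdiarmid.

(** * Uniform deviations over a network class *)

Section network_process.
Context (R : realType) d (T : measurableType d) (P : probability T R).
Variable Lw : forall n, probability (n.-tuple T) R.
Hypothesis LwS : iterated_law P Lw.
Variables (D : nat) (xi : T -> 'I_D -> R).
Hypothesis xi1 : forall x j, `|xi x j| <= 1.
Hypothesis mxi : forall j, measurable_fun [set: T] (xi ^~ j).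

Definition network k (th : 'I_k -> 'I_D -> R) (beta : 'I_k -> R) (b0 : R) (x : T) : R :=
  \sum_(i < k) beta i * ridge (th i) (xi x) + b0.

Lemma bmf_xi j : bmf (xi ^~ j).
Proof. by split; [exact: mxi|exists 1]. Qed.

Lemma measurable_sigmoid : measurable_fun [set: R] (@sigmoid R).
Proof.
apply: nondecreasing_measurable => // a b ab.
by rewrite -subr_ge0; have /andP[] := sigmoid_sub_le ab.
Qed.

Lemma bmf_ridge th : bmf (fun x => ridge th (xi x)).
Proof.
apply: (bmf_post measurable_sigmoid).
  by move=> M; exists 1 => v _; exact: sigmoid_norm.
by apply: bmf_sum => j; apply: bmfZ; exact: bmf_xi.
Qed.

Lemma bmf_network k (th : 'I_k -> 'I_D -> R) beta b0 : bmf (network th beta b0).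
Proof.
apply: bmfD; last exact: bmf_cst.
by apply: bmf_sum => i; apply: bmfZ; exact: bmf_ridge.
Qed.

Lemma network_norm k (th : 'I_k -> 'I_D -> R) beta b0 a2 a3 x :
  (forall i, `|beta i| <= a2) -> `|b0| <= a3 -> `|network th beta b0 x| <= k%:R * a2 + a3.
Proof.
move=> hbeta hb0; rewrite (le_trans (ler_normD _ _))// lerD//.
rewrite (le_trans (ler_norm_sum _ _ _))//.
rewrite (_ : k%:R * a2 = \sum_(i < k) a2); last by rewrite sumr_const card_ord mulr_natl.
apply: ler_sum => i _; rewrite normrM -[leRHS]mulr1 ler_pM//; exact: sigmoid_norm.
Qed.

Lemma network_close k (th th' : 'I_k -> 'I_D -> R) beta beta' b0 b0' a2 delta x :
  (forall i, `|beta' i| <= a2) -> (forall i j, `|th i j - th' i j| <= delta) ->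
  (forall i, `|beta i - beta' i| <= delta) -> `|b0 - b0'| <= delta ->
  `|network th beta b0 x - network th' beta' b0' x| <= (k%:R * (1 + a2 * D%:R) + 1) * delta.
Proof.
move=> ha2 hth hbeta hb0.
rewrite /network opprD addrACA -sumrB (le_trans (ler_normD _ _))//.
rewrite [leRHS]mulrDl mul1r lerD//.
rewrite (le_trans (ler_norm_sum _ _ _))//.
rewrite (_ : _ * delta = \sum_(i < k) (1 + a2 * D%:R) * delta); last first.
  by rewrite sumr_const card_ord -mulrA mulr_natl.
apply: ler_sum => i _.
rewrite (_ : _ - _ = (beta i - beta' i) * ridge (th i) (xi x) +
   beta' i * (ridge (th i) (xi x) - ridge (th' i) (xi x))); last by ring.
rewrite (le_trans (ler_normD _ _))// [leRHS]mulrDl mul1r lerD// normrM.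
  by rewrite -[leRHS]mulr1 ler_pM// sigmoid_norm.
by rewrite -mulrA ler_pM//; exact: ridge_lipschitz.
Qed.

Section grid1.
Variables (a : R) (A : nat).
Hypotheses (a0 : 0 <= a) (aA : 2 * a < A%:R).

(** For outer weights and the constant term: here the cap at [a] matters, since their size enters
    the bounds directly. *)
Definition scalar_gridpt l (m : 'I_(A * 2 ^ l)) : R := Num.min a (m%:R / 2 ^+ l - a).

Lemma scalar_gridpt_norm l (m : 'I_(A * 2 ^ l)) : `|scalar_gridpt m| <= a.
Proof.
have h : 0 <= m%:R / 2 ^+ l :> R by rewrite divr_ge0 ?exprn_ge0.
rewrite /scalar_gridpt ler_norml le_min ge_min lexx /= andbT.
by apply/andP; split; [move: a0|move: h]; lra.
Qed.

Lemma grid_index l v : `|v| <= a ->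
  exists m : 'I_(A * 2 ^ l), `|v - (m%:R / 2 ^+ l - a)| <= (2 ^+ l)^-1 /\ m%:R / 2 ^+ l - a <= v.
Proof.
rewrite ler_norml => /andP[v1 v2].
have p : 0 < 2 ^+ l :> R by rewrite exprn_gt0.
pose m := Num.truncn ((v + a) * 2 ^+ l).
have va : 0 <= (v + a) * 2 ^+ l by rewrite mulr_ge0 ?(ltW p)//; lra.
have /andP[m1 m2] := truncn_itv va.
have mlt : (m < A * 2 ^ l)%N.
  rewrite -(ltr_nat R) natrM natrX (le_lt_trans m1)// ltr_pM2r//; move: aA v2; lra.
exists (Ordinal mlt) => /=.
have h1 : m%:R / 2 ^+ l <= v + a by rewrite ler_pdivrMr.
have h2 : v + a < m%:R / 2 ^+ l + (2 ^+ l)^-1.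
  rewrite (_ : _ + (2 ^+ l)^-1 = m.+1%:R / 2 ^+ l) ?ltr_pdivlMr//.
  by rewrite -[m.+1%:R]natr1 mulrDl mul1r.
by rewrite ger0_norm; lra.
Qed.

Lemma scalar_grid_index l v : `|v| <= a ->
  exists m : 'I_(A * 2 ^ l), `|v - scalar_gridpt m| <= (2 ^+ l)^-1.
Proof.
move=> va; have [m [m1 m2]] := grid_index l va; exists m.
rewrite /scalar_gridpt min_r//.
by move: va; rewrite ler_norml; lra.
Qed.

End grid1.

Variables (a1 a2 a3 : R) (k : nat).
Hypotheses (a1_ge0 : 0 <= a1) (a2_ge0 : 0 <= a2) (a3_ge0 : 0 <= a3).

Definition grid_size1 := (Num.truncn (2 * a1)).+1.
Definition grid_size2 := (Num.truncn (2 * a2)).+1.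
Definition grid_size3 := (Num.truncn (2 * a3)).+1.

Lemma lt_grid_size (a : R) : 2 * a < (Num.truncn (2 * a)).+1%:R.
Proof. exact: truncnS_gt. Qed.

Section level.
Variable l : nat.

(* [None] stands for the zero network: it makes the one-sided maxima nonnegative. *)
Definition net_index : finType :=
  option ({ffun 'I_k -> grid D grid_size1 l * 'I_(grid_size2 * 2 ^ l)} * 'I_(grid_size3 * 2 ^ l)).

Definition net_outer (p : {ffun 'I_k -> grid D grid_size1 l * 'I_(grid_size2 * 2 ^ l)}) i :=
  scalar_gridpt a2 (p i).2.

Definition net_fun (i : net_index) : T -> R := if i is Some p then
  network (fun i => gridpt a1 (p.1 i).1) (net_outer p.1) (scalar_gridpt a3 p.2)
  else fun=> 0.

Lemma bmf_net_fun i : bmf (net_fun i).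
Proof. by case: i => [p|]; [exact: bmf_network|exact: bmf_cst]. Qed.

Lemma net_fun_norm i x : `|net_fun i x| <= k%:R * a2 + a3.
Proof.
case: i => [p|]; last by rewrite normr0 addr_ge0 ?mulr_ge0.
by apply: network_norm => [i|]; exact: scalar_gridpt_norm.
Qed.

(** A network is linear in its outer weights, so its sign sum is at most k a2 times the maximum over
    one neuron plus a3 times that of the constant 1. Only the grid of a single neuron is counted,
    not its k-fold product. *)
Lemma signavg_net_fun (L : R) n xs : 0 <= L -> (0 < n)%N -> size xs = n ->
  signavg n (fun e =>
    fmax (None : net_index) (fun i => 0 + 2 * L * dotp e [seq net_fun i x | x <- xs])) <=
  2 * L * (Num.sqrt n%:R * (k%:R * a2 * (chain_cst R D * Num.sqrt grid_size1%:R) + 3 * a3)).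
Proof.
move=> L0 n0 xsn; have n0' : (0 : R) < n%:R by rewrite ltr0n.
have sn : 0 < Num.sqrt n%:R :> R by rewrite sqrtr_gt0.
pose W e := \big[Num.max/0]_(z : grid D grid_size1 l) `|ridge_sum xi (gridpt a1 z) xs e|.
pose V e := \big[Num.max/0]_(z : unit) `|dotp e [seq (1 : R) | x <- xs]|.
have h e : fmax (None : net_index) (fun i => 0 + 2 * L * dotp e [seq net_fun i x | x <- xs]) <=
    2 * L * (k%:R * a2 * W e + a3 * V e).
  have W0 : 0 <= W e by exact: bigmax_ge_id.
  have V0 : 0 <= V e by exact: bigmax_ge_id.
  apply: fmax_le => -[p|]; rewrite add0r ler_wpM2l ?mulr_ge0//; last first.
    by rewrite dotp0 addr_ge0 ?mulr_ge0.
  have -> : dotp e [seq net_fun (Some p) x | x <- xs] =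
      \sum_(i < k) net_outer p.1 i * ridge_sum xi (gridpt a1 (p.1 i).1) xs e +
      scalar_gridpt a3 p.2 * dotp e [seq (1 : R) | x <- xs].
    rewrite /ridge_sum -dotpZ.
    under eq_bigr do rewrite -dotpZ.
    rewrite (_ : \sum_(i < k) _ = dotp e [seq \sum_(i < k) net_outer p.1 i *
       ridge (gridpt a1 (p.1 i).1) (xi x) | x <- xs]).
      by rewrite dotpD; congr (dotp e); apply: eq_map => x; rewrite mulr1.
    elim: (index_enum _) => [|i s IH].
      by rewrite big_nil; under eq_map do rewrite big_nil; rewrite dotp0.
    rewrite big_cons IH dotpD; congr (dotp e); apply: eq_map => x.
    by rewrite big_cons.
  rewrite lerD//.
    rewrite -mulrA (_ : k%:R * _ = \sum_(i < k) a2 * W e); last first.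
      by rewrite sumr_const card_ord mulr_natl.
    apply: ler_sum => i _; apply: le_trans (ler_norm _) _; rewrite normrM.
    apply: ler_pM => //; first exact: scalar_gridpt_norm.
    exact: (le_bigmax 0 (fun z => `|ridge_sum xi (gridpt a1 z) xs e|)).
  apply: le_trans (ler_norm _) _; rewrite normrM.
  apply: ler_pM => //; first exact: scalar_gridpt_norm.
  exact: (le_bigmax 0 (fun z : unit => `|dotp e [seq (1 : R) | x <- xs]|) tt).
apply: le_trans (le_signavg (fun e _ => h e)) _.
rewrite signavgZ ler_wpM2l ?mulr_ge0// signavgD !signavgZ.
have hW : signavg n W <= chain_cst R D * Num.sqrt n%:R * Num.sqrt grid_size1%:R.
  by rewrite -xsn; apply: chaining => //; rewrite xsn.
(* [massart] for a one-point family with l = n^(-1/2): the sum is (ln 2 + 2) sqrt n. *)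
have hV : signavg n V <= 3 * Num.sqrt n%:R.
  have vs (z : unit) : \sum_(x <- [seq (1 : R) | x <- xs]) x ^+ 2 <= (n%:R : R) * 1 ^+ 2.
    by rewrite -xsn; apply: (sum_sqr_le (f := fun=> 1)) => x; rewrite normr1.
  have vn (z : unit) : size [seq (1 : R) | x <- xs] = n by rewrite size_map.
  have c1 : (0 < #|{: unit}|)%N by rewrite card_unit.
  have l0 : 0 < (Num.sqrt n%:R)^-1 :> R by rewrite invr_gt0.
  apply: le_trans (massart c1 vn vs l0) _.
  have l2 := ln2_le1 R.
  rewrite card_unit mulr1 expr1n mulr1 invrK.
  have -> : 2 * (Num.sqrt n%:R)^-1 * n%:R = 2 * Num.sqrt n%:R :> R.
    have := sqr_sqrtr (ltW n0'); move: sn; move: (Num.sqrt _) => s s0 <-.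
    by field; rewrite gt_eqF.
  by have := ler_wpM2r (ltW sn) l2; clear vs vn c1 h; lra.
have := ler_wpM2l (mulr_ge0 (ler0n R k) a2_ge0) hW.
have := ler_wpM2l a3_ge0 hV.
by clear h; lra.
Qed.

Section lipschitz_post.
Variables (phi : R -> R) (L : R).
Hypotheses (L0 : 0 <= L) (phiL : lipschitz_cst phi L) (mphi : measurable_fun [set: R] phi).

Lemma bmf_lipschitz f : bmf f -> bmf (fun x : T => phi (f x)).
Proof.
apply: bmf_post => // M; exists (`|phi 0| + L * M) => v vM.
rewrite -[phi v](subrK (phi 0)) (le_trans (ler_normD _ _))// addrC lerD2l.
by rewrite (le_trans (phiL v 0))// subr0 ler_wpM2l.
Qed.

Definition net_dev i x := phi (net_fun i x) - \int[P]_y phi (net_fun i y).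

Lemma bmf_phi_net i : bmf (fun x => phi (net_fun i x)). Proof. exact/bmf_lipschitz/bmf_net_fun. Qed.

Definition deviation n (s : n.-tuple T) :=
  fmax (None : net_index) (fun i => 0 + \sum_(y <- s) net_dev i y).

Lemma bmf_deviation n : bmf (@deviation n).
Proof.
apply: bmf_fmax => i; apply: bmfD; first exact: bmf_cst.
by apply: bmf_tuple_sum; apply: bmfB; [exact: bmf_phi_net|exact: bmf_cst].
Qed.

Lemma deviation_ge0 n (s : n.-tuple T) : 0 <= deviation s.
Proof.
apply: le_trans (le_fmax _ _ None); rewrite add0r big1// => y _.
by rewrite /net_dev /= Rintegral_cstP subrr.
Qed.

Lemma le_deviation n (s : n.-tuple T) i : \sum_(y <- s) net_dev i y <= deviation s.
Proof. by apply: le_trans (le_fmax _ _ i); rewrite add0r. Qed.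

Lemma Rintegral_deviation n : (0 < n)%N -> \int[Lw n]_s deviation s <=
  2 * L * (Num.sqrt n%:R * (k%:R * a2 * (chain_cst R D * Num.sqrt grid_size1%:R) + 3 * a3)).
Proof.
move=> n0.
set K := _ * _.
have := @symmetrization R d T P Lw LwS net_index None net_fun phi L bmf_net_fun L0 phiL
  bmf_phi_net n [:: fun=> 0] K.
rewrite big_seq1; apply=> xs xsn.
by rewrite big_seq1; exact: signavg_net_fun.
Qed.

Lemma deviation_differences n :
  bounded_differences (@deviation n) (L * (2 * (k%:R * a2 + a3))).
Proof.
move=> t t' s1 x y s2 et et'.
suff h u u' (w w' : n.-tuple T) : w = s1 ++ u :: s2 :> seq T ->
    w' = s1 ++ u' :: s2 :> seq T ->
    deviation w <= deviation w' + L * (2 * (k%:R * a2 + a3)).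
  by rewrite ler_norml; have := h _ _ _ _ et et'; have := h _ _ _ _ et' et; lra.
move=> ew ew'; apply: le_fmax2 => i; rewrite !add0r ew ew' !big_cat !big_cons /=.
have h : phi (net_fun i u) - phi (net_fun i u') <= L * (2 * (k%:R * a2 + a3)).
  apply: le_trans (ler_norm _) _; apply: le_trans (phiL _ _) _.
  rewrite ler_wpM2l// mulr2n mulrDl mul1r.
  by apply: le_trans (ler_normB _ _) _; apply: lerD; exact: net_fun_norm.
have e v : net_dev i v = phi (net_fun i v) - \int[P]_y phi (net_fun i y) by [].
rewrite (e u) (e u').
by move: h; lra.
Qed.

Lemma deviationP (th : 'I_k -> 'I_D -> R) beta b0 n (s : n.-tuple T) :
  (forall i j, `|th i j| <= a1) -> (forall i, `|beta i| <= a2) -> `|b0| <= a3 ->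
  \sum_(y <- s) phi (network th beta b0 y) -
    n%:R * \int[P]_y phi (network th beta b0 y) <=
  deviation s + n%:R * (2 * L * ((k%:R * (1 + a2 * D%:R) + 1) * (2 ^+ l)^-1)).
Proof.
move=> hth hbeta hb0.
pose thi i j := sval (cid (grid_index (lt_grid_size a1) l (hth i j))).
have thiP i j := svalP (cid (grid_index (lt_grid_size a1) l (hth i j))).
pose bi i := sval (cid (scalar_grid_index (lt_grid_size a2) l (hbeta i))).
have biP i := svalP (cid (scalar_grid_index (lt_grid_size a2) l (hbeta i))).
have [b0i b0iP] := scalar_grid_index (lt_grid_size a3) l hb0.
pose p : net_index := Some ([ffun i => ([ffun j => thi i j], bi i)], b0i).
set e := (k%:R * (1 + a2 * D%:R) + 1) * (2 ^+ l)^-1.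
have close y : `|network th beta b0 y - net_fun p y| <= e.
  apply: network_close => //.
  - by move=> i; rewrite /net_outer; exact: scalar_gridpt_norm.
  - by move=> i j; rewrite /gridpt !ffunE /=; have [] := thiP i j.
  - by move=> i; rewrite /net_outer ffunE /=; exact: biP.
have bn := bmf_lipschitz (bmf_network th beta b0).
have phi_close y : `|phi (network th beta b0 y) - phi (net_fun p y)| <= L * e.
  by rewrite (le_trans (phiL _ _))// ler_wpM2l.
have int_close : `|\int[P]_y phi (network th beta b0 y) - \int[P]_y phi (net_fun p y)| <= L * e.
  have bp := bmf_phi_net p; rewrite -RintegralBT//.
  by apply: Rintegral_norm_leP => //; exact: bmfB.
have sum_close : \sum_(y <- s) phi (network th beta b0 y) <=
    \sum_(y <- s) phi (net_fun p y) + n%:R * (L * e).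
  rewrite -lerBlDl -sumrB.
  have -> : n%:R * (L * e) = \sum_(y <- s) (L * e).
    by rewrite big_const_seq count_predT size_tuple iter_addr addr0 mulr_natl.
  by apply: ler_sum => y _; exact: le_trans (ler_norm _) (phi_close y).
have := le_deviation s p.
have -> : \sum_(y <- s) net_dev p y =
    \sum_(y <- s) phi (net_fun p y) - n%:R * \int[P]_y phi (net_fun p y).
  by rewrite sumrB big_const_seq count_predT size_tuple iter_addr addr0 mulr_natl.
have n0 : (0 : R) <= n%:R by [].
move: int_close; rewrite ler_norml => /andP[int_close _].
have := ler_wpM2l n0 int_close.
move: sum_close; lra.
Qed.

End lipschitz_post.

End level.

Lemma ltn_expr2 (x : R) : exists l, x <= 2 ^+ l.
Proof.
exists (Num.truncn x).+1; apply: (le_trans (ltW (truncnS_gt x))).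
by rewrite -natrX ler_nat ltnW// ltn_expl.
Qed.

Definition network_rate :=
  k%:R * a2 * (chain_cst R D * Num.sqrt (2 * a1 + 1)) + 3 * a3.

(* The supremum over the uncountable class of networks need not be measurable; [Z]
   stands in for it. *)
Lemma network_deviations (phi : R -> R) (L : R) n (delta : R) :
  0 <= L -> lipschitz_cst phi L -> measurable_fun [set: R] phi ->
  (0 < n)%N -> 0 < delta ->
  exists Z : n.-tuple T -> R,
  [/\ bmf Z, forall s, 0 <= Z s,
      forall (th : 'I_k -> 'I_D -> R) beta b0 (s : n.-tuple T),
        (forall i j, `|th i j| <= a1) -> (forall i, `|beta i| <= a2) -> `|b0| <= a3 ->
        `|\sum_(y <- s) phi (network th beta b0 y) -
          n%:R * \int[P]_y phi (network th beta b0 y)| <= Z s + n%:R * delta,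
      \int[Lw n]_s Z s <= 4 * L * (Num.sqrt n%:R * network_rate) &
      bounded_differences Z (4 * L * (k%:R * a2 + a3))].
Proof.
move=> L0 phiL mphi n0 delta0.
have phiL' : lipschitz_cst (fun v => - phi v) L.
  by move=> u v; rewrite -opprD normrN.
have mphi' : measurable_fun [set: R] (fun v => - phi v) by exact: measurableT_comp.
pose X := 2 * L * (k%:R * (1 + a2 * D%:R) + 1).
have X0 : 0 <= X by rewrite !mulr_ge0// addr_ge0// mulr_ge0// addr_ge0// mulr_ge0.
(* The chaining bound is the same at every level, so the level can be taken high enough for the
   rounding error, made once in the sum and once in the integral, to stay below [delta]. *)
have [l hl] := ltn_expr2 (X / delta).
have Xl : 2 * L * ((k%:R * (1 + a2 * D%:R) + 1) * (2 ^+ l)^-1) <= delta.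
  by rewrite mulrA -/X ler_pdivrMr ?exprn_gt0// mulrC -ler_pdivrMr.
have bD := @bmf_deviation l phi L L0 phiL mphi n.
have bD' := @bmf_deviation l _ L L0 phiL' mphi' n.
exists (fun s => deviation l phi s + deviation l (fun v => - phi v) s); split.
- exact: bmfD.
- by move=> s; rewrite addr_ge0 ?deviation_ge0.
- move=> th beta b0 s hth hbeta hb0.
  have h1 := deviationP l L0 phiL mphi s hth hbeta hb0.
  have h2 := deviationP l L0 phiL' mphi' s hth hbeta hb0.
  have n0' : (0 : R) <= n%:R by [].
  have h3 := ler_wpM2l n0' Xl.
  have d1 := deviation_ge0 l phi s.
  have d2 := deviation_ge0 l (fun v => - phi v) s.
  have bn := bmf_lipschitz L0 phiL mphi (bmf_network th beta b0).
  rewrite sumrN in h2.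
  have e : \int[P]_y (- phi (network th beta b0 y)) = - \int[P]_y phi (network th beta b0 y).
    have := RintegralZT P (-1) bn; rewrite mulN1r => <-.
    by apply: eq_Rintegral => y _; rewrite mulN1r.
  rewrite e in h2; rewrite ler_norml.
  by move: h1 h2 h3 d1 d2; lra.
- rewrite RintegralDT//.
  have hA : Num.sqrt grid_size1%:R <= Num.sqrt (2 * a1 + 1) :> R.
    by rewrite ler_wsqrtr// /grid_size1 -[(Num.truncn _).+1%:R]natr1 lerD2r truncn_le mulr_ge0.
  have := Rintegral_deviation l L0 phiL mphi n0.
  have := Rintegral_deviation l L0 phiL' mphi' n0.
  rewrite /network_rate.
  have h :
     2 * L * (Num.sqrt n%:R * (k%:R * a2 * (chain_cst R D * Num.sqrt grid_size1%:R) + 3 * a3)) <=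
     2 * L * (Num.sqrt n%:R * (k%:R * a2 * (chain_cst R D * Num.sqrt (2 * a1 + 1)) + 3 * a3)).
    rewrite ler_wpM2l ?mulr_ge0// ler_wpM2l ?sqrtr_ge0// lerD2r ler_wpM2l ?mulr_ge0//.
    by rewrite ler_wpM2l// mulr_ge0// sqr_ge0.
  by move: h; lra.
- move=> t t' s1 x y s2 et et'.
  have h1 := @deviation_differences l phi L L0 phiL n t t' s1 x y s2 et et'.
  have h2 := @deviation_differences l _ L L0 phiL' n t t' s1 x y s2 et et'.
  rewrite opprD addrACA (le_trans (ler_normD _ _))//.
  by move: h1 h2; lra.
Qed.

End network_process.

(** * The variational form of the Hellinger distance *)

Section almost_everywhere.
Context d (T : measurableType d) (R : realType) (mu : {measure set T -> \bar R}).

Lemma ae_mono (A B : T -> Prop) :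
  {ae mu, forall x, A x} -> (forall x, A x -> B x) -> {ae mu, forall x, B x}.
Proof. by move=> hA AB; apply: filterS hA. Qed.

Lemma ae_and (A B : T -> Prop) : {ae mu, forall x, A x} ->
  {ae mu, forall x, B x} -> {ae mu, forall x, A x /\ B x}.
Proof. by move=> hA hB; apply: filterS2 hA hB. Qed.

End almost_everywhere.

Section hellinger_identity.
Context (R : realType) (d : nat) (P Q : probability (borel_rV R d) R).
Hypothesis PQ : P `<< Q.

(* The positive part makes the density nonnegative everywhere and not only Q-almost everywhere. *)
Definition rho (x : borel_rV R d) : R := Num.max 0 (fine (density P Q x)).

Lemma rho_ge0 x : 0 <= rho x. Proof. by rewrite /rho le_max lexx. Qed.

Lemma densityE x : density P Q x = (fine (density P Q x))%:E.
Proof. by rewrite fineK//; exact: Radon_Nikodym_fin_num. Qed.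

Lemma integrable_density : Q.-integrable [set: borel_rV R d] (density P Q).
Proof. exact: Radon_Nikodym_integrable. Qed.

Lemma ae_density_ge0 : {ae Q, forall x, (0 <= density P Q x)%E}.
Proof.
have h := @ae_eq_Radon_Nikodym_SigmaFinite _ _ _ P Q PQ _ measurableT.
apply: (ae_mono h) => x /= /(_ I) {}h.
by rewrite /density -h; exact: Radon_Nikodym_SigmaFinite.f_ge0.
Qed.

Lemma ae_rho : {ae Q, forall x, density P Q x = (rho x)%:E}.
Proof.
apply: (ae_mono ae_density_ge0) => x.
by rewrite /rho densityE lee_fin /= => h; rewrite max_r.
Qed.

Lemma measurable_rho : measurable_fun [set: borel_rV R d] rho.
Proof.
apply: measurable_maxr; first exact: measurable_cst.
apply: measurableT_comp => //; exact: measurable_int integrable_density.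
Qed.

Lemma integrable_rho : Q.-integrable [set: borel_rV R d] (EFin \o rho).
Proof.
apply: (le_integrable measurableT _ _ integrable_density).
  by apply/measurable_EFinP; exact: measurable_rho.
move=> x _ /=; rewrite densityE lee_fin [X in X <= _]ger0_norm ?rho_ge0//.
by rewrite /rho ge_max normr_ge0 /= ler_norm.
Qed.

Lemma integrable_bmf_rho g : bmf g ->
  Q.-integrable [set: borel_rV R d] (EFin \o (fun x => g x * rho x)).
Proof.
move=> [mg [M gM]].
have h := integrableZl measurableT M integrable_rho.
apply: (le_integrable measurableT _ _ h).
  by apply/measurable_EFinP; apply: measurable_funM => //; exact: measurable_rho.
move=> x _ /=; rewrite lee_fin !normrM ler_wpM2r//.
exact: le_trans (gM x) (ler_norm _).
Qed.

Lemma Rintegral_rho g : bmf g -> \int[Q]_x (g x * rho x) = \int[P]_x g x.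
Proof.
move=> bg; rewrite /Rintegral; congr fine.
have h := @Radon_Nikodym_change_of_variables _ _ _ P Q PQ (EFin \o g) _ measurableT
  (bmf_integrable P bg).
rewrite -h; apply: ae_eq_integral => //.
- exact: measurable_int (integrable_bmf_rho bg).
- apply: emeasurable_funM; first by apply/measurable_EFinP; case: bg.
  exact: measurable_int integrable_density.
- apply: (ae_mono ae_rho) => x hx _ /=.
  by rewrite EFinM -hx.
Qed.

(** Equal to the integral of r (f - g)^2 / (1 - g) where r > 0, but free of f and meaningful also
    where r vanishes. *)
Definition bias (g : 'rV[R]_d -> R) : R :=
  \int[Q]_x ((Num.sqrt (rho x) * (1 - g x) - 1) ^+ 2 / (1 - g x)).

Definition objective (g : borel_rV R d -> R) : R :=
  \int[P]_x g x - \int[Q]_x (g x / (1 - g x)).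

Section bounded_g.
Variables (g : borel_rV R d -> R) (t : R).
Hypotheses (t0 : 0 < t) (bg : bmf g) (gt : forall x, t <= 1 - g x).

Let inv_ge0 x : 0 <= (1 - g x)^-1 <= t^-1.
Proof.
have h : 0 < 1 - g x by exact: lt_le_trans (gt x).
by rewrite invr_ge0 (ltW h) /= lef_pV2.
Qed.

Lemma bmf_inv1 : bmf (fun x => (1 - g x)^-1).
Proof.
split; last by exists t^-1 => x; have /andP[h1 h2] := inv_ge0 x; rewrite ger0_norm.
have e : (fun x => (1 - g x)^-1) = (fun u => (Num.max t u)^-1) \o (fun x => 1 - g x).
  by apply/funext => x /=; rewrite max_r.
rewrite e; apply: measurableT_comp; last by case: (bmfB (bmf_cst _ (1 : R)) bg).
apply: nonincreasing_measurable => // u v uv.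
by rewrite lef_pV2 ?posrE ?lt_max ?t0// ge_max !le_max lexx uv orbT.
Qed.

Lemma bmf_odds : bmf (fun x => g x / (1 - g x)).
Proof. exact: bmfM bg bmf_inv1. Qed.

Let q x := (Num.sqrt (rho x) * (1 - g x) - 1) ^+ 2 / (1 - g x).

Lemma bias_integrand_ge0 x : 0 <= q x.
Proof. by rewrite mulr_ge0 ?sqr_ge0//; have /andP[] := inv_ge0 x. Qed.

(** With s = sqrt rho, the square in [q] expands to s^2 (1 - g) - 2 s + 1 / (1 - g), and the other
    two terms complete it to s^2 - 2 s + 1. This is the variational identity before integration. *)
Lemma bias_integrandE x :
  (Num.sqrt (rho x) - 1) ^+ 2 = g x * rho x - g x / (1 - g x) + q x.
Proof.
rewrite /q -[in RHS](sqr_sqrtr (rho_ge0 x)).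
set s := Num.sqrt (rho x).
rewrite sqrtr_sqr ger0_norm ?sqrtr_ge0//.
by field; rewrite gt_eqF// (lt_le_trans _ (gt x)).
Qed.

Lemma measurable_sqrt_rho : measurable_fun [set: borel_rV R d] (fun x => Num.sqrt (rho x)).
Proof.
apply: measurableT_comp measurable_rho; apply: nondecreasing_measurable => // u v uv.
exact: ler_wsqrtr.
Qed.

Lemma integrable_hellinger :
  Q.-integrable [set: borel_rV R d] (EFin \o (fun x => (Num.sqrt (rho x) - 1) ^+ 2)).
Proof.
have h := integrableD measurableT integrable_rho (bmf_integrable Q (bmf_cst _ 1)).
apply: (le_integrable measurableT _ _ h).
  apply/measurable_EFinP; apply: measurable_funX; apply: measurable_funB => //.
  exact: measurable_sqrt_rho.
move=> x _ /=; rewrite lee_fin ger0_norm ?sqr_ge0// ger0_norm ?addr_ge0 ?rho_ge0//.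
have := sqr_sqrtr (rho_ge0 x); have := sqrtr_ge0 (rho x).
by move: (Num.sqrt _) => s s0 <-; nra.
Qed.

Lemma integrable_bias : Q.-integrable [set: borel_rV R d] (EFin \o q).
Proof.
have h := integrableB measurableT integrable_hellinger
  (integrableB measurableT (integrable_bmf_rho bg) (bmf_integrable Q bmf_odds)).
apply: (le_integrable measurableT _ _ h).
  apply/measurable_EFinP; apply: measurable_funM; last by case: bmf_inv1.
  apply: measurable_funX; apply: measurable_funB => //.
  apply: measurable_funM; first exact: measurable_sqrt_rho.
  by case: (bmfB (bmf_cst _ (1 : R)) bg).
move=> x _ /=; rewrite lee_fin bias_integrandE le_eqVlt; apply/orP; left.
by apply/eqP; congr (`|_|); ring.
Qed.

Lemma hellinger2_objective : hellinger2 P Q = (objective g + bias g)%:E.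
Proof.
have -> : hellinger2 P Q = (\int[Q]_x ((Num.sqrt (rho x) - 1) ^+ 2)%:E)%E.
  rewrite /hellinger2 unlock; apply: eq_integral => x _ /=; congr (_ %:E).
  congr ((_ - _) ^+ 2); rewrite /rho.
  by have [h|h] := leP 0 (fine (density P Q x)); last rewrite sqrtr0 ltr0_sqrtr.
rewrite -(fineK (integrable_fin_num measurableT integrable_hellinger)); congr (_ %:E).
rewrite -/(Rintegral Q setT _).
have -> : (fun x => (Num.sqrt (rho x) - 1) ^+ 2) =
   (fun x => (g x * rho x - g x / (1 - g x)) + q x).
  by apply/funext => x; exact: bias_integrandE.
rewrite RintegralD//; last 2 first.
- by have := integrableB measurableT (integrable_bmf_rho bg) (bmf_integrable Q bmf_odds).
- exact: integrable_bias.
rewrite RintegralB//; [|exact: integrable_bmf_rho|exact/bmf_integrable/bmf_odds].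
by rewrite Rintegral_rho.
Qed.

Lemma bias_ge0 : 0 <= bias g.
Proof. by apply: Rintegral_ge0 => x _; exact: bias_integrand_ge0. Qed.

Lemma le_bias (h : borel_rV R d -> R) : (forall x, 0 <= h x) ->
  Q.-integrable [set: borel_rV R d] (EFin \o h) ->
  {ae Q, forall x, q x <= h x} -> bias g <= \int[Q]_x h x.
Proof.
move=> h0 ih qh; rewrite /bias /Rintegral fine_le//.
- exact: integrable_fin_num integrable_bias.
- exact: integrable_fin_num ih.
- apply: ae_ge0_le_integral => //.
  + by move=> x _; rewrite lee_fin bias_integrand_ge0.
  + exact: measurable_int integrable_bias.
  + by move=> x _; rewrite lee_fin.
  + exact: measurable_int ih.
  + by apply: (ae_mono qh) => x h' _; rewrite lee_fin.
Qed.

End bounded_g.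
End hellinger_identity.

Section cube_retraction.
Context (R : realType) (d : nat).

Lemma measurable_coord j : measurable_fun [set: borel_rV R d] (fun x : 'rV[R]_d => x ord0 j).
Proof.
apply: (measurability (@RGenOpens.G R)); first exact: RGenOpens.measurableE.
move=> _ [_ [a [b ->] <-]]; rewrite setTI; apply: sub_sigma_algebra.
apply: open_comp; last exact: interval_open.
by move=> x _; exact: coord_continuous.
Qed.

Lemma measurable_cube : measurable (@cube R d : set (borel_rV R d)).
Proof.
have -> : @cube R d = \bigcap_(j in [set: 'I_d])
   ((fun x : 'rV[R]_d => x ord0 j) @^-1` `[0, 1]%classic).
  apply/seteqP; split => x /= h j; first by move=> _; rewrite /= in_itv /=.
  by have := h j I; rewrite /= in_itv.
apply: fin_bigcap_measurable; first exact: finite_finset.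
move=> j _; rewrite -[X in measurable X]setTI; exact: measurable_coord.
Qed.

(* Composing with [to_cube] turns bounds valid on the cube into bounds valid everywhere. *)
Definition to_cube (x : 'rV[R]_d) : 'rV[R]_d := if x \in @cube R d then x else 0.

Lemma to_cubeP x : cube (to_cube x).
Proof.
rewrite /to_cube; case: ifPn => [|_]; first by rewrite inE.
by move=> j; rewrite mxE lexx ler01.
Qed.

Lemma to_cube_id x : cube x -> to_cube x = x.
Proof. by move=> cx; rewrite /to_cube ifT// inE. Qed.

Lemma to_cube_norm x j : `|to_cube x ord0 j| <= 1.
Proof. by have /(_ j)/andP[h1 h2] := to_cubeP x; rewrite ger0_norm. Qed.

Lemma measurable_to_cube_coord j :
  measurable_fun [set: borel_rV R d] (fun x : 'rV[R]_d => to_cube x ord0 j).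
Proof.
have -> : (fun x : 'rV[R]_d => to_cube x ord0 j) =
    (fun x => \1_(@cube R d) x * x ord0 j).
  apply/funext => x; rewrite /to_cube indicE; case: ifP => _; rewrite ?mul1r//.
  by rewrite mul0r mxE.
have h : measurable_fun [set: borel_rV R d] (\1_(@cube R d) : borel_rV R d -> R).
  by apply: measurable_indic; exact: measurable_cube.
exact: measurable_funM h (measurable_coord j).
Qed.

Lemma ae_cube (Q : probability (borel_rV R d) R) : on_cube Q ->
  {ae Q, forall x, @cube R d x}.
Proof.
move=> QC; exists (~` @cube R d); split => //.
  exact: (measurableC measurable_cube).
by rewrite (probability_setC _ measurable_cube) QC subee.
Qed.

End cube_retraction.

Section bias_bounds.
Context (R : realType) (d : nat) (P Q : probability (borel_rV R d) R).
Hypothesis PQ : P `<< Q.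
Variable f : 'rV[R]_d -> R.
Hypothesis hf : f_hellinger_version P Q f.

(** Where the density vanishes [f_hellinger] is -oo, which is no real value; so a real version
    forces rho > 0 almost everywhere. *)
Lemma ae_version_rho :
  {ae Q, forall x, 0 < 1 - f x /\ Num.sqrt (rho P Q x) * (1 - f x) = 1}.
Proof.
apply: (ae_mono (ae_and (ae_rho PQ) hf)) => x [rx].
rewrite /f_hellinger rx poweR_EFin powR12_sqrt ?rho_ge0//.
have := sqrtr_ge0 (rho P Q x); rewrite le_eqVlt => /predU1P[<-|s0].
  by rewrite inve0.
rewrite inver gt_eqF// -EFinB => -[<-].
by rewrite opprB addrCA subrr addr0 invr_gt0 mulfV ?gt_eqF.
Qed.

Variables (g : borel_rV R d -> R) (t : R).
Hypotheses (t0 : 0 < t) (bg : bmf g) (gt : forall x, t <= 1 - g x).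

Lemma bias_integrand_version x :
  Num.sqrt (rho P Q x) * (1 - f x) = 1 ->
  (Num.sqrt (rho P Q x) * (1 - g x) - 1) ^+ 2 / (1 - g x) =
  rho P Q x * (f x - g x) ^+ 2 / (1 - g x).
Proof.
move=> h; rewrite -[in RHS](sqr_sqrtr (rho_ge0 P Q x)) -exprMn; congr (_ ^+ 2 / _).
by rewrite -[X in _ - X]h; ring.
Qed.

(** The hypothesis gives 1 - g >= s / 2 and, since f < 1, |f - g| <= 3 s / 2. Hence (f - g)^2 / (1 -
    g) <= 9 s / 2, and the unbounded factor rho only has to be integrated, with integral 1. *)
Lemma bias_le_truncation s : 0 < s ->
  {ae Q, forall x, `|g x - Num.min (f x) (1 - s)| <= s / 2} ->
  bias P Q g <= 5 * s.
Proof.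
move=> s0 gs.
have -> : 5 * s = \int[Q]_x (5 * s * rho P Q x).
  rewrite RintegralZl//; last exact: integrable_rho.
  have := Rintegral_rho PQ (bmf_cst _ (1 : R)).
  under eq_Rintegral do rewrite mul1r.
  by rewrite Rintegral_cstP => ->; rewrite mulr1.
apply: (le_bias PQ t0 bg gt).
- by move=> x; rewrite mulr_ge0 ?rho_ge0// mulr_ge0// ltW.
- by have := integrableZl measurableT (5 * s) (integrable_rho PQ).
apply: (ae_mono (ae_and ae_version_rho gs)) => x [[f1 /bias_integrand_version ->]].
rewrite ler_norml => /andP[h1 h2].
have m1 : Num.min (f x) (1 - s) <= 1 - s by rewrite ge_min lexx orbT.
have m2 : Num.min (f x) (1 - s) <= f x by rewrite ge_min lexx.
have m3 : f x - s <= Num.min (f x) (1 - s) by rewrite le_min; apply/andP; split; lra.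
have g1 : s / 2 <= 1 - g x by lra.
have g0 : 0 < 1 - g x by lra.
rewrite ler_pdivrMr// [5 * s * _]mulrC -mulrA ler_wpM2l ?rho_ge0//.
have h3 : `|f x - g x| <= 3 / 2 * s by rewrite ler_norml; apply/andP; split; lra.
have h4 : (f x - g x) ^+ 2 <= (3 / 2 * s) ^+ 2.
  by rewrite -real_normK ?num_real// ler_pXn2r ?nnegrE//; lra.
apply: le_trans h4 _; nra.
Qed.

(** Here rho = (1 - f)^-2 <= M^2 and 1 - g >= t, while truncating at 1 - t cannot move g0 away from
    f, which lies below 1 - t. *)
Lemma bias_le_bounded (M : R) (f0 g0 : borel_rV R d -> R) : 0 < M -> bmf f0 -> bmf g0 ->
  {ae Q, forall x, [/\ f x = f0 x, M^-1 <= `|1 - f x|, f x <= 1 - t &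
    g x = Num.min (1 - t) (g0 x)]} ->
  bias P Q g <= M ^+ 2 / t * \int[Q]_x ((f0 x - g0 x) ^+ 2).
Proof.
move=> M0 bf0 bg0 hae.
have b2 : bmf (fun x => (f0 x - g0 x) ^+ 2).
  by have := bmfM (bmfB bf0 bg0) (bmfB bf0 bg0).
have c0 : 0 <= M ^+ 2 / t by rewrite divr_ge0 ?sqr_ge0// ltW.
rewrite -RintegralZT//.
apply: (le_bias PQ t0 bg gt).
- by move=> x; rewrite mulr_ge0// sqr_ge0.
- by apply: bmf_integrable; exact: bmfZ.
apply: (ae_mono (ae_and ae_version_rho hae)) => x [[f1 e] [ff0 Mf ft gx]].
rewrite (bias_integrand_version e).
have rM : rho P Q x <= M ^+ 2.
  rewrite -(sqr_sqrtr (rho_ge0 P Q x)) ler_pXn2r ?nnegrE ?sqrtr_ge0 ?(ltW M0)//.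
  rewrite gtr0_norm// in Mf.
  have -> : Num.sqrt (rho P Q x) = (1 - f x)^-1.
    by apply: (mulIf (lt0r_neq0 f1)); rewrite e mulVf ?lt0r_neq0.
  by rewrite -[M]invrK lef_pV2 ?posrE ?invr_gt0.
have fg : (f x - g x) ^+ 2 <= (f0 x - g0 x) ^+ 2.
  rewrite -ff0 gx -real_normK ?num_real// -[leRHS]real_normK ?num_real//.
  rewrite ler_pXn2r ?nnegrE//.
  have [h|h] := leP (1 - t) (g0 x); last by [].
  by rewrite !ler0_norm; lra.
have g0' : 0 < 1 - g x by exact: lt_le_trans (gt x).
apply: (@le_trans _ _ (M ^+ 2 * (f0 x - g0 x) ^+ 2 / (1 - g x))).
  rewrite ler_pM2r ?invr_gt0// ler_pM ?rho_ge0 ?sqr_ge0//.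
have M2 : 0 <= M ^+ 2 by rewrite sqr_ge0.
have ti : (1 - g x)^-1 <= t^-1 by rewrite lef_pV2 ?posrE.
rewrite [leRHS]mulrAC; apply: ler_pM => //; first by rewrite mulr_ge0 ?sqr_ge0.
  by rewrite invr_ge0 ltW.
Qed.

End bias_bounds.

(** * Approximation of Barron functions *)

Section step_functions.
Context (R : realType).

Lemma geometric_sum_le (q : R) n : 0 <= q < 1 ->
  \sum_(0 <= i < n) q ^+ i <= (1 - q)^-1.
Proof.
move=> /andP[q0 q1]; have p : 0 < 1 - q by lra.
suff -> : \sum_(0 <= i < n) q ^+ i = (1 - q ^+ n) / (1 - q).
  by rewrite ler_piMl ?invr_ge0 ?(ltW p)// gerBl exprn_ge0.
elim: n => [|n IH]; first by rewrite big_nil expr0 subrr mul0r.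
by rewrite big_nat_recr//= IH exprS; field; rewrite gt_eqF.
Qed.

Variables (H : R -> R) (l tau : R).
Hypotheses (l0 : 0 <= l) (tau0 : 0 < tau).
Hypothesis Hl : forall u v, `|u| <= 1 -> `|v| <= 1 -> `|H u - H v| <= l * `|u - v|.

(* Riemann-sum form of [H z - H (-1) = \int H' (u) 1_(u < z) du], the step being replaced by
   a steep sigmoid. *)
Lemma sigmoid_mixture : exists (N : nat) (a u : nat -> R),
  [/\ forall j, (j < N)%N -> `|u j| <= 1, \sum_(0 <= j < N) `|a j| <= 2 * l &
  forall z, `|z| <= 1 ->
    `|H z - H (-1) - \sum_(0 <= j < N) a j * sigmoid (tau * (z - u j))| <= 6 * l / tau].
Proof.
(* A mesh 2 / N of at most 1 / tau, the width of the sigmoid, is fine enough for the discretisation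
   error to have the order of the smoothing error. *)
pose N := (Num.truncn (2 * tau)).+1.
have N0 : 0 < N%:R :> R by rewrite ltr0n.
have Ntau : 2 * tau <= N%:R by exact/ltW/truncnS_gt.
pose u (j : nat) : R := -1 + 2 * j%:R / N%:R.
have uS j : u j.+1 = u j + 2 / N%:R by rewrite /u -[j.+1%:R]natr1; field; rewrite gt_eqF.
have u1 j : (j <= N)%N -> `|u j| <= 1.
  move=> jN; have h : j%:R / N%:R <= 1 :> R by rewrite ler_pdivrMr// mul1r ler_nat.
  have h0 : 0 <= j%:R / N%:R :> R by rewrite divr_ge0// ltW.
  by rewrite /u ler_norml; apply/andP; split; lra.
pose a j := H (u j.+1) - H (u j).
have aN j : (j < N)%N -> `|a j| <= l * (2 / N%:R).
  move=> jN; apply: le_trans (Hl (u1 _ jN) (u1 _ (ltnW jN))) _.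
  by rewrite uS addrC addKr ger0_norm// divr_ge0// ltW.
exists N, a, u; split; first by move=> j /ltnW; exact: u1.
  apply: (@le_trans _ _ (\sum_(0 <= j < N) l * (2 / N%:R))).
    by apply: ler_sum_nat => j /andP[_ jN]; exact: aN.
  rewrite sumr_const_nat subn0 -[leLHS]mulr_natr le_eqVlt; apply/orP; left.
  by apply/eqP; field; rewrite gt_eqF.
move=> z z1; have /andP[z1' z1''] : -1 <= z <= 1 by rewrite -ler_norml.
pose h := 2 / N%:R : R.
have h0 : 0 < h by rewrite divr_gt0.
pose J := Num.truncn ((z + 1) / h).
have zh : 0 <= (z + 1) / h by rewrite divr_ge0 ?(ltW h0)//; lra.
have /andP[J1 J2] := truncn_itv zh.
have uE j : u j = -1 + j%:R * h by rewrite /u /h; field; rewrite gt_eqF.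
have J1' : u J <= z by move: J1; rewrite ler_pdivlMr// uE; lra.
have J2' : z < u J + h.
  by move: J2; rewrite ltr_pdivrMr// -[J.+1%:R]natr1 uE; lra.
have JN : (J <= N)%N.
  rewrite -(ler_nat R); apply: le_trans J1 _; rewrite ler_pdivrMr// /h.
  by rewrite mulrCA mulfV ?gt_eqF//; lra.
(* Away from z the error of a steep sigmoid decays by the factor q per mesh step. As tau h <= 1, the
   geometric series on each side of z sums to at most N / tau; the cell containing z contributes at
   most 1 more. *)
pose q := expR (- (tau * h)).
have q1 : 1 - q >= tau / N%:R.
  have th : 0 < tau * h by rewrite mulr_gt0.
  have th1 : tau * h <= 1 by rewrite /h mulrA ler_pdivrMr// mul1r; lra.
  have e1 : 1 + tau * h <= expR (tau * h) := expR_ge1Dx _.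
  have qe : q * expR (tau * h) = 1 by rewrite /q mulrC expRxMexpNx_1.
  have q0 : 0 < q := expR_gt0 _.
  have : q * (1 + tau * h) <= 1 by rewrite -[leRHS]qe ler_pM2l.
  have -> : tau / N%:R = tau * h / 2 by rewrite /h; field; rewrite gt_eqF.
  by nra.
have q0 : 0 <= q by exact: expR_ge0.
have tN : 0 < tau / N%:R by rewrite divr_gt0.
have q01 : 0 <= q < 1 by rewrite q0 /=; lra.
have qV : (1 - q)^-1 <= N%:R / tau.
  by rewrite -[leRHS]invrK invf_div lef_pV2// posrE; lra.
pose e j := `|(if (j < J)%N then 1 else 0) - sigmoid (tau * (z - u j))|.
have qX j : expR (- (tau * (j%:R * h))) = q ^+ j.
  by rewrite /q -expRM_natl; congr expR; rewrite -mulr_natl; ring.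
have elow j : (j < J)%N -> e j <= q ^+ (J - j).
  move=> jJ; rewrite /e jJ -sigmoidN ger0_norm ?(ltW (sigmoid_gt0 _))//.
  apply: le_trans (sigmoid_le_expR _) _; rewrite -qX ler_expR lerN2 ler_pM2l//.
  by rewrite natrB 1?ltnW// mulrBl; move: J1'; rewrite !uE; lra.
have ehigh j : (J <= j)%N -> e j <= q ^+ (j - J).-1.
  move=> Jj; rewrite /e ltnNge Jj /= sub0r normrN ger0_norm ?(ltW (sigmoid_gt0 _))//.
  have [->|jJ] := eqVneq j J; first by rewrite subnn expr0 ltW// sigmoid_lt1.
  have {}Jj : (J < j)%N by rewrite ltn_neqAle eq_sym jJ.
  apply: le_trans (sigmoid_le_expR _) _; rewrite -qX ler_expR -mulrN ler_pM2l//.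
  rewrite -subnS natrB// mulrBl -[J.+1%:R]natr1.
  by move: J2'; rewrite !uE; lra.
have sum_e : \sum_(0 <= j < N) e j <= 2 * (N%:R / tau) + 1.
  rewrite (big_cat_nat (n := J))//=.
  have s1 : \sum_(0 <= j < J) e j <= N%:R / tau.
    apply: (@le_trans _ _ (\sum_(0 <= j < J) q ^+ j)); last first.
      exact: le_trans (geometric_sum_le _ q01) qV.
    rewrite big_nat_rev /= add0n; apply: ler_sum_nat => j /andP[_ jJ].
    apply: le_trans (elow _ _) _; first by rewrite ltn_subrL /= (leq_ltn_trans _ jJ).
    by rewrite subKn// exprS ler_piMl ?exprn_ge0//; lra.
  have s2 : \sum_(J <= j < N) e j <= 1 + N%:R / tau.
    have [NJ|JN'] := leqP N J.
      by rewrite big_geq// addr_ge0// divr_ge0// ltW.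
    rewrite big_ltn// lerD//; first by have := ehigh _ (leqnn J); rewrite subnn.
    rewrite -{1}[J.+1]add0n big_addn; apply: (@le_trans _ _ (\sum_(0 <= j < N - J.+1) q ^+ j)).
      apply: ler_sum_nat => j _; apply: le_trans (ehigh _ _) _.
        by rewrite addnS leqW// leq_addl.
      by rewrite addnS subSn ?leq_addl//= addnK.
    exact: le_trans (geometric_sum_le _ q01) qV.
  lra.
have u0 : u 0%N = -1 by rewrite /u mulr0 mul0r addr0.
(* With exact steps at the u_j the sum telescopes to H (u_J) - H (-1), so the error is that of
   rounding z down to u_J plus that of replacing steps by sigmoids. *)
have -> : H z - H (-1) - \sum_(0 <= j < N) a j * sigmoid (tau * (z - u j)) =
  (H z - H (u J)) +
  \sum_(0 <= j < N) a j * ((if (j < J)%N then 1 else 0) - sigmoid (tau * (z - u j))).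
  under [in RHS]eq_bigr do rewrite mulrBr.
  rewrite sumrB addrA; congr (_ - _).
  have -> : \sum_(0 <= j < N) a j * (if (j < J)%N then 1 else 0) = H (u J) - H (u 0%N).
    rewrite (big_cat_nat (n := J))//= [X in _ + X]big1_seq ?addr0; last first.
      move=> j; rewrite mem_index_iota => /andP[_ /andP[Jj _]].
      by rewrite ltnNge Jj mulr0.
    rewrite -(telescope_sumr (fun j => H (u j)))//.
    by apply: eq_big_nat => j /andP[_ ->]; rewrite mulr1.
  by rewrite u0 addrA subrK.
apply: le_trans (ler_normD _ _) _.
have b1 : `|H z - H (u J)| <= l * h.
  apply: le_trans (Hl z1 (u1 _ JN)) _; rewrite ler_wpM2l// ger0_norm; lra.
have b2 : `|\sum_(0 <= j < N) a j * ((if (j < J)%N then 1 else 0) - sigmoid (tau * (z - u j)))|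
   <= l * h * (2 * (N%:R / tau) + 1).
  apply: le_trans (ler_norm_sum _ _ _) _.
  apply: (@le_trans _ _ (\sum_(0 <= j < N) l * h * e j)); last first.
    by rewrite -mulr_sumr ler_wpM2l// mulr_ge0// ltW.
  apply: ler_sum_nat => j /andP[_ jN]; rewrite normrM ler_wpM2r//; exact: aN.
apply: le_trans (lerD b1 b2) _.
have -> : l * h + l * h * (2 * (N%:R / tau) + 1) = 4 * l / N%:R + 4 * l / tau.
  by rewrite /h; field; rewrite !gt_eqF.
have : 4 * l / N%:R <= 2 * l / tau.
  rewrite ler_pdivrMr// mulrAC ler_pdivlMr//.
  by have := ler_wpM2l l0 Ntau; lra.
lra.
Qed.

End step_functions.

(** * Fourier integrals tested against sigmoid neurons *)

Section fourier_dual.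
Context (R : realType) (d : nat).
Implicit Types (w x : 'rV[R]_d).
Local Notation V := (borel_rV R d).

Definition l1norm w : R := \sum_(j < d) `|w ord0 j|.

Lemma l1norm_ge0 w : 0 <= l1norm w. Proof. exact: sumr_ge0. Qed.

Lemma dot_le_l1norm w x : (forall j, `|x ord0 j| <= 1) -> `|dot w x| <= l1norm w.
Proof.
move=> x1; apply: le_trans (ler_norm_sum _ _ _) _; apply: ler_sum => j _.
by rewrite normrM ler_piMr.
Qed.

Lemma coord_le_l1norm w j : `|w ord0 j| <= l1norm w.
Proof. by rewrite /l1norm (bigD1 j)//= lerDl sumr_ge0. Qed.

Lemma dotZl (c : R) w x : dot (c *: w) x = c * dot w x.
Proof. by rewrite /dot mulr_sumr; apply: eq_bigr => j _; rewrite mxE mulrA. Qed.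

Lemma measurable_l1norm : measurable_fun [set: V] l1norm.
Proof.
apply: measurable_sum => j.
exact: (measurableT_comp (@normr_measurable R setT) (measurable_coord j)).
Qed.

Lemma measurable_dot2 : measurable_fun [set: V * V] (fun z => dot z.1 (to_cube z.2)).
Proof.
apply: measurable_sum => j; apply: measurable_funM.
  exact: (measurableT_comp (measurable_coord j) measurable_fst).
exact: (measurableT_comp (measurable_to_cube_coord j) measurable_snd).
Qed.

Lemma bmf_neuron w b : bmf (fun x : V => sigmoid (dot w (to_cube x) + b)).
Proof.
split; last by exists 1 => x; exact: sigmoid_norm.
apply: measurableT_comp; first exact: measurable_sigmoid.
apply: measurable_funD => //.
apply: measurable_sum => j; apply: measurable_funM => //.
exact: measurable_to_cube_coord.
Qed.

Variables (Q : probability V R) (rhom : {finite_measure set V -> \bar R}).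
Variables (K : R) (h : R -> R) (S : V -> R) (A tau : R).
Hypothesis rhoK : (\int[rhom]_w (l1norm w)%:E <= K%:E)%E.
Hypotheses (mh : measurable_fun [set: R] h) (h1 : forall u, `|h u| <= 1).
Hypothesis hlip : forall u v, `|h u - h v| <= `|u - v|.
Hypotheses (bS : bmf S) (A0 : 0 <= A) (tau0 : 0 < tau).
Hypothesis SA : forall w b, (forall j, `|w ord0 j| <= tau) -> `|b| <= tau ->
  `|\int[Q]_x (S x * sigmoid (dot w (to_cube x) + b))| <= A.

Lemma bmf_wave2 : bmf (fun z : V * V => h (dot z.1 (to_cube z.2))).
Proof.
split; last by exists 1 => z; exact: h1.
exact: (measurableT_comp mh measurable_dot2).
Qed.

Lemma bmf_wave_l1 : bmf (fun w : V => h (- l1norm w)).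
Proof.
split; last by exists 1 => z; exact: h1.
apply: (measurableT_comp mh); apply: measurable_funN; exact: measurable_l1norm.
Qed.

Lemma bmf_fourier : bmf (fun x : V => \int[rhom]_w h (dot w (to_cube x))).
Proof. exact: (bmf_Rintegralr rhom Q bmf_wave2). Qed.

(** Put l = [l1norm w]. On the cube z = w . x / l lies in [-1, 1], and z |-> h (l z) is l-Lipschitz,
    so [sigmoid_mixture] applies; its neurons have inner weights tau w / l and - tau u_j, all at
    most tau. The subtracted constant is the value at z = -1. *)
Lemma wave_dual w : `|\int[Q]_x (S x * (h (dot w (to_cube x)) - h (- l1norm w)))| <=
  l1norm w * (2 * A + 6 / tau * \int[Q]_x `|S x|).
Proof.
have x1 x : forall j, `|to_cube x ord0 j| <= 1 by exact: to_cube_norm.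
have := l1norm_ge0 w; rewrite le_eqVlt => /predU1P[l0|l0].
  rewrite -l0 mul0r oppr0.
  have -> : (fun x => S x * (h (dot w (to_cube x)) - h 0)) = fun=> 0.
    apply/funext => x; have := dot_le_l1norm w (x1 x).
    by rewrite -l0 normr_le0 => /eqP ->; rewrite subrr mulr0.
  by rewrite Rintegral_cstP normr0.
set l := l1norm w in l0 *.
have Hlip u v : `|u| <= 1 -> `|v| <= 1 -> `|h (l * u) - h (l * v)| <= l * `|u - v|.
  by move=> _ _; rewrite (le_trans (hlip _ _))// -mulrBr normrM gtr0_norm.
have [N [a [u [u1 a2 apx]]]] := @sigmoid_mixture R (fun z => h (l * z)) l tau (ltW l0) tau0 Hlip.
pose E x := h (dot w (to_cube x)) - h (- l) -
  \sum_(0 <= j < N) a j * sigmoid (dot ((tau / l) *: w) (to_cube x) + - (tau * u j)).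
have bh : bmf (fun x : V => h (dot w (to_cube x))) := bmf_sectionl bmf_wave2 w.
have bsum : bmf (fun x : V =>
    \sum_(0 <= j < N) a j * sigmoid (dot ((tau / l) *: w) (to_cube x) + - (tau * u j))).
  by apply: bmf_sum => j; apply: bmfZ; exact: bmf_neuron.
have bE : bmf (E : V -> R).
  by apply: bmfB => //; apply: bmfB => //; exact: bmf_cst.
have EN (x : V) : `|E x| <= 6 * l / tau.
  have z1 : `|dot w (to_cube x) / l| <= 1.
    by rewrite normrM normfV (gtr0_norm l0) ler_pdivrMr// mul1r dot_le_l1norm.
  have := apx _ z1; rewrite /= [l * (_ / l)]mulrC divfK ?gt_eqF// mulrN1 /E.
  rewrite (eq_bigr (fun j => a j * sigmoid (dot ((tau / l) *: w) (to_cube x) + - (tau * u j))))//.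
  by move=> j _; rewrite dotZl; congr (_ * sigmoid _); ring.
have -> : (fun x => S x * (h (dot w (to_cube x)) - h (- l))) =
   (fun x => S x * E x + \sum_(0 <= j < N) a j *
      (S x * sigmoid (dot ((tau / l) *: w) (to_cube x) + - (tau * u j)))).
  apply/funext => x; rewrite /E; rewrite [X in _ = _ + X](eq_bigr (fun j =>
    S x * (a j * sigmoid (dot ((tau / l) *: w) (to_cube x) + - (tau * u j))))); last
    by move=> j _; rewrite mulrCA.
  by rewrite -mulr_sumr -mulrDr subrK.
have bSs j : bmf (fun x : V => S x * sigmoid (dot ((tau / l) *: w) (to_cube x) + - (tau * u j))).
  by apply: bmfM => //; exact: bmf_neuron.
rewrite RintegralDT//; [|exact: bmfM|by apply: bmf_sum => j; exact: bmfZ].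
rewrite Rintegral_sumT; last by move=> j; exact: bmfZ.
have bnS := bmf_norm bS.
have p1 : `|\int[Q]_x (S x * E x)| <= 6 * l / tau * \int[Q]_x `|S x|.
  apply: le_trans (normr_RintegralT _ (bmfM bS bE)) _.
  rewrite -RintegralZT//; apply: le_RintegralT.
  - exact/bmf_norm/bmfM.
  - exact: bmfZ.
  by move=> x; rewrite normrM mulrC ler_wpM2r.
have p2 : `|\sum_(0 <= j < N)
     \int[Q]_x (a j * (S x * sigmoid (dot ((tau / l) *: w) (to_cube x) + - (tau * u j))))|
    <= 2 * l * A.
  apply: le_trans (ler_norm_sum _ _ _) _.
  apply: (@le_trans _ _ (\sum_(0 <= j < N) `|a j| * A)); last first.
    by rewrite -mulr_suml ler_wpM2r.
  apply: ler_sum_nat => j /andP[_ jN]; rewrite RintegralZT// normrM ler_wpM2l//.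
  apply: SA => [i|].
    rewrite mxE normrM ger0_norm ?divr_ge0 ?(ltW tau0) ?(ltW l0)//.
    rewrite mulrAC ler_pdivrMr// ler_wpM2l ?(ltW tau0)//.
    exact: coord_le_l1norm.
  by rewrite normrN normrM (gtr0_norm tau0) ler_piMr ?(ltW tau0)// u1.
apply: le_trans (ler_normD _ _) _; apply: le_trans (lerD p1 p2) _.
by rewrite le_eqVlt; apply/orP; left; apply/eqP; field; rewrite gt_eqF.
Qed.

(** A bound on the pairing with every S is linear in the function paired, so mixing over frequencies
    is just Fubini, with the first moment K of the measure as total weight. *)
Lemma fourier_dual :
  `|\int[Q]_x (S x * (\int[rhom]_w h (dot w (to_cube x)) - \int[rhom]_w h (- l1norm w)))| <=
  K * (2 * A + 6 / tau * \int[Q]_x `|S x|).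
Proof.
pose F (z : V * V) := S z.2 * (h (dot z.1 (to_cube z.2)) - h (- l1norm z.1)).
have bF : bmf F.
  apply: bmfM; first exact: (bmf_comp measurable_snd bS).
  by apply: bmfB; [exact: bmf_wave2|exact: (bmf_comp measurable_fst bmf_wave_l1)].
have e : (fun x : V => S x * (\int[rhom]_w h (dot w (to_cube x)) - \int[rhom]_w h (- l1norm w))) =
    (fun x => \int[rhom]_w F (w, x)).
  apply/funext => x; rewrite -RintegralBT//; last exact: bmf_wave_l1.
    by rewrite -RintegralZT//; apply: bmfB; [exact: (bmf_sectionr bmf_wave2 x)|exact: bmf_wave_l1].
  exact: (bmf_sectionr bmf_wave2 x).
rewrite e -(Rintegral_Fubini rhom Q bF).
have bG := bmf_Rintegral rhom Q bF.
apply: le_trans (normr_RintegralT _ bG) _.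
set B := 2 * A + _.
have B0 : 0 <= B.
  have I0 : 0 <= \int[Q]_x `|S x| by apply: Rintegral_ge0 => x _.
  apply: addr_ge0; first exact: mulr_ge0.
  by apply: mulr_ge0 => //; apply: divr_ge0 => //; exact: ltW.
rewrite -lee_fin -ERintegral; last exact: bmf_norm.
apply: (@le_trans _ _ (\int[rhom]_w (B%:E * (l1norm w)%:E))%E).
  apply: ge0_le_integral => //.
  - by apply/measurable_EFinP; case: (bmf_norm bG).
  - apply/measurable_EFinP; apply: measurable_funM => //; exact: measurable_l1norm.
  - by move=> w _; rewrite -EFinM lee_fin mulrC; exact: wave_dual.
rewrite ge0_integralZl//; last 2 first.
- by apply/measurable_EFinP; exact: measurable_l1norm.
- by move=> w _; rewrite lee_fin l1norm_ge0.
by rewrite mulrC EFinM lee_wpmul2l.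
Qed.

End fourier_dual.

(* Applies to suprema of uncountable families, whose measurability is unclear. *)
Lemma ge0_le_integralT d (T : measurableType d) (R : realType)
    (mu : {measure set T -> \bar R}) (f g : T -> \bar R) :
  (forall x, (0 <= f x)%E) -> (forall x, (f x <= g x)%E) ->
  (\int[mu]_x f x <= \int[mu]_x g x)%E.
Proof.
move=> f0 fg; rewrite !ge0_integralTE//; last by move=> x; exact: le_trans (fg x).
apply: le_ereal_sup => _ [h hf <-]; exists h => // x.
exact: le_trans (hf x) (fg x).
Qed.

Section greedy.
Context (R : realType) (d : nat) (Q : probability (borel_rV R d) R).
Local Notation V := (borel_rV R d).
Variables (f0 : V -> R) (K M0 tau : R).
Hypotheses (bf0 : bmf f0) (f0M : forall x, `|f0 x| <= M0).
Hypotheses (K0 : 0 <= K) (tau0 : 0 < tau).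
Hypothesis dual : forall (S : V -> R) (A : R), bmf S -> 0 <= A ->
  (forall (w : 'rV[R]_d) (b : R), (forall j, `|w ord0 j| <= tau) -> `|b| <= tau ->
     `|\int[Q]_x (S x * sigmoid (dot w (to_cube x) + b))| <= A) ->
  `|\int[Q]_x (S x * f0 x)| <= K * (2 * A + 6 / tau * \int[Q]_x `|S x|).

Definition neuron (p : 'rV[R]_d * R * R) (x : V) : R :=
  p.2 * sigmoid (dot p.1.1 (to_cube x) + p.1.2).

Definition good_neuron (a c : R) (p : 'rV[R]_d * R * R) :=
  [/\ forall j, `|p.1.1 ord0 j| <= a, `|p.1.2| <= a & `|p.2| <= c].

Lemma bmf_neuronp p : bmf (neuron p).
Proof. exact/bmfZ/bmf_neuron. Qed.

Let G := 2 * K + 1.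

(** Otherwise, using outer weights G and -G, every neuron pairs with S to less than A = - (I + E) /
    G in absolute value. Then [dual] gives |I| <= 2 K A + E < - I, a contradiction; the last
    inequality is strict because G = 2 K + 1 exceeds 2 K. *)
Lemma greedy_choice (S : V -> R) : bmf S -> exists p, good_neuron tau G p /\
  \int[Q]_x (S x * (neuron p x - f0 x)) <= 6 * K / tau * \int[Q]_x `|S x|.
Proof.
move=> bS; set E := 6 * K / tau * _; set I := \int[Q]_x (S x * f0 x).
have G0 : 0 < G by move: K0; rewrite /G; lra.
have bSn p : bmf (fun x => S x * neuron p x) by apply: bmfM => //; exact: bmf_neuronp.
have bSf : bmf (fun x => S x * f0 x) by exact: bmfM.
have split_int p : \int[Q]_x (S x * (neuron p x - f0 x)) = \int[Q]_x (S x * neuron p x) - I.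
  by rewrite -RintegralBT//; apply: eq_Rintegral => x _; rewrite mulrBr.
apply: contrapT => no.
have {}no p : good_neuron tau G p -> I + E < \int[Q]_x (S x * neuron p x).
  move=> gp; rewrite ltNge; apply/negP => h; apply: no; exists p; split => //.
  by rewrite split_int; lra.
pose sg (w : 'rV[R]_d) (b : R) := \int[Q]_x (S x * sigmoid (dot w (to_cube x) + b)).
have sgE w b (c : R) : \int[Q]_x (S x * neuron (w, b, c) x) = c * sg w b.
  rewrite /sg -RintegralZT; last by apply: bmfM => //; exact: bmf_neuron.
  by apply: eq_Rintegral => x _; rewrite /neuron /= mulrCA.
have sgV (w : 'rV[R]_d) (b : R) : (forall j, `|w ord0 j| <= tau) -> `|b| <= tau ->
    G * `|sg w b| < - (I + E).
  move=> hw hb.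
  have h1 : I + E < G * sg w b.
    by rewrite -sgE; apply: no; split => //=; rewrite gtr0_norm.
  have h2 : I + E < - G * sg w b.
    by rewrite -sgE; apply: no; split => //=; rewrite normrN gtr0_norm.
  by have [_|_] := ger0P (sg w b); lra.
have V0 : 0 <= - (I + E).
  have z1 j : `|(0 : 'rV[R]_d) ord0 j| <= tau by rewrite mxE normr0 ltW.
  have z2 : `|0 : R| <= tau by rewrite normr0 ltW.
  by apply: le_trans (ltW (sgV _ _ z1 z2)); rewrite mulr_ge0// ltW.
have z1 j : `|(0 : 'rV[R]_d) ord0 j| <= tau by rewrite mxE normr0 ltW.
have z2 : `|0 : R| <= tau by rewrite normr0 ltW.
have V1 : 0 < - (I + E) by apply: le_lt_trans (sgV _ _ z1 z2); rewrite mulr_ge0// ltW.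
have A0 : 0 <= - (I + E) / G by rewrite divr_ge0// ltW.
have : `|I| <= K * (2 * (- (I + E) / G) + 6 / tau * \int[Q]_x `|S x|).
  by apply: dual => // w b hw hb; rewrite ler_pdivlMr// mulrC ltW// sgV.
have -> : K * (2 * (- (I + E) / G) + 6 / tau * \int[Q]_x `|S x|) =
  (2 * K) * (- (I + E) / G) + E by rewrite /E; ring.
have : (2 * K) * (- (I + E) / G) < - (I + E).
  rewrite mulrA ltr_pdivrMr// mulrC ltr_pM2l// /G; lra.
have := ler_norm (- I); rewrite normrN.
lra.
Qed.

Let c := G + M0.
Let B := c + 12 * K.

(** For unnormalised sums S, adding a neuron raises the integral of S^2 by a cross term and by at
    most c^2. The L^1 norm of S is at most sqrt k B, so tau >= sqrt k makes the cross term at most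
    12 K B; this is where steep inner weights are needed. Finally 12 K B + c^2 <= B^2 as B = c + 12
    K. *)
Lemma greedy_sequence (k i : nat) : (0 < k)%N -> Num.sqrt k%:R <= tau -> (i <= k)%N ->
  exists s : seq ('rV[R]_d * R * R), [/\ size s = i, forall p, p \in s -> good_neuron tau G p &
    \int[Q]_x ((\sum_(p <- s) neuron p x - i%:R * f0 x) ^+ 2) <= i%:R * B ^+ 2].
Proof.
move=> k0 ktau; have M00 : 0 <= M0 by exact: le_trans (f0M 0).
have G0 : 0 < G by move: K0; rewrite /G; lra.
have c0 : 0 < c by rewrite /c; lra.
have B0 : 0 < B by move: K0; rewrite /B; lra.
have sk : 0 < Num.sqrt k%:R :> R by rewrite sqrtr_gt0 ltr0n.
have bS (s : seq ('rV[R]_d * R * R)) j : bmf (fun x => \sum_(p <- s) neuron p x - j%:R * f0 x).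
  by apply: bmfB; [by apply: bmf_sum => p; exact: bmf_neuronp|exact: bmfZ].
elim: i => [|i IH] ik.
  exists [::]; split => //; rewrite mul0r.
  under eq_Rintegral do rewrite big_nil mul0r subrr expr0n /=.
  by rewrite Rintegral_cstP.
have [s [ss sgood sB]] := IH (ltnW ik).
pose S x := \sum_(p <- s) neuron p x - i%:R * f0 x.
have bSS : bmf S by exact: bS.
have [p [pgood pS]] := greedy_choice bSS.
exists (p :: s); split; first by rewrite /= ss.
  by move=> q; rewrite inE => /predU1P[->//|]; exact: sgood.
pose r x := neuron p x - f0 x.
have br : bmf r by apply: bmfB => //; exact: bmf_neuronp.
have bS2 : bmf (fun x => S x ^+ 2) by exact: (bmfM bSS bSS).
have bSr : bmf (fun x => S x * r x) by exact: bmfM.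
have br2 : bmf (fun x => r x ^+ 2) by exact: (bmfM br br).
have -> : (fun x => (\sum_(p0 <- p :: s) neuron p0 x - i.+1%:R * f0 x) ^+ 2) =
    (fun x => (S x ^+ 2 + 2 * (S x * r x)) + r x ^+ 2).
  by apply/funext => x; rewrite big_cons /S /r -[i.+1%:R]natr1; ring.
rewrite RintegralDT//; last exact: bmfD bS2 (bmfZ _ bSr).
rewrite RintegralDT// ?RintegralZT//; last exact: bmfZ.
have rc x : `|r x| <= c.
  apply: le_trans (ler_normB _ _) _; rewrite /c lerD// normrM -[leRHS]mulr1.
  by have [_ _ h] := pgood; rewrite ler_pM// sigmoid_norm.
have r2 : \int[Q]_x (r x ^+ 2) <= c ^+ 2.
  apply: Rintegral_le_cstP => // x; rewrite -real_normK ?num_real//.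
  by rewrite ler_pXn2r ?nnegrE// ltW.
have y0 : 0 < Num.sqrt k%:R * B by rewrite mulr_gt0.
have iB : \int[Q]_x (S x ^+ 2) <= (Num.sqrt k%:R * B) ^+ 2.
  rewrite exprMn sqr_sqrtr ?ler0n//; apply: le_trans sB _.
  by rewrite ler_wpM2r ?sqr_ge0// ler_nat ltnW.
have S1 : \int[Q]_x `|S x| <= Num.sqrt k%:R * B.
  set y := Num.sqrt k%:R * B in y0 iB *.
  (* The pointwise bound |S| <= S^2 / (2 y) + y / 2 replaces the Cauchy-Schwarz inequality. *)
  apply: (@le_trans _ _ (\int[Q]_x ((2 * y)^-1 * S x ^+ 2 + y / 2))).
    apply: le_RintegralT; [exact: bmf_norm|by apply: bmfD; [exact: bmfZ|exact: bmf_cst]|].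
    move=> x; rewrite -(real_normK (num_real (S x))); move: (normr_ge0 (S x)).
    move: `|S x| => u u0.
    have -> : (2 * y)^-1 * u ^+ 2 + y / 2 = (u ^+ 2 + y ^+ 2) / (2 * y).
      by field; rewrite gt_eqF.
    rewrite ler_pdivlMr ?mulr_gt0//.
    by have := sqr_ge0 (u - y); rewrite sqrrB; lra.
  rewrite RintegralDT; [|exact: bmfZ|exact: bmf_cst].
  rewrite RintegralZT// Rintegral_cstP.
  have h : (2 * y)^-1 * \int[Q]_x (S x ^+ 2) <= (2 * y)^-1 * y ^+ 2.
    by rewrite ler_wpM2l// invr_ge0 mulr_ge0// ltW.
  apply: le_trans (lerD h (lexx _)) _; rewrite le_eqVlt; apply/orP; left; apply/eqP.
  by field; rewrite gt_eqF.
have cross : \int[Q]_x (S x * r x) <= 6 * K * B.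
  apply: le_trans pS _.
  apply: (@le_trans _ _ (6 * K / tau * (Num.sqrt k%:R * B))).
    by rewrite ler_wpM2l// divr_ge0 ?(ltW tau0)// mulr_ge0.
  rewrite mulrA ler_wpM2r ?(ltW B0)// mulrAC ler_pdivrMr// ler_wpM2l//.
  by rewrite mulr_ge0.
rewrite -[i.+1%:R]natr1 mulrDl mul1r.
have key : 2 * (6 * K * B) + c ^+ 2 <= B ^+ 2.
  by move: K0 c0; rewrite /B; nra.
lra.
Qed.

End greedy.

Section magnitude.
Context d (T : measurableType d) (R : realType) (nu : complex_measure T R).
Variable F : {finite_measure set T -> \bar R}.
Hypothesis nuF : is_magnitude nu F.

Lemma le_magnitude A : measurable A ->
  ((Num.sqrt (fine (cm_re nu A) ^+ 2 + fine (cm_im nu A) ^+ 2))%:E <= F A)%E.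
Proof.
move=> mA; rewrite nuF//; apply: ereal_sup_ubound.
(* The trivial partition of A already attains the modulus of the complex measure of A. *)
exists (fun n => if n is 0%N then A else set0); split.
- by case.
- apply/trivIsetP => -[|i] [|j] _ _ //= _; by rewrite ?setI0 ?set0I.
- by apply/seteqP; split => [x [[|i]]//|x Ax]; exists 0%N.
- rewrite nneseries_recl//.
  rewrite [X in (_ + X)%E](_ : _ = 0%E) ?adde0//; apply: eseries0 => -[|i] //= _ _.
  by rewrite !charge0 /= expr0n /= addr0 sqrtr0.
Qed.

Lemma re_le_magnitude A : measurable A -> (`|cm_re nu A| <= F A)%E.
Proof.
move=> mA; apply: le_trans (le_magnitude mA).
rewrite -(fineK (fin_num_measure (cm_re nu) A mA)) lee_fin /=.
by rewrite -sqrtr_sqr ler_wsqrtr// lerDl sqr_ge0.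
Qed.

Lemma im_le_magnitude A : measurable A -> (`|cm_im nu A| <= F A)%E.
Proof.
move=> mA; apply: le_trans (le_magnitude mA).
rewrite -(fineK (fin_num_measure (cm_im nu) A mA)) lee_fin /=.
by rewrite -sqrtr_sqr ler_wsqrtr// lerDr sqr_ge0.
Qed.

Section jordan.
Variables (mu : {charge set T -> \bar R}) (P N : set T).
Hypothesis muPN : hahn_decomposition mu P N.
Hypothesis muF : forall A, measurable A -> (`|mu A| <= F A)%E.

Lemma jordan_pos_le A : measurable A -> (jordan_pos muPN A <= F A)%E.
Proof.
move=> mA; have [[mP _] _ _ _] := muPN.
rewrite jordan_posE cjordan_posE /crestr0 mem_set//= /crestr.
have mAP : measurable (A `&` P) by exact: measurableI.
apply: le_trans (lee_abs _) _; apply: le_trans (muF mAP) _.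
by apply: le_measure; rewrite ?inE//; exact: subIsetl.
Qed.

Lemma jordan_neg_le A : measurable A -> (jordan_neg muPN A <= F A)%E.
Proof.
move=> mA; have [_ [mN _] _ _] := muPN.
rewrite jordan_negE cjordan_negE /crestr0 mem_set//= /crestr.
have mAN : measurable (A `&` N) by exact: measurableI.
apply: le_trans (lee_abs _) _; rewrite abseN; apply: le_trans (muF mAN) _.
by apply: le_measure; rewrite ?inE//; exact: subIsetl.
Qed.

End jordan.
End magnitude.

Section barron_approximation.
Context (R : realType) (d : nat).
Local Notation V := (borel_rV R d).

(** Test at the vertex of the cube that selects the nonnegative coordinates of w and at the opposite
    vertex: the absolute values of the two products add up to the l1 norm, so one of them is at
    least half of it. *)
Lemma half_l1norm_le (w : 'rV[R]_d) :
  ((l1norm w / 2)%:E <= ereal_sup [set `|dot w x|%:E | x in @cube R d])%E.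
Proof.
pose xp : 'rV[R]_d := \row_j (if 0 <= w ord0 j then 1 else 0).
pose xn : 'rV[R]_d := \row_j (if 0 <= w ord0 j then 0 else 1).
have cxp : cube xp by move=> j; rewrite mxE; case: ifP; rewrite ?lexx ?ler01.
have cxn : cube xn by move=> j; rewrite mxE; case: ifP; rewrite ?lexx ?ler01.
have e : l1norm w = dot w xp - dot w xn.
  rewrite /l1norm /dot -sumrB; apply: eq_bigr => j _; rewrite !mxE.
  by have [h|h] := ler0P (w ord0 j); case: ifPn; rewrite ?mulr1 ?mulr0; lra.
have [h|h] := leP (`|dot w xn|) (`|dot w xp|).
  apply: le_trans (ereal_sup_ubound _); last by exists xp; [exact: cxp|reflexivity].
  rewrite lee_fin e; have := ler_norm (dot w xp); have := ler_norm (- dot w xn).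
  by rewrite normrN; lra.
apply: le_trans (ereal_sup_ubound _); last by exists xn; [exact: cxn|reflexivity].
rewrite lee_fin e; have := ler_norm (dot w xp); have := ler_norm (- dot w xn).
by rewrite normrN; lra.
Qed.

Lemma l1norm_barron_coef (F rhom : {finite_measure set V -> \bar R}) (c : R) :
  (barron_coef F <= c%:E)%E -> (forall A, measurable A -> (rhom A <= F A)%E) ->
  (\int[rhom]_w (l1norm w)%:E <= (2 * c)%:E)%E.
Proof.
move=> Fc rF.
have ml : measurable_fun [set: V] (fun w : V => (l1norm w / 2)%:E).
  by apply/measurable_EFinP; apply: measurable_funM => //; exact: measurable_l1norm.
have h0 (w : 'rV[R]_d) : (0 <= (l1norm w / 2)%:E)%E by rewrite lee_fin divr_ge0// l1norm_ge0.
have h : (\int[rhom]_w (l1norm w / 2)%:E <= c%:E)%E.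
  have h1 := @ge0_le_measure_integral _ V R rhom F rF _ setT measurableT h0 ml.
  apply: le_trans h1 _.
  apply: le_trans Fc; apply: ge0_le_integralT => //; exact: half_l1norm_le.
have -> : (\int[rhom]_w (l1norm w)%:E = 2%:E * \int[rhom]_w (l1norm w / 2)%:E)%E.
  rewrite -ge0_integralZl//; apply: eq_integral => w _; rewrite -EFinM; congr (_ %:E).
  by field.
by rewrite EFinM lee_wpmul2l.
Qed.

Lemma derive_lipschitz (f df : R -> R) : (forall x : R, is_derive x (1 : R) f (df x)) ->
  (forall x, `|df x| <= 1) -> forall u v, `|f u - f v| <= `|u - v|.
Proof.
move=> hf df1.
suff h u v : u < v -> `|f v - f u| <= v - u.
  move=> u v; have [uv|vu|->] := ltgtP u v; last by rewrite !subrr.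
    by rewrite distrC [leRHS]distrC [leRHS]gtr0_norm ?subr_gt0// h.
  by rewrite [leRHS]gtr0_norm ?subr_gt0// h.
move=> uv.
have cf : {within `[u, v], continuous f}.
  apply: continuous_subspaceT => x; apply: differentiable_continuous.
  by apply/derivable1_diffP; have [] := hf x.
have [c _ ->] := MVT uv (fun x _ => hf x) cf.
by rewrite normrM [X in _ * X]gtr0_norm ?subr_gt0// ler_piMl ?df1 ?subr_ge0 ?(ltW uv).
Qed.

Lemma cos_lipschitz (u v : R) : `|cos u - cos v| <= `|u - v|.
Proof.
apply: derive_lipschitz (@is_derive_cos R) _ u v => x.
by rewrite normrN ler_norml sin_geN1 sin_le1.
Qed.

Lemma sin_lipschitz (u v : R) : `|sin u - sin v| <= `|u - v|.
Proof.
apply: derive_lipschitz (@is_derive_sin R) _ u v => x.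
by rewrite ler_norml cos_geN1 cos_le1.
Qed.

Lemma measurable_cos : measurable_fun [set: R] (@cos R).
Proof. apply: continuous_measurable_fun; exact: continuous_cos. Qed.

Lemma measurable_sin : measurable_fun [set: R] (@sin R).
Proof. apply: continuous_measurable_fun; exact: continuous_sin. Qed.

(** The Jordan parts of the real and imaginary parts of the Fourier measure are four positive
    measures, each below the magnitude and so with first moment at most 2 c. Adding their dual
    bounds gives K = 4 (2 c). *)
Lemma barron_approx (Q : probability V R) (M : R) (f : 'rV[R]_d -> R) :
  hellinger_class M f -> exists (f0 : V -> R) (Bc G c0 : R),
  [/\ bmf f0, (forall x, cube x -> f x = f0 x) &
   forall (k : nat) (tau : R), (0 < k)%N -> Num.sqrt k%:R <= tau ->
   exists (w : 'I_k -> 'rV[R]_d) (b beta : 'I_k -> R),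
   [/\ forall i j, `|w i ord0 j| <= tau, forall i, `|b i| <= tau,
       forall i, `|beta i| <= G / k%:R, `|c0| <= G &
       \int[Q]_x ((f0 x -
         (\sum_(i < k) beta i * sigmoid (dot (w i) (to_cube x) + b i) + c0)) ^+ 2)
       <= Bc / k%:R]].
Proof.
rewrite /hellinger_class /= => hM.
have : (barron_const f <= M%:E)%E by apply: le_trans hM; rewrite le_max lexx.
move=> /le_lt_trans/(_ (ltry _))/ereal_inf_lt[_ [c [c0 [f' hf' ff']] <-] _].
have [nu [F [nuF fou hc]]] := hf'.
have Fc : (barron_coef F <= c%:E)%E by apply: le_trans hc; rewrite le_max lexx.
have c4 : 0 <= 2 * c by rewrite mulr_ge0.
pose reP := cid (Hahn_decomposition (cm_re nu)).
pose reN := cid (svalP reP).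
pose imP := cid (Hahn_decomposition (cm_im nu)).
pose imN := cid (svalP imP).
pose r1 : {finite_measure set V -> \bar R} := jordan_pos (svalP reN).
pose r2 : {finite_measure set V -> \bar R} := jordan_neg (svalP reN).
pose r3 : {finite_measure set V -> \bar R} := jordan_pos (svalP imN).
pose r4 : {finite_measure set V -> \bar R} := jordan_neg (svalP imN).
have K1 : (\int[r1]_w (l1norm w)%:E <= (2 * c)%:E)%E.
  apply: l1norm_barron_coef Fc _ => A mA; apply: jordan_pos_le => // B mB.
  exact: re_le_magnitude.
have K2 : (\int[r2]_w (l1norm w)%:E <= (2 * c)%:E)%E.
  apply: l1norm_barron_coef Fc _ => A mA; apply: jordan_neg_le => // B mB.
  exact: re_le_magnitude.
have K3 : (\int[r3]_w (l1norm w)%:E <= (2 * c)%:E)%E.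
  apply: l1norm_barron_coef Fc _ => A mA; apply: jordan_pos_le => // B mB.
  exact: im_le_magnitude.
have K4 : (\int[r4]_w (l1norm w)%:E <= (2 * c)%:E)%E.
  apply: l1norm_barron_coef Fc _ => A mA; apply: jordan_neg_le => // B mB.
  exact: im_le_magnitude.
have cos1 (u : R) : `|cos u| <= 1 by rewrite ler_norml cos_geN1 cos_le1.
have sin1 (u : R) : `|sin u| <= 1 by rewrite ler_norml sin_geN1 sin_le1.
pose D (r : {finite_measure set V -> \bar R}) h (x : V) :=
  \int[r]_w h (dot w (to_cube x)) - \int[r]_w h (- l1norm w).
have bDc r : bmf (D r cos).
  apply: bmfB; last exact: bmf_cst.
  exact: (bmf_fourier Q r measurable_cos cos1).
have bDs r : bmf (D r sin).
  apply: bmfB; last exact: bmf_cst.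
  exact: (bmf_fourier Q r measurable_sin sin1).
pose f0 (x : V) := D r1 cos x - D r2 cos x - (D r3 sin x - D r4 sin x).
have bf0 : bmf f0 by apply: bmfB; exact: bmfB.
(* The constants subtracted in the four functions [D]; they become the constant term of the
   network. *)
pose cc := \int[r1]_w cos (- l1norm w) - \int[r2]_w cos (- l1norm w) -
  (\int[r3]_w sin (- l1norm w) - \int[r4]_w sin (- l1norm w)).
have f'E x : f' (to_cube x) = f0 x + cc.
  have [-> _] := fou (to_cube x).
  by rewrite /f0 /D /cc /charge_integral -/r1 -/r2 -/r3 -/r4; ring.
have bf' : bmf (fun x : V => f' (to_cube x)).
  by under eq_fun do rewrite f'E; apply: bmfD => //; exact: bmf_cst.
have [_ [M0 f0M]] := bf0.
pose K := 4 * (2 * c).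
have K0 : 0 <= K by rewrite mulr_ge0.
have dual tau (tau0 : 0 < tau) (S : V -> R) (A : R) : bmf S -> 0 <= A ->
  (forall (w : 'rV[R]_d) (b : R), (forall j, `|w ord0 j| <= tau) -> `|b| <= tau ->
     `|\int[Q]_x (S x * sigmoid (dot w (to_cube x) + b))| <= A) ->
  `|\int[Q]_x (S x * f0 x)| <= K * (2 * A + 6 / tau * \int[Q]_x `|S x|).
  move=> bS A0 SA.
  have d1 := fourier_dual K1 measurable_cos cos1 cos_lipschitz bS A0 tau0 SA.
  have d2 := fourier_dual K2 measurable_cos cos1 cos_lipschitz bS A0 tau0 SA.
  have d3 := fourier_dual K3 measurable_sin sin1 sin_lipschitz bS A0 tau0 SA.
  have d4 := fourier_dual K4 measurable_sin sin1 sin_lipschitz bS A0 tau0 SA.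
  have -> : (fun x => S x * f0 x) = (fun x =>
     (S x * D r1 cos x - S x * D r2 cos x) - (S x * D r3 sin x - S x * D r4 sin x)).
    by apply/funext => x; rewrite /f0; ring.
  have b1 r := bmfM bS (bDc r).
  have b2 r := bmfM bS (bDs r).
  rewrite RintegralBT ?RintegralBT//; [|exact: bmfB|exact: bmfB].
  apply: le_trans (ler_normB _ _) _.
  apply: le_trans (lerD (ler_normB _ _) (ler_normB _ _)) _.
  apply: le_trans (lerD (lerD d1 d2) (lerD d3 d4)) _.
  by rewrite /K le_eqVlt; apply/orP; left; apply/eqP; ring.
exists (fun x => f' (to_cube x)), ((2 * K + 1 + M0 + 12 * K) ^+ 2), (Num.max (2 * K + 1) `|cc|), cc.
split => //; first by move=> x cx; rewrite ff'// to_cube_id.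
move=> k tau k0 ktau.
have k0' : (0 : R) < k%:R by rewrite ltr0n.
have tau0 : 0 < tau by apply: lt_le_trans ktau; rewrite sqrtr_gt0.
have [s [ss sg sB]] := greedy_sequence bf0 f0M K0 tau0 (dual _ tau0) k0 ktau (leqnn k).
pose p0 : 'rV[R]_d * R * R := (0, 0, 0).
have good (i : 'I_k) : good_neuron tau (2 * K + 1) (nth p0 s i).
  by apply: sg; rewrite mem_nth// ss.
exists (fun i => (nth p0 s i).1.1), (fun i => (nth p0 s i).1.2), (fun i => (nth p0 s i).2 / k%:R).
split.
- by move=> i j; have [h _ _] := good i.
- by move=> i; have [_ h _] := good i.
- move=> i; have [_ _ h] := good i.
  rewrite normrM [X in _ * X]ger0_norm ?invr_ge0 ?(ltW k0')// ler_pM2r ?invr_gt0//.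
  by rewrite le_max h.
- by rewrite le_max lexx orbT.
have -> : (fun x : V => (f' (to_cube x) - (\sum_(i < k) (nth p0 s i).2 / k%:R *
     sigmoid (dot (nth p0 s i).1.1 (to_cube x) + (nth p0 s i).1.2) + cc)) ^+ 2) =
  (fun x => k%:R^-1 ^+ 2 * (\sum_(p <- s) neuron p x - k%:R * f0 x) ^+ 2).
  apply/funext => x; rewrite f'E -exprMn -[LHS]sqrrN; congr (_ ^+ 2).
  rewrite mulrBr mulrA mulVf ?gt_eqF// mul1r (big_nth p0) ss big_mkord mulr_sumr.
  have -> : \sum_(i < k) (nth p0 s i).2 / k%:R *
     sigmoid (dot (nth p0 s i).1.1 (to_cube x) + (nth p0 s i).1.2) =
     \sum_(i < k) k%:R^-1 * neuron (nth p0 s i) x.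
    by apply: eq_bigr => i _; rewrite /neuron; ring.
  ring.
have bn : bmf (fun x : V => \sum_(p <- s) neuron p x - k%:R * f0 x).
  by apply: bmfB; [apply: bmf_sum => p; exact: bmf_neuronp|exact: bmfZ].
rewrite RintegralZT; last by have := bmfM bn bn.
apply: le_trans (ler_wpM2l (sqr_ge0 _) sB) _.
by rewrite le_eqVlt; apply/orP; left; apply/eqP; field; rewrite gt_eqF.
Qed.

End barron_approximation.

(** * Deviations of the estimator *)

Section truncations.
Context (R : realType) (t : R).
Hypothesis t0 : 0 < t.

Definition trunc (v : R) : R := Num.min (1 - t) v.
Definition trunc_odds (v : R) : R := trunc v / (1 - trunc v).

Lemma trunc_le v : t <= 1 - trunc v.
Proof. by rewrite lerBrDr addrC -lerBrDr /trunc ge_min lexx. Qed.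

Lemma trunc_homo : {homo trunc : u v / u <= v}.
Proof. by move=> u v uv; rewrite /trunc le_min !ge_min lexx uv orbT. Qed.

Lemma trunc_lipschitz : lipschitz_cst trunc 1.
Proof.
move=> u v; rewrite mul1r /trunc.
wlog uv : u v / u <= v.
  move=> h; have [|/ltW] := leP u v; first exact: h.
  by rewrite (distrC u) (distrC (Num.min _ u)); exact: h.
have := trunc_homo uv; rewrite /trunc => h.
rewrite (distrC u) (distrC (Num.min _ u)) !ger0_norm ?subr_ge0//; move: h.
have [h1|h1] := leP (1 - t) u; have [h2|h2] := leP (1 - t) v; lra.
Qed.

Lemma trunc_oddsE v : trunc_odds v = (1 - trunc v)^-1 - 1.
Proof.
have h : 1 - trunc v != 0 by rewrite gt_eqF// (lt_le_trans t0)// trunc_le.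
by rewrite /trunc_odds; field.
Qed.

Lemma trunc_odds_homo : {homo trunc_odds : u v / u <= v}.
Proof.
move=> u v uv; rewrite !trunc_oddsE lerD2r lef_pV2 ?posrE ?(lt_le_trans t0) ?trunc_le//.
by rewrite lerD2l lerN2 trunc_homo.
Qed.

Lemma trunc_odds_lipschitz : lipschitz_cst trunc_odds (t ^- 2).
Proof.
move=> u v; rewrite !trunc_oddsE.
have hu := trunc_le u; have hv := trunc_le v.
have pu : 0 < 1 - trunc u by exact: lt_le_trans hu.
have pv : 0 < 1 - trunc v by exact: lt_le_trans hv.
have -> : (1 - trunc u)^-1 - 1 - ((1 - trunc v)^-1 - 1) =
   (1 - trunc u)^-1 * (1 - trunc v)^-1 * (trunc u - trunc v).
  by field; rewrite !gt_eqF.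
rewrite normrM ler_pM//; last by have := trunc_lipschitz u v; rewrite mul1r.
rewrite ger0_norm ?mulr_ge0 ?invr_ge0 ?(ltW pu) ?(ltW pv)//.
by rewrite expr2 invfM ler_pM ?invr_ge0 ?(ltW pu) ?(ltW pv)// lef_pV2 ?posrE.
Qed.

Lemma measurable_trunc : measurable_fun [set: R] trunc.
Proof. by apply: nondecreasing_measurable => //; exact: trunc_homo. Qed.

Lemma measurable_trunc_odds : measurable_fun [set: R] trunc_odds.
Proof. by apply: nondecreasing_measurable => //; exact: trunc_odds_homo. Qed.

Lemma lipschitz_cstW (phi : R -> R) L L' : L <= L' -> lipschitz_cst phi L -> lipschitz_cst phi L'.
Proof. by move=> LL' h u v; rewrite (le_trans (h u v))// ler_wpM2r. Qed.

End truncations.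

Section class_deviations.
Context (R : realType) (d : nat).
Local Notation V := (borel_rV R d).

(** Coordinate 0 is the constant 1, so that the bias of a neuron becomes one more weight. *)
Definition feature (x : V) (j : 'I_d.+1) : R :=
  if unlift ord0 j is Some j' then to_cube x ord0 j' else 1.

Lemma feature_norm x j : `|feature x j| <= 1.
Proof. by rewrite /feature; case: unliftP => [j' _|_]; rewrite ?normr1// to_cube_norm. Qed.

Lemma measurable_feature j : measurable_fun [set: V] (feature ^~ j).
Proof.
rewrite /feature; case: unliftP => [j' _|_]; first exact: measurable_to_cube_coord.
exact: measurable_cst.
Qed.

Lemma ridge_feature (w : 'rV[R]_d) (b : R) (x : V) :
  ridge (fun j => if unlift ord0 j is Some j' then w ord0 j' else b) (feature x) =
  sigmoid (dot w (to_cube x) + b).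
Proof.
rewrite /ridge; congr sigmoid; rewrite big_ord_recl unlift_none.
have -> : feature x ord0 = 1 by rewrite /feature unlift_none.
rewrite mulr1 [RHS]addrC; congr (_ + _); rewrite /dot.
by apply: eq_bigr => j _; rewrite /feature liftK.
Qed.

Lemma nn_class_network k a1 a2 a3 (g : 'rV[R]_d -> R) : nn_class k a1 a2 a3 g ->
  exists (th : 'I_k -> 'I_d.+1 -> R) (beta : 'I_k -> R) (b0 : R),
   [/\ forall i j, `|th i j| <= a1, forall i, `|beta i| <= a2, `|b0| <= a3 &
     forall x, g (to_cube x) = network feature th beta b0 x].
Proof.
move=> [w [b [beta [b0 [hw hb hbeta hb0 gE]]]]].
exists (fun i j => if unlift ord0 j is Some j' then w i ord0 j' else b i), beta, b0.
split => //.
  by move=> i j; case: unliftP => [j' _|_].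
move=> x; rewrite gE /network; congr (_ + _).
by apply: eq_bigr => i _; rewrite ridge_feature.
Qed.

Lemma bmf_nn_class k a1 a2 a3 (g : 'rV[R]_d -> R) : nn_class k a1 a2 a3 g ->
  bmf (fun x : V => g (to_cube x)).
Proof.
move=> /nn_class_network[th [beta [b0 [_ _ _ gE]]]].
rewrite (_ : (fun _ => _) = network feature th beta b0); last exact/funext.
apply: bmf_network; [exact: feature_norm|exact: measurable_feature].
Qed.

Context dO (Omega : measurableType dO) (Pr : probability Omega R).

Lemma sum_sample (X : nat -> {RV Pr >-> V}) (phi : V -> R) n w :
  \sum_(y <- sample X n w) phi y = \sum_(i < n) phi (X i w).
Proof.
elim: n => [|n IH]; first by rewrite big_nil big_ord0.
by rewrite big_ord_recr /= big_cons IH addrC.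
Qed.

Lemma class_deviations (P : probability V R) (X : nat -> {RV Pr >-> V}) (k : nat) (a1 a2 a3 : R)
    (phi : R -> R) (L : R) (n : nat) (delta : R) :
  iid_from P X -> 0 <= a1 -> 0 <= a2 -> 0 <= a3 ->
  0 <= L -> lipschitz_cst phi L -> measurable_fun [set: R] phi -> (0 < n)%N -> 0 < delta ->
  exists W : Omega -> R,
  [/\ bmf W, forall w, 0 <= W w,
    forall w g, (forall i, cube (X i w)) -> nn_class k a1 a2 a3 g ->
      `|\sum_(i < n) phi (g (X i w)) - n%:R * \int[P]_x phi (g (to_cube x))| <=
      W w + n%:R * delta,
    \int[Pr]_w W w <= 4 * L * (Num.sqrt n%:R * network_rate d.+1 a1 a2 a3 k) &
    forall eta, 0 <= eta -> 0 < L -> 0 < k%:R * a2 + a3 ->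
      (Pr [set w | (4 * L * (Num.sqrt n%:R * network_rate d.+1 a1 a2 a3 k) + eta <= W w)%R] <=
      (expR (- (eta ^+ 2 / (8 * ((4 * L * (k%:R * a2 + a3)) ^+ 2 * n%:R)))))%:E)%E].
Proof.
move=> hX a10 a20 a30 L0 phiL mphi n0 delta0.
have LwS : iterated_law P (sample_law X) by move=> m F; exact: (sample_lawS hX).
have [Z [bZ Z0 ZP EZ Zc]] := network_deviations LwS feature_norm measurable_feature
  k a10 a20 a30 L0 phiL mphi n0 delta0.
exists (fun w => Z (sample X n w)); split => //.
- exact: bmf_comp (@measurable_sample _ _ _ _ _ _ X n) bZ.
- move=> w g wC /nn_class_network[th [beta [b0 [h1 h2 h3 gE]]]].
  have := ZP th beta b0 (sample X n w) h1 h2 h3; rewrite sum_sample.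
  under [in X in X -> _]eq_bigr => i _ do rewrite -gE to_cube_id//.
  by under [in X in X -> _]eq_Rintegral do rewrite -gE.
- by rewrite -Rintegral_sample_law.
- move=> eta eta0 Lp kp.
  have c0 : 0 < 4 * L * (k%:R * a2 + a3) by rewrite !mulr_gt0.
  apply: le_trans (mcdiarmid_tail LwS n0 c0 eta0 bZ Zc).
  have -> : sample_law X n [set s | \int[sample_law X n]_s0 Z s0 + eta <= Z s] =
    Pr [set w | \int[sample_law X n]_s0 Z s0 + eta <= Z (sample X n w)] by [].
  have mW c : measurable [set w | c <= Z (sample X n w)].
    have [mW _] := bmf_comp (@measurable_sample _ _ _ _ _ _ X n) bZ.
    rewrite (_ : [set w | _] = (fun w => Z (sample X n w)) @^-1` `[c, +oo[%classic); last first.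
      by apply/seteqP; split => w /=; rewrite in_itv/= andbT.
    by rewrite -[X in measurable X]setTI; exact: mW.
  apply: le_measure; rewrite ?inE//.
  by move=> w /=; apply: le_trans; rewrite lerD2r.
Qed.

End class_deviations.

Section estimator_bracket.
Context (R : realType) (d : nat) (P Q : probability (borel_rV R d) R).
Local Notation V := (borel_rV R d).
Hypothesis PQ : P `<< Q.

Definition hell := fine (hellinger2 P Q).

Lemma bmf_half : bmf (fun _ : V => 2^-1 : R). Proof. exact: bmf_cst. Qed.

Lemma hellinger2_fin : hellinger2 P Q = hell%:E.
Proof.
have h (x : V) : (2^-1 : R) <= 1 - 2^-1 by lra.
have h0 : (0 : R) < 2^-1 by rewrite invr_gt0.
by rewrite /hell (hellinger2_objective PQ h0 bmf_half h).
Qed.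

Lemma hellE (g : V -> R) t : 0 < t -> bmf g -> (forall x, t <= 1 - g x) ->
  hell = objective P Q g + bias P Q g.
Proof. by move=> t0 bg gt; rewrite /hell (hellinger2_objective PQ t0 bg gt). Qed.

Variables (k : nat) (a1 a2 a3 t : R).
Hypothesis t0 : 0 < t.
Variables (n : nat) (xs ys : 'I_n -> 'rV[R]_d) (E1 E2 : R).
Hypothesis n0 : (0 < n)%N.
Hypothesis dev1 : forall g, nn_class k a1 a2 a3 g ->
  `|\sum_(i < n) trunc t (g (xs i)) - n%:R * \int[P]_x trunc t (g (to_cube x))| <= n%:R * E1.
Hypothesis dev2 : forall g, nn_class k a1 a2 a3 g ->
  `|\sum_(i < n) trunc_odds t (g (ys i)) - n%:R * \int[Q]_x trunc_odds t (g (to_cube x))| <=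
  n%:R * E2.

Let net_of (g : 'rV[R]_d -> R) (x : V) := trunc t (g (to_cube x)).

Lemma bmf_net_of g : nn_class k a1 a2 a3 g -> bmf (net_of g).
Proof.
move=> hg; apply: bmf_lipschitz (bmf_nn_class hg).
- exact: ler01.
- exact: trunc_lipschitz.
- exact: measurable_trunc.
Qed.

Lemma empirical_close g : nn_class k a1 a2 a3 g ->
  `|n%:R^-1 * \sum_(i < n) (trunc t (g (xs i)) - trunc t (g (ys i)) / (1 - trunc t (g (ys i)))) -
    (hell - bias P Q (net_of g))| <= E1 + E2.
Proof.
move=> hg; have n0' : 0 < n%:R :> R by rewrite ltr0n.
rewrite (hellE t0 (bmf_net_of hg) (fun x => trunc_le t _)) addrK /objective.
have := dev1 hg; have := dev2 hg; rewrite sumrB.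
have -> : \sum_(i < n) trunc t (g (ys i)) / (1 - trunc t (g (ys i))) =
  \sum_(i < n) trunc_odds t (g (ys i)) by [].
have -> : \int[Q]_x trunc_odds t (g (to_cube x)) =
  \int[Q]_x (net_of g x / (1 - net_of g x)) by [].
have -> : \int[P]_x trunc t (g (to_cube x)) = \int[P]_x net_of g x by [].
move: (\sum_(i < n) _) (\sum_(i < n) _) (\int[P]_x _) (\int[Q]_x _) => A B C D h1 h2.
rewrite -(ler_pM2l n0') -[X in X * `|_|](gtr0_norm n0') -normrM.
have -> : n%:R * (n%:R^-1 * (A - B) - (C - D)) = (A - n%:R * C) - (B - n%:R * D).
  by field; rewrite gt_eqF.
by apply: le_trans (ler_normB _ _) _; rewrite mulrDr lerD.
Qed.

Lemma hat_le : (hellinger2_hat (nn_class_trunc k a1 a2 a3 t) xs ys <= (hell + (E1 + E2))%:E)%E.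
Proof.
apply: ge_ereal_sup => _ [g [g' hg' gE] <-].
have := empirical_close hg'; rewrite ler_norml => /andP[_ h].
have : 0 <= bias P Q (net_of g') by apply: bias_ge0 t0 _ => x; exact: trunc_le.
rewrite lee_fin; under eq_bigr do rewrite !gE.
by move: h; rewrite /trunc; lra.
Qed.

(** A single well-approximating network bounds the supremum from below. The upper bound [hat_le]
    involves no approximation, because the bias is nonnegative for every network. *)
Lemma hat_ge g : nn_class k a1 a2 a3 g ->
  ((hell - bias P Q (net_of g) - (E1 + E2))%:E <=
   hellinger2_hat (nn_class_trunc k a1 a2 a3 t) xs ys)%E.
Proof.
move=> hg; apply: le_trans (ereal_sup_ubound _); last first.
  by exists (fun x => trunc t (g x)); [exists g|reflexivity].
have := empirical_close hg; rewrite ler_norml => /andP[h _].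
by rewrite lee_fin; lra.
Qed.

End estimator_bracket.

Section iid_in_cube.
Context (R : realType) (d : nat) (P : probability (borel_rV R d) R).
Context dO (Omega : measurableType dO) (Pr : probability Omega R).
Variable X : nat -> {RV Pr >-> borel_rV R d}.

Lemma ae_iid_cube : on_cube P -> iid_from P X ->
  {ae Pr, forall w, forall i, @cube R d (X i w)}.
Proof.
move=> PC [_ hX]; apply: ae_foralln => i.
have mC := @measurable_cube R d.
exists (X i @^-1` (~` @cube R d)); split => //.
  by rewrite -[X in measurable X]setTI; apply: measurable_funP => //; exact: measurableC.
rewrite [LHS](_ : _ = P (~` @cube R d)); last exact: (hX i _ (measurableC mC)).
by rewrite (probability_setC _ mC) PC subee.
Qed.

End iid_in_cube.

(** F is arbitrary, so the inequality is made to hold everywhere by adding +oo to G on a measurable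
    null set; this leaves the integral of G unchanged. *)
Lemma le_integral_ae d (T : measurableType d) (R : realType) (mu : probability T R)
    (F : T -> \bar R) (G : T -> R) : (forall x, (0 <= F x)%E) -> bmf G -> (forall x, 0 <= G x) ->
  {ae mu, forall x, (F x <= (G x)%:E)%E} -> (\int[mu]_x F x <= (\int[mu]_x G x)%:E)%E.
Proof.
move=> F0 bG G0 [N [mN N0 FG]].
pose H x := ((G x)%:E + ((cst +oo%E) \_ N) x)%E.
have mG : measurable_fun [set: T] G by case: bG.
apply: (@le_trans _ _ (\int[mu]_x H x)%E).
  apply: ge0_le_integralT => // x; rewrite /H patchE; case: ifPn => [_|].
    by rewrite addey// leey.
  rewrite notin_setE adde0 => xN; apply: contrapT => h; apply: xN; exact: FG.
have mH : measurable_fun [set: T] H.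
  apply: emeasurable_funD; first exact/measurable_EFinP.
  by apply/(measurable_restrictT _ mN); exact: measurable_cst.
rewrite -ERintegral// le_eqVlt; apply/orP; left; apply/eqP.
apply: ae_eq_integral => //; first exact/measurable_EFinP.
exists N; split => // x /= h; apply: contrapT => xN; apply: h => _.
by rewrite /H patchE ifF ?adde0//; apply/negbTE; rewrite notin_setE.
Qed.

Lemma abse_bracket (R : realType) (x : \bar R) (h e b : R) : 0 <= b ->
  ((h - b - e)%:E <= x)%E -> (x <= (h + e)%:E)%E -> (`|x - h%:E| <= (e + b)%:E)%E.
Proof.
case: x => [x| |] b0; last 2 first.
- by move=> _; rewrite leye_eq.
- by rewrite leeNy_eq.
rewrite !lee_fin => h1 h2.
by rewrite /= ler_norml; apply/andP; split; lra.
Qed.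

(** * The rate of part (ii) *)

Section rate_numerics.
Context (R : realType).

Lemma ln_natr_gt0 k : (2 <= k)%N -> 0 < (ln 2 : R) <= ln k%:R.
Proof.
move=> k2; have h2 : (1 : R) < 2 by lra.
rewrite ln_gt0//= ler_ln ?posrE ?ltr0n ?(leq_trans _ k2)// ler_nat//.
Qed.

Lemma ln_le_sqrt k : (0 < k)%N -> ln k%:R <= 2 * Num.sqrt k%:R :> R.
Proof.
move=> k0; have k0' : (0 : R) < k%:R by rewrite ltr0n.
have s0 : 0 < Num.sqrt k%:R :> R by rewrite sqrtr_gt0.
rewrite -{1}(sqr_sqrtr (ltW k0')) lnXn// mulr2n.
by have := ln_le_id s0; lra.
Qed.

Lemma sqrt_ge1 k : (1 <= k)%N -> 1 <= Num.sqrt k%:R :> R.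
Proof. by move=> k1; rewrite -[leLHS]sqrtr1 ler_wsqrtr// ler1n. Qed.

(** The total outer weight is ln k, and ln k <= 2 sqrt k gives 2 sqrt k ln k + 1 <= 9 k, hence the
    factor 3 sqrt k for the inner weights. *)
Lemma network_rate_le D k : (2 <= k)%N ->
  network_rate D (Num.sqrt k%:R * ln k%:R) (2 * k%:R^-1 * (2^-1 * ln k%:R))
    (2^-1 * ln k%:R) k <= (3 * chain_cst R D + 2) * (Num.sqrt k%:R * ln k%:R).
Proof.
move=> k2; have k0 : (0 < k)%N by exact: leq_trans k2.
have k0' : (0 : R) < k%:R by rewrite ltr0n.
have /andP[l2 lk] := ln_natr_gt0 k2.
have lk0 : 0 < ln k%:R :> R by exact: lt_le_trans lk.
have sk := sqrt_ge1 k0.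
have ls := ln_le_sqrt k0.
have ks : k%:R = Num.sqrt k%:R ^+ 2 :> R by rewrite sqr_sqrtr// ltW.
rewrite /network_rate.
have -> : k%:R * (2 * k%:R^-1 * (2^-1 * ln k%:R)) = ln k%:R :> R.
  by field; rewrite gt_eqF.
have h : Num.sqrt (2 * (Num.sqrt k%:R * ln k%:R) + 1) <= 3 * Num.sqrt k%:R :> R.
  rewrite -[leRHS]ger0_norm ?mulr_ge0 ?sqrtr_ge0// -sqrtr_sqr ler_wsqrtr//.
  move: ls sk; move: (Num.sqrt k%:R) (ln k%:R) => s l ls sk.
  nra.
have c0 : 0 <= chain_cst R D by rewrite mulr_ge0// sqr_ge0.
have h1 : chain_cst R D * Num.sqrt (2 * (Num.sqrt k%:R * ln k%:R) + 1) <=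
   chain_cst R D * (3 * Num.sqrt k%:R) by rewrite ler_wpM2l.
have h2 := ler_wpM2l (ltW lk0) h1.
have h3 : ln k%:R <= Num.sqrt k%:R * ln k%:R :> R by rewrite ler_peMl// ltW.
lra.
Qed.

End rate_numerics.

Section rate_part.
Context (R : realType) (d : nat) (P Q : probability (borel_rV R d) R).
Hypothesis PQ : P `<< Q.
Hypotheses (PC : on_cube P) (QC : on_cube Q).
Local Notation V := (borel_rV R d).

Lemma hellinger_class_inv (M : R) (f : 'rV[R]_d -> R) x : hellinger_class M f -> cube x ->
  0 < M /\ M^-1 <= `|1 - f x|.
Proof.
rewrite /hellinger_class /= => hM cx.
have : (`|(1 - f x)%:E^-1| <= M%:E)%E.
  apply: le_trans hM; rewrite !le_max; apply/orP; right; apply/orP; left.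
  by apply: ereal_sup_ubound; exists x.
rewrite inver; case: eqVneq => [_|h0].
  by rewrite /= leye_eq.
rewrite /= lee_fin normfV => h.
have p : 0 < `|1 - f x| by rewrite normr_gt0.
have M0 : 0 < M by apply: lt_le_trans h; rewrite invr_gt0.
by split => //; rewrite -[leRHS]invrK lef_pV2 ?posrE ?invr_gt0.
Qed.

Lemma bias_rate (M : R) (f : 'rV[R]_d -> R) :
  f_hellinger_version P Q f -> hellinger_class M f ->
  exists2 C1 : R, 0 <= C1 & forall k, (2 <= k)%N ->
  exists2 g : 'rV[R]_d -> R, nn_class k (Num.sqrt k%:R * ln k%:R)
      (2 * k%:R^-1 * (2^-1 * ln k%:R)) (2^-1 * ln k%:R) g &
    bias P Q (fun x => trunc (ln k%:R)^-1 (g (to_cube x))) <=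
    C1 * ((Num.sqrt k%:R)^-1 * ln k%:R).
Proof.
move=> fv fM; have [f0 [Bc [G [c0 [bf0 ff0 apx]]]]] := barron_approx Q fM.
have cube0 : @cube R d 0 by move=> j; rewrite mxE lexx ler01.
have [M0 _] := hellinger_class_inv fM cube0.
(* Once ln k exceeds this, the network of [barron_approx] obeys all weight bounds of the class, and
   t = 1 / ln k is at most 1 / M, so that f <= 1 - t. *)
pose La := Num.max 1 (Num.max (2 * G) M).
pose l2 : R := ln 2.
have l20 : 0 < l2 by have /andP[] := @ln_natr_gt0 R 2 isT.
pose C1B := (`|hell P Q| + l2^-1 ^+ 2) * expR (La / 2) / l2.
have C1B0 : 0 <= C1B.
  by rewrite divr_ge0 ?(ltW l20)// mulr_ge0 ?expR_ge0// addr_ge0 ?sqr_ge0.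
exists (M ^+ 2 * `|Bc| + C1B); first by rewrite addr_ge0// mulr_ge0 ?sqr_ge0.
move=> k k2; have k0 : (0 < k)%N by exact: leq_trans k2.
have k0' : (0 : R) < k%:R by rewrite ltr0n.
have /andP[_ lk] := ln_natr_gt0 R k2.
have lk0 : 0 < ln k%:R :> R by exact: lt_le_trans lk.
have sk := sqrt_ge1 R k0.
have sk0 : 0 < Num.sqrt k%:R :> R by exact: lt_le_trans sk.
have t0 : 0 < (ln k%:R)^-1 :> R by rewrite invr_gt0.
set t := (ln k%:R)^-1 in t0 *.
have X0 : 0 <= (Num.sqrt k%:R)^-1 * ln k%:R :> R.
  by rewrite mulr_ge0 ?invr_ge0 ?(ltW lk0) ?(ltW sk0).
have [hL|hL] := leP La (ln k%:R).
  have L1 : 1 <= ln k%:R :> R by apply: le_trans hL; rewrite le_max lexx.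
  have L2 : 2 * G <= ln k%:R by apply: le_trans hL; rewrite !le_max lexx orbT.
  have L3 : M <= ln k%:R by apply: le_trans hL; rewrite !le_max lexx !orbT.
  have tau1 : Num.sqrt k%:R <= Num.sqrt k%:R * ln k%:R :> R by rewrite ler_peMr// ltW.
  have [w [b [beta [h1 h2 h3 h4 h5]]]] := apx k _ k0 tau1.
  pose g (x : 'rV[R]_d) := \sum_(i < k) beta i * sigmoid (dot (w i) x + b i) + c0.
  have hg : nn_class k (Num.sqrt k%:R * ln k%:R) (2 * k%:R^-1 * (2^-1 * ln k%:R))
     (2^-1 * ln k%:R) g.
    exists w, b, beta, c0; split => //; last by apply: le_trans h4 _; lra.
    move=> i; apply: le_trans (h3 i) _.
    rewrite (_ : 2 * k%:R^-1 * (2^-1 * ln k%:R) = ln k%:R / k%:R); last by field; rewrite gt_eqF.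
    by rewrite ler_pM2r ?invr_gt0//; apply: le_trans L2; have := le_trans (normr_ge0 _) h4; lra.
  exists g => //.
  have bg0 : bmf (fun x : V => g (to_cube x)) := bmf_nn_class hg.
  have bg : bmf (fun x : V => trunc t (g (to_cube x))).
    exact: bmf_net_of hg.
  apply: (@le_trans _ _ (M ^+ 2 / t * \int[Q]_x ((f0 x - g (to_cube x)) ^+ 2))).
    apply: (bias_le_bounded PQ fv t0 bg (fun x => trunc_le t _) M0 bf0 bg0).
    apply: (ae_mono (ae_and (ae_version_rho PQ fv) (ae_cube QC))) => x [[f1 _] cx].
    have [_ hM] := hellinger_class_inv fM cx.
    split=> //; first exact: ff0.
    rewrite gtr0_norm// in hM.
    have ht : t <= M^-1 by rewrite /t lef_pV2.
    by have := le_trans ht hM; rewrite !lerBrDr addrC.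
  have -> : M ^+ 2 / t = M ^+ 2 * ln k%:R by rewrite /t invrK.
  have I0 : 0 <= \int[Q]_x ((f0 x - g (to_cube x)) ^+ 2).
    by apply: Rintegral_ge0 => x _; rewrite sqr_ge0.
  apply: (@le_trans _ _ (M ^+ 2 * `|Bc| * ((Num.sqrt k%:R)^-1 * ln k%:R))); last first.
    by rewrite ler_wpM2r// lerDl.
  rewrite (_ : _ * (_ * ln k%:R) = M ^+ 2 * ln k%:R * (`|Bc| / Num.sqrt k%:R)); last by ring.
  apply: ler_wpM2l; first by rewrite mulr_ge0 ?sqr_ge0// ltW.
  apply: le_trans h5 _.
  apply: (@le_trans _ _ (`|Bc| / k%:R)).
    by rewrite ler_pM2r ?invr_gt0// ler_norm.
  rewrite ler_wpM2l// lef_pV2 ?posrE// -[leRHS](sqr_sqrtr (ltW k0')) expr2.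
  by rewrite ler_peMr// ltW.
(* For the remaining k, which are bounded, the zero network will do: its bias is bounded, k^(-1/2)
   ln k is bounded below, and [C1B] is the quotient of the two bounds. *)
pose g (x : 'rV[R]_d) : R := 0.
have hg : nn_class k (Num.sqrt k%:R * ln k%:R) (2 * k%:R^-1 * (2^-1 * ln k%:R)) (2^-1 * ln k%:R) g.
  have a1 : 0 <= Num.sqrt k%:R * ln k%:R :> R by rewrite mulr_ge0 ?ltW.
  have a3 : 0 <= 2^-1 * ln k%:R :> R by rewrite mulr_ge0 ?ltW.
  have a2 : 0 <= 2 * k%:R^-1 * (2^-1 * ln k%:R) :> R by rewrite mulr_ge0// mulr_ge0// invr_ge0.
  exists (fun=> 0), (fun=> 0), (fun=> 0), 0; split; rewrite ?normr0//.
  - by move=> i j; rewrite mxE normr0.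
  - by move=> x; rewrite big1 ?addr0// => i _; rewrite mul0r.
exists g => //.
(* Not always 0: for k = 2 the level t = 1 / ln 2 exceeds 1 and the truncated zero network is
   negative. *)
set c := trunc t 0.
have bc : bmf (fun _ : V => c) := bmf_cst _ c.
have := hellE PQ t0 bc (fun x => trunc_le t _).
rewrite /objective !Rintegral_cstP => hE.
have c1 : c <= 0 by rewrite /c /trunc ge_min lexx orbT.
have c2 : - t <= c by rewrite /c /trunc le_min; apply/andP; split; lra.
have cc : - (c - c / (1 - c)) <= t ^+ 2.
  have p : 0 < 1 - c by lra.
  have -> : - (c - c / (1 - c)) = c ^+ 2 / (1 - c) by field; rewrite gt_eqF.
  rewrite ler_pdivrMr//; nra.
have tl : t <= l2^-1 by rewrite /t lef_pV2.
have t2 : t ^+ 2 <= l2^-1 ^+ 2 by rewrite ler_pXn2r ?nnegrE ?invr_ge0 ?(ltW l20) ?(ltW lk0).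
have ek : Num.sqrt k%:R <= expR (La / 2) :> R.
  rewrite -(lnK (x := Num.sqrt k%:R)) ?posrE// ler_expR.
  have : ln k%:R = 2 * ln (Num.sqrt k%:R) :> R.
    by rewrite -{1}(sqr_sqrtr (ltW k0')) lnXn// mulr_natl.
  by lra.
have Xl : l2 / expR (La / 2) <= (Num.sqrt k%:R)^-1 * ln k%:R.
  rewrite mulrC; apply: ler_pM => //; rewrite ?invr_ge0 ?expR_ge0 ?(ltW l20)//.
  by rewrite lef_pV2 ?posrE ?expR_gt0.
have b0 : 0 <= `|hell P Q| + l2^-1 ^+ 2 by rewrite addr_ge0 ?sqr_ge0.
apply: (@le_trans _ _ (`|hell P Q| + l2^-1 ^+ 2)).
  rewrite -[X in X <= _]/(bias P Q (fun=> c)).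
  by have := ler_norm (hell P Q); lra.
apply: (@le_trans _ _ (C1B * ((Num.sqrt k%:R)^-1 * ln k%:R))); last first.
  by rewrite ler_wpM2r// lerDr mulr_ge0 ?sqr_ge0.
apply: le_trans (ler_wpM2l C1B0 Xl).
rewrite /C1B le_eqVlt; apply/orP; left; apply/eqP; field.
by rewrite !gt_eqF ?expR_gt0.
Qed.

End rate_part.

Section rate_bound.
Context (R : realType) (d : nat) (P Q : probability (borel_rV R d) R).
Hypothesis PQ : hellinger_pair P Q.
Context (dO : measure_display) (Omega : measurableType dO) (Pr : probability Omega R).
Variables X Y : nat -> {RV Pr >-> borel_rV R d}.
Hypotheses (hX : iid_from P X) (hY : iid_from Q Y).

(** L = 1 + t^-2 is a common Lipschitz constant for the two functions averaged, v truncated and its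
    odds; [W] adds the deviations of both samples, each rounded to within delta / 2. *)
Lemma sample_deviations k (a1 a2 a3 t : R) n delta : 0 <= a1 -> 0 <= a2 -> 0 <= a3 ->
  0 < t -> (0 < n)%N -> 0 < delta ->
  let L := 1 + t ^- 2 in
  let rate := 4 * L * (Num.sqrt n%:R * network_rate d.+1 a1 a2 a3 k) in
  exists W : Omega -> R, [/\ bmf W, forall w, 0 <= W w,
    forall w, (forall i, cube (X i w)) -> (forall i, cube (Y i w)) ->
      (hellinger2_hat (nn_class_trunc k a1 a2 a3 t) (fun i : 'I_n => X i w)
        (fun i : 'I_n => Y i w) <= (hell P Q + (n%:R^-1 * W w + delta))%:E)%E /\
      forall g, nn_class k a1 a2 a3 g ->
       ((hell P Q - bias P Q (fun x => trunc t (g (to_cube x))) - (n%:R^-1 * W w + delta))%:E <=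
        hellinger2_hat (nn_class_trunc k a1 a2 a3 t) (fun i : 'I_n => X i w)
        (fun i : 'I_n => Y i w))%E,
    \int[Pr]_w W w <= 2 * rate &
    forall eta, 0 <= eta -> 0 < k%:R * a2 + a3 ->
      (Pr [set w | (2 * (rate + eta) <= W w)%R] <=
      (2 * expR (- (eta ^+ 2 / (8 * ((4 * L * (k%:R * a2 + a3)) ^+ 2 * n%:R)))))%:E)%E].
Proof.
move=> a10 a20 a30 t0 n0 delta0 L rate.
have [PC QC dom] := PQ.
have t2 : 0 <= t ^- 2 by rewrite invr_ge0 exprn_ge0// ltW.
have L0 : 0 < L by rewrite /L; lra.
have lip1 : lipschitz_cst (trunc t) L.
  by apply: lipschitz_cstW (trunc_lipschitz t); rewrite /L; lra.
have lip2 : lipschitz_cst (trunc_odds t) L.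
  by apply: lipschitz_cstW (trunc_odds_lipschitz t0); rewrite /L; lra.
have n0' : (0 : R) < n%:R by rewrite ltr0n.
have d2 : 0 < delta / 2 by rewrite divr_gt0.
have [W1 [bW1 W10 W1P EW1 TW1]] := class_deviations k hX a10 a20 a30 (ltW L0) lip1
  (measurable_trunc t) n0 d2.
have [W2 [bW2 W20 W2P EW2 TW2]] := class_deviations k hY a10 a20 a30 (ltW L0) lip2
  (measurable_trunc_odds t0) n0 d2.
exists (fun w => W1 w + W2 w); split.
- exact: bmfD.
- by move=> w; rewrite addr_ge0.
- move=> w Xw Yw.
  have dev1 g : nn_class k a1 a2 a3 g ->
     `|\sum_(i < n) trunc t (g (X i w)) - n%:R * \int[P]_x trunc t (g (to_cube x))| <=
     n%:R * (n%:R^-1 * W1 w + delta / 2).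
    by move=> hg; rewrite mulrDr mulrA mulfV ?gt_eqF// mul1r; exact: W1P.
  have dev2 g : nn_class k a1 a2 a3 g ->
     `|\sum_(i < n) trunc_odds t (g (Y i w)) - n%:R * \int[Q]_x trunc_odds t (g (to_cube x))| <=
     n%:R * (n%:R^-1 * W2 w + delta / 2).
    by move=> hg; rewrite mulrDr mulrA mulfV ?gt_eqF// mul1r; exact: W2P.
  have -> : n%:R^-1 * (W1 w + W2 w) + delta =
     (n%:R^-1 * W1 w + delta / 2) + (n%:R^-1 * W2 w + delta / 2) by field; rewrite gt_eqF.
  split; first exact: hat_le.
  by move=> g hg; exact: hat_ge.
- rewrite RintegralDT// (_ : 2 * rate = rate + rate); first exact: lerD.
  by ring.
- move=> eta eta0 kp; have {}TW1 := TW1 eta eta0 L0 kp; have {}TW2 := TW2 eta eta0 L0 kp.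
  have mW (W : Omega -> R) c : bmf W -> measurable [set w | c <= W w].
    move=> [mW _]; rewrite (_ : [set w | _] = W @^-1` `[c, +oo[%classic); last first.
      by apply/seteqP; split => w /=; rewrite in_itv/= andbT.
    by rewrite -[X in measurable X]setTI; exact: mW.
  set E := expR _ in TW1 TW2 *.
  have -> : (2 * E)%:E = (E%:E + E%:E)%E by rewrite -EFinD; congr (_ %:E); ring.
  apply: le_trans (leeD TW1 TW2).
  apply: le_trans (measureU2 Pr (mW _ _ bW1) (mW _ _ bW2)).
  apply: le_measure; rewrite ?inE.
  + by apply: mW; exact: bmfD.
  + by apply: measurableU; exact: mW.
  move=> w /= h; have [h1|h1] := leP (rate + eta) (W1 w); first by left.
  right; have : 2 * (rate + eta) <= W1 w + W2 w by [].
  by rewrite -/rate; lra.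
Qed.

Lemma rate_bound (M : R) (f : 'rV[R]_d -> R) :
  f_hellinger_version P Q f -> hellinger_class M f ->
  exists C1 C2 : R, forall k n : nat, (2 <= k)%N -> (1 <= n)%N ->
    (\int[Pr]_omega `| hellinger2_hat (nn_class2 k (2^-1 * ln k%:R) (ln k%:R)^-1)
           (fun i : 'I_n => X i omega) (fun i : 'I_n => Y i omega)
         - hellinger2 P Q |
      <= (C1 * (k%:R `^ (- 2^-1) * ln k%:R) +
          C2 * (Num.sqrt k%:R * ln k%:R ^+ 3 * n%:R `^ (- 2^-1)))%:E)%E.
Proof.
move=> fv fM; have [PC QC dom] := PQ.
have [C1 C10 hC1] := bias_rate dom QC fv fM.
pose l2 : R := ln 2.
have l20 : 0 < l2 by have /andP[] := @ln_natr_gt0 R 2 isT.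
pose cr := 3 * chain_cst R d.+1 + 2.
exists C1, (8 * (1 + l2^-1 ^+ 2) * cr + l2^-1 ^+ 3) => k n k2 n1.
have k0 : (0 < k)%N by exact: leq_trans k2.
have k0' : (0 : R) < k%:R by rewrite ltr0n.
have n0' : (0 : R) < n%:R by rewrite ltr0n.
have /andP[_ lk] := ln_natr_gt0 R k2.
have lk0 : 0 < ln k%:R :> R by exact: lt_le_trans lk.
have sk := sqrt_ge1 R k0.
have sn := sqrt_ge1 R n1.
have sn0 : 0 < Num.sqrt n%:R :> R by exact: lt_le_trans sn.
have t0 : 0 < (ln k%:R)^-1 :> R by rewrite invr_gt0.
have a1 : 0 <= Num.sqrt k%:R * ln k%:R :> R by rewrite mulr_ge0 ?(ltW lk0)// (le_trans _ sk).
have a3 : 0 <= 2^-1 * ln k%:R :> R by rewrite mulr_ge0 ?(ltW lk0).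
have a2 : 0 <= 2 * k%:R^-1 * (2^-1 * ln k%:R) :> R by rewrite mulr_ge0// mulr_ge0// invr_ge0.
(* Rounding at the order of the statistical error; as ln k >= ln 2, it is absorbed by the summand
   (ln 2)^-3 of the second constant. *)
have delta0 : 0 < (Num.sqrt n%:R)^-1 :> R by rewrite invr_gt0.
pose L := 1 + (ln k%:R)^-1 ^- 2 : R.
pose nr := network_rate d.+1 (Num.sqrt k%:R * ln k%:R)
  (2 * k%:R^-1 * (2^-1 * ln k%:R)) (2^-1 * ln k%:R : R) k.
pose rate := 4 * L * (Num.sqrt n%:R * nr).
have [W [bW W0 WP]] := sample_deviations k a1 a2 a3 t0 n1 delta0.
rewrite -/nr -/L -/rate => EW _.
have [g hg hbias] := hC1 k k2.
have b0 : 0 <= bias P Q (fun x => trunc (ln k%:R)^-1 (g (to_cube x))).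
  by apply: bias_ge0 t0 _ => x; exact: trunc_le.
set b := bias P Q _ in hbias b0.
have L0 : 0 <= L by rewrite addr_ge0// invr_ge0 exprn_ge0// ltW.
pose G (w : Omega) := (n%:R^-1 * W w + (Num.sqrt n%:R)^-1) + b.
have bG : bmf G by apply: bmfD; [apply: bmfD; [exact: bmfZ|exact: bmf_cst]|exact: bmf_cst].
have G0 w : 0 <= G w.
  by rewrite addr_ge0// addr_ge0 ?(ltW delta0)// mulr_ge0 ?invr_ge0.
have main : (\int[Pr]_omega `| hellinger2_hat (nn_class2 k (2^-1 * ln k%:R) (ln k%:R)^-1)
           (fun i : 'I_n => X i omega) (fun i : 'I_n => Y i omega)
         - hellinger2 P Q | <= (\int[Pr]_w G w)%:E)%E.
  apply: le_integral_ae => //.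
  apply: (ae_mono (ae_and (ae_iid_cube PC hX) (ae_iid_cube QC hY))) => w [Xw Yw].
  have [h1 h2] := WP w Xw Yw.
  rewrite (hellinger2_fin dom); apply: abse_bracket => //.
  exact: h2.
apply: le_trans main _; rewrite lee_fin /G.
rewrite RintegralDT; [|by apply: bmfD; [exact: bmfZ|exact: bmf_cst]|exact: bmf_cst].
rewrite RintegralDT; [|exact: bmfZ|exact: bmf_cst].
rewrite RintegralZT// !Rintegral_cstP addrC !powRN !powR12_sqrt ?ler0n//.
apply: lerD; first exact: hbias.
have c0 : 0 <= cr by rewrite addr_ge0// mulr_ge0// mulr_ge0// sqr_ge0.
have lV : 1 <= l2^-1 * ln k%:R by rewrite mulrC ler_pdivlMr// mul1r.
have lV2 : 1 <= (l2^-1 * ln k%:R) ^+ 2 by rewrite exprn_ege1.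
have lV3 : 1 <= (l2^-1 * ln k%:R) ^+ 3 by rewrite exprn_ege1.
have Lle : L <= (1 + l2^-1 ^+ 2) * ln k%:R ^+ 2.
  rewrite /L exprVn invrK mulrDl mul1r addrC lerD2l.
  by rewrite -exprMn.
have rle : nr <= cr * (Num.sqrt k%:R * ln k%:R) by exact: network_rate_le.
have r1 : n%:R^-1 * \int[Pr]_w W w <= 8 * (1 + l2^-1 ^+ 2) * cr *
   (Num.sqrt k%:R * ln k%:R ^+ 3 * (Num.sqrt n%:R)^-1).
  apply: (@le_trans _ _ (n%:R^-1 * (2 * rate))).
    by rewrite ler_wpM2l// invr_ge0 ltW.
  rewrite /rate; have e : n%:R^-1 * (2 * (4 * L * (Num.sqrt n%:R * nr))) =
       8 * (L * nr) * (Num.sqrt n%:R)^-1.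
    rewrite -[in LHS](sqr_sqrtr (ltW n0')); set s := Num.sqrt _ in sn0 *.
    rewrite sqrtr_sqr gtr0_norm//; by field; rewrite gt_eqF.
  rewrite e [leRHS]mulrA ler_wpM2r ?invr_ge0 ?(ltW sn0)//.
  rewrite -!mulrA ler_wpM2l//.
  apply: (@le_trans _ _ (((1 + l2^-1 ^+ 2) * ln k%:R ^+ 2) * (cr * (Num.sqrt k%:R * ln k%:R)))).
    have h1 : L * nr <= L * (cr * (Num.sqrt k%:R * ln k%:R)) by rewrite ler_wpM2l.
    by apply: le_trans h1 _; rewrite ler_wpM2r// mulr_ge0.
  by rewrite le_eqVlt; apply/orP; left; apply/eqP; ring.
have r2 : (Num.sqrt n%:R)^-1 <= l2^-1 ^+ 3 *
   (Num.sqrt k%:R * ln k%:R ^+ 3 * (Num.sqrt n%:R)^-1).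
  rewrite mulrA -[leLHS]mul1r ler_wpM2r ?invr_ge0 ?(ltW sn0)//.
  rewrite mulrCA -exprMn -[leLHS]mul1r.
  by apply: ler_pM.
by rewrite mulrDl; exact: lerD.
Qed.

End rate_bound.

(** * Universal approximation with bounded weights *)

Section sigmoid_powers.
Context (R : realType).
Implicit Types h v : R.

Lemma expRN_taylor h : `|h| <= 2^-1 -> `|1 - expR (- h) - h| <= 2 * h ^+ 2.
Proof.
rewrite ler_norml => /andP[h1 h2].
have e1 := expR_ge1Dx (- h); have e2 := expR_ge1Dx h.
have p : 0 < 1 + h by lra.
have e3 : expR (- h) <= (1 + h)^-1 by rewrite expRN lef_pV2 ?posrE ?expR_gt0.
have e4 : (1 + h)^-1 <= 1 - h + 2 * h ^+ 2.
  rewrite -[X in X <= _]div1r ler_pdivrMr//; nra.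
by rewrite ler_norml; apply/andP; split; nra.
Qed.

Lemma sigmoidD v h :
  sigmoid (v + h) - sigmoid v = sigmoid (v + h) * (1 - sigmoid v) * (1 - expR (- h)).
Proof.
have p (c : R) : 0 < 1 + expR c by rewrite ltr_pwDl// expR_ge0.
have e : expR (- (v + h)) = expR (- v) * expR (- h) by rewrite opprD expRD.
have := p (- (v + h)); rewrite /sigmoid e => q; field.
by rewrite !gt_eqF.
Qed.

Lemma sigmoid_taylor v h : `|h| <= 2^-1 ->
  `|sigmoid (v + h) - sigmoid v - h * (sigmoid v - sigmoid v ^+ 2)| <= 4 * h ^+ 2.
Proof.
move=> h1; have e := expRN_taylor h1.
have s0 := sigmoid_gt0 v; have s1 := sigmoid_lt1 v.
have -> : sigmoid (v + h) - sigmoid v - h * (sigmoid v - sigmoid v ^+ 2) =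
  (1 - sigmoid v) * ((sigmoid (v + h) - sigmoid v) * (1 - expR (- h)) +
     sigmoid v * (1 - expR (- h) - h)).
  rewrite [sigmoid (v + h) - sigmoid v in LHS]sigmoidD; ring.
have l := sigmoid_lipschitz (v + h) v.
have {}l : `|sigmoid (v + h) - sigmoid v| <= `|h|.
  by apply: le_trans l _; rewrite (addrC v) addrK.
have e2 : `|1 - expR (- h)| <= 2 * `|h|.
  rewrite -[X in `|X|](subrK h); apply: le_trans (ler_normD _ _) _.
  have : h ^+ 2 = `|h| ^+ 2 by rewrite real_normK ?num_real.
  have := normr_ge0 h; move: h1 e; nra.
rewrite normrM [X in X * _]gtr0_norm ?subr_gt0//.
apply: (@le_trans _ _ (1 * (`|h| * (2 * `|h|) + 1 * (2 * h ^+ 2)))).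
  rewrite ler_pM ?subr_ge0 ?(ltW s1)//; first lra.
  apply: le_trans (ler_normD _ _) _; rewrite !normrM; apply: lerD; apply: ler_pM => //.
  by rewrite gtr0_norm// ltW.
have : h ^+ 2 = `|h| ^+ 2 by rewrite real_normK ?num_real.
nra.
Qed.

(** The product rule with a remainder, by induction on n. Uniformity in v is what turns difference
    quotients into uniform approximations on the cube. *)
Lemma sigmoid_exp_taylor n : exists C : R, 0 <= C /\ forall v h, `|h| <= 2^-1 ->
  `|sigmoid (v + h) ^+ n - sigmoid v ^+ n -
    h * n%:R * (sigmoid v ^+ n - sigmoid v ^+ n.+1)| <= C * h ^+ 2.
Proof.
elim: n => [|n [C [C0 hC]]].
  by exists 0; split => // v h _; rewrite !expr0 subrr mulr0 !mul0r subr0 normr0.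
exists (C + 4 + n%:R); split; first by rewrite !addr_ge0.
move=> v h h1; have {}hC := hC v h h1; have hT := sigmoid_taylor v h1.
have l : `|sigmoid (v + h) - sigmoid v| <= `|h|.
  by apply: le_trans (sigmoid_lipschitz _ _) _; rewrite (addrC v) addrK.
have s0 := sigmoid_gt0 v; have s1 := sigmoid_lt1 v.
set s := sigmoid v in s0 s1 hC hT l *; set s' := sigmoid (v + h) in hC hT l *.
have -> : s' ^+ n.+1 - s ^+ n.+1 - h * n.+1%:R * (s ^+ n.+1 - s ^+ n.+2) =
  s' * (s' ^+ n - s ^+ n - h * n%:R * (s ^+ n - s ^+ n.+1)) +
  s ^+ n * (s' - s - h * (s - s ^+ 2)) +
  (s' - s) * (h * n%:R * (s ^+ n * (1 - s))).
  by rewrite !exprS -[n.+1%:R]natr1; ring.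
apply: le_trans (ler_normD _ _) _; rewrite [leRHS]mulrDl; apply: lerD.
  apply: le_trans (ler_normD _ _) _; rewrite mulrDl; apply: lerD.
    rewrite normrM -[leRHS]mul1r ler_pM//; exact: sigmoid_norm.
  by rewrite normrM -[leRHS]mul1r ler_pM// normrX exprn_ile1//; exact: sigmoid_norm.
have -> : n%:R * h ^+ 2 = `|h| * (`|h| * n%:R * 1).
  by rewrite mulr1 mulrA -expr2 real_normK ?num_real// mulrC.
rewrite normrM ler_pM// !normrM (@ger0_norm _ n%:R)// ler_wpM2l ?mulr_ge0//.
rewrite -[leRHS]mul1r ler_pM ?normr_ge0//.
  by rewrite normrX exprn_ile1//; exact: sigmoid_norm.
rewrite ger0_norm ?subr_ge0 ?(ltW s1)//; lra.
Qed.

End sigmoid_powers.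

Section uniform_span.
Context (R : realType) (d : nat).
Implicit Types (h g : 'rV[R]_d -> R) (s : seq ('rV[R]_d * R * R)) (al : seq 'I_d).

Definition neuron_sum s (x : 'rV[R]_d) : R :=
  \sum_(p <- s) p.2 * sigmoid (dot p.1.1 x + p.1.2).

Definition small_weights (c : R) (p : 'rV[R]_d * R * R) :=
  (forall j, `|p.1.1 ord0 j| <= c) /\ `|p.1.2| <= c.

(** Outer weights are free here, as difference quotients carry the factor 1 / h; only the inner ones
    are kept within 1. *)
Definition in_span h := forall e : R, 0 < e -> exists s,
  (forall p, p \in s -> small_weights 1 p) /\
  forall x, cube x -> `|h x - neuron_sum s x| <= e.

Lemma in_span_ext h g : (forall x, cube x -> h x = g x) -> in_span h -> in_span g.
Proof.
move=> hg H e e0; have [s [s1 s2]] := H e e0; exists s; split => // x cx.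
by rewrite -hg// s2.
Qed.

Lemma in_spanD h g : in_span h -> in_span g -> in_span (fun x => h x + g x).
Proof.
move=> H G e e0; have e2 : 0 < e / 2 by rewrite divr_gt0.
have [s [s1 s2]] := H _ e2; have [r [r1 r2]] := G _ e2.
exists (s ++ r); split => [p|x cx].
  by rewrite mem_cat => /orP[/s1|/r1].
rewrite /neuron_sum big_cat/= opprD addrACA; apply: le_trans (ler_normD _ _) _.
by rewrite (splitr e) lerD ?s2 ?r2.
Qed.

Lemma in_spanZ c h : in_span h -> in_span (fun x => c * h x).
Proof.
move=> H e e0; have c0 : 0 < `|c| + 1 by rewrite ltr_wpDl.
have [s [s1 s2]] := H _ (divr_gt0 e0 c0).
exists [seq (p.1, c * p.2) | p <- s]; split => [_ /mapP[p ps ->]|x cx].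
  exact: (s1 p ps).
rewrite /neuron_sum big_map/=.
under eq_bigr do rewrite -mulrA.
rewrite -mulr_sumr -mulrBr normrM.
apply: (@le_trans _ _ ((`|c| + 1) * (e / (`|c| + 1)))); last first.
  by rewrite mulrCA divff ?gt_eqF// mulr1.
by rewrite ler_pM ?s2// lerDl.
Qed.

Lemma in_span_lim h : (forall e : R, 0 < e -> exists2 g, in_span g &
  forall x, cube x -> `|h x - g x| <= e) -> in_span h.
Proof.
move=> H e e0; have e2 : 0 < e / 2 by rewrite divr_gt0.
have [g G hg] := H _ e2; have [s [s1 s2]] := G _ e2.
exists s; split => // x cx; rewrite -(subrK (g x) (h x)) -addrA.
by apply: le_trans (ler_normD _ _) _; rewrite (splitr e) lerD ?s2 ?hg.
Qed.

Definition monomial al (x : 'rV[R]_d) : R := \prod_(j <- al) x ord0 j.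

Lemma monomial_norm al x : cube x -> `|monomial al x| <= 1.
Proof.
move=> cx; rewrite /monomial; elim: al => [|j al IH]; first by rewrite big_nil normr1.
rewrite big_cons normrM -[leRHS]mul1r ler_pM//.
by have /andP[x0 x1] := cx j; rewrite ger0_norm.
Qed.

Definition sigmoid_pow al n (w : 'rV[R]_d) (b : R) (x : 'rV[R]_d) : R :=
  monomial al x * sigmoid (dot w x + b) ^+ n.

(** Strict bounds leave room to perturb w or b in a difference quotient. *)
Definition interior_weights (w : 'rV[R]_d) (b : R) :=
  (forall j, `|w ord0 j| < 1) /\ `|b| < 1.

(* The derivative of [sigmoid ^ n] is [n (sigmoid ^ n - sigmoid ^ n.+1)]. *)
Lemma in_span_derivative al n (w u : 'rV[R]_d) (b c : R) (xi : 'rV[R]_d -> R) r :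
  0 < r ->
  (forall x, cube x -> `|xi x| <= 1) ->
  (forall x, dot u x + c = xi x) ->
  (forall h : R, 0 < h < r -> in_span (sigmoid_pow al n (w + h *: u) (b + h * c))) ->
  in_span (sigmoid_pow al n w b) ->
  in_span (fun x => xi x * (n%:R * (sigmoid_pow al n w b x - sigmoid_pow al n.+1 w b x))).
Proof.
move=> r0 xi1 xiE H H0; apply: in_span_lim => e e0.
have [C [C0 hC]] := sigmoid_exp_taylor R n.
have C1 : 0 < C + 1 by rewrite ltr_wpDl.
pose h := Num.min (r / 2) (Num.min 2^-1 (e / (C + 1))).
have h0 : 0 < h by rewrite !lt_min invr_gt0 ltr0n ?divr_gt0.
have hr : h < r.
  by rewrite gt_min ltr_pdivrMr// ltr_pMr// ltr1n.
have h2 : h <= 2^-1 by rewrite /h !ge_min lexx orbT.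
have he : (C + 1) * h <= e.
  by rewrite mulrC -ler_pdivlMr// !ge_min lexx !orbT.
exists (fun x => h^-1 *
  (sigmoid_pow al n (w + h *: u) (b + h * c) x + (-1) * sigmoid_pow al n w b x)).
  by apply: in_spanZ; apply: in_spanD; [apply: H; rewrite h0|exact: in_spanZ].
move=> x cx.
have E : dot (w + h *: u) x + (b + h * c) = (dot w x + b) + h * xi x.
  rewrite -xiE mulrDr addrACA; congr (_ + _); rewrite /dot mulr_sumr -big_split/=.
  by apply: eq_bigr => j _; rewrite !mxE mulrDl mulrA.
rewrite /sigmoid_pow E; set v := dot w x + b; set m := monomial al x.
have -> : forall a b' a' : R, xi x * (n%:R * (m * a - m * b')) - h^-1 * (m * a' + -1 * (m * a)) =
   - (m * h^-1 * (a' - a - h * xi x * n%:R * (a - b'))).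
  by move=> a b' a'; field; rewrite gt_eqF.
have hx : `|h * xi x| <= h.
  by rewrite normrM gtr0_norm// ler_piMr ?xi1// ltW.
have := hC v (h * xi x) (le_trans hx h2); set D := _ - _ - _ => hD.
rewrite normrN -mulrA normrM -[leRHS]mul1r ler_pM ?monomial_norm//.
rewrite normrM gtr0_norm ?invr_gt0// ler_pdivrMl//.
apply: le_trans hD _; apply: (@le_trans _ _ (C * h ^+ 2)).
  by rewrite ler_wpM2l// -real_normK ?num_real// ler_pXn2r ?nnegrE ?(ltW h0).
apply: (@le_trans _ _ (h * ((C + 1) * h))); last by rewrite ler_wpM2l// ltW.
have := sqr_ge0 h; nra.
Qed.

Lemma dot_delta j (x : 'rV[R]_d) : dot (delta_mx ord0 j) x = x ord0 j.
Proof.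
rewrite /dot (bigD1 j)//= mxE !eqxx mul1r big1 ?addr0// => i ij.
by rewrite mxE (negPf ij) andbF mul0r.
Qed.

Lemma dot0l (x : 'rV[R]_d) : dot 0 x = 0.
Proof. by rewrite /dot big1// => i _; rewrite mxE mul0r. Qed.

(** The derivative in b of the n-th power is a multiple of its difference with the next power, so
    powers are gained one at a time. *)
Lemma in_span_sigmoid_pow al :
  (forall w b, interior_weights w b -> in_span (sigmoid_pow al 1 w b)) ->
  forall n w b, interior_weights w b -> in_span (sigmoid_pow al n.+1 w b).
Proof.
move=> H; elim => [//|n IH] w b wb.
pose D x := 1 * (n.+1%:R * (sigmoid_pow al n.+1 w b x - sigmoid_pow al n.+2 w b x)) : R.
have HD : in_span D.
  case: (wb) => w1 b1.
  apply: (@in_span_derivative al n.+1 w 0 b 1 (fun=> 1) (1 - `|b|)).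
  - by rewrite subr_gt0.
  - by move=> x _; rewrite normr1.
  - by move=> x; rewrite dot0l add0r.
  - move=> h /andP[h0 h1]; apply: IH; split => [j|].
      by rewrite scaler0 addr0.
    rewrite mulr1; apply: le_lt_trans (ler_normD _ _) _.
    by rewrite -ltrBrDl gtr0_norm.
  - exact: IH.
apply: in_span_ext (in_spanD (IH w b wb) (in_spanZ (- n.+1%:R^-1) HD)) => x _.
by rewrite /D mul1r mulrA mulNr mulVf ?pnatr_eq0// mulN1r opprB addrCA subrr addr0.
Qed.

Lemma sigmoid_pow_le w b n x al : interior_weights w b -> cube x ->
  `|sigmoid_pow al n w b x| <= sigmoid (d%:R + 1) ^+ n.
Proof.
move=> [w1 b1] cx; rewrite normrM -[leRHS]mul1r ler_pM ?monomial_norm//.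
rewrite normrX lerXn2r ?nnegrE// ?(ltW (sigmoid_gt0 _))//.
rewrite gtr0_norm ?sigmoid_gt0//.
suff h : dot w x + b <= d%:R + 1.
  by have /andP[] := sigmoid_sub_le h; rewrite subr_ge0.
apply: lerD; last by rewrite (le_trans (ler_norm _))// ltW.
rewrite /dot -[X in X%:R]card_ord -sum1_card natr_sum; apply: ler_sum => j _.
apply: le_trans (ler_norm _) _; rewrite normrM -[leRHS]mul1r ler_pM//; first exact: ltW.
by have /andP[x0 x1] := cx j; rewrite ger0_norm.
Qed.

(* [\sum_(1 <= n <= N) (sigmoid ^ n - sigmoid ^ n.+1)] telescopes and [sigmoid ^ N] tends to 0. *)
Lemma in_span_monomial_sigmoid al w b : interior_weights w b ->
  in_span (sigmoid_pow al 1 w b).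
Proof.
elim: al w b => [|j al IH] w b wb.
  move=> e e0; exists [:: (w, b, 1)]; split => [p|x cx].
    by rewrite inE => /eqP ->; case: wb => w1 b1; split => [j|] /=; exact: ltW.
  by rewrite /neuron_sum big_seq1 /sigmoid_pow /monomial big_nil expr1 subrr normr0 ltW.
pose q : R := sigmoid (d%:R + 1).
have q01 : 0 < q < 1 by rewrite sigmoid_gt0 sigmoid_lt1.
have tel N : in_span (fun x => x ord0 j * (sigmoid_pow al 1 w b x - sigmoid_pow al N.+1 w b x)).
  elim: N => [|N IHN].
    by apply: in_span_ext (in_spanZ 0 (IH w b wb)) => x _; rewrite subrr mulr0 mul0r.
  have HD : in_span (fun x => x ord0 j *
      (N.+1%:R * (sigmoid_pow al N.+1 w b x - sigmoid_pow al N.+2 w b x))).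
    case: (wb) => w1 b1.
    apply: (@in_span_derivative al N.+1 w (delta_mx ord0 j) b 0 (fun x => x ord0 j)
      (1 - `|w ord0 j|)).
    - by rewrite subr_gt0.
    - by move=> x cx; have /andP[x0 x1] := cx j; rewrite ger0_norm.
    - by move=> x; rewrite addr0 dot_delta.
    - move=> h /andP[h0 h1]; apply: in_span_sigmoid_pow => //; split => [i|].
        rewrite !mxE eqxx /=; case: eqP => [->|_]; last by rewrite mulr0 addr0.
        rewrite mulr1; apply: le_lt_trans (ler_normD _ _) _.
        by rewrite -ltrBrDl gtr0_norm.
      by rewrite mulr0 addr0.
    - exact: in_span_sigmoid_pow.
  apply: in_span_ext (in_spanD IHN (in_spanZ N.+1%:R^-1 HD)) => x _.
  rewrite (mulrCA (x ord0 j)) (mulrA _^-1) mulVf ?pnatr_eq0// mul1r -mulrDr.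
  by rewrite addrA subrK.
apply: in_span_lim => e e0.
have /cvgrPdist_le/(_ e e0)[N _ /(_ N (leqnn N))] : q ^+ n @[n --> \oo] --> 0.
  by apply: cvg_expr; rewrite ger0_norm; lra.
rewrite /= sub0r normrN => hN.
exists (fun x : 'rV[R]_d =>
  x ord0 j * (sigmoid_pow al 1 w b x - sigmoid_pow al N.+1 w b x)) => // x cx.
have -> : sigmoid_pow (j :: al) 1 w b x = x ord0 j * sigmoid_pow al 1 w b x.
  by rewrite /sigmoid_pow /monomial big_cons mulrA.
rewrite mulrBr opprB addrCA subrr addr0 normrM.
apply: (@le_trans _ _ (1 * q ^+ N.+1)).
  apply: ler_pM => //; last exact: sigmoid_pow_le.
  by have /andP[x0 x1] := cx j; rewrite ger0_norm.
rewrite mul1r exprS; apply: le_trans _ hN.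
by rewrite ger0_norm ?exprn_ge0 ?ler_piMl ?exprn_ge0//; lra.
Qed.

(** At zero weights the sigmoid is the constant 1/2. *)
Lemma in_span_monomial al : in_span (monomial al).
Proof.
have i0 : interior_weights (0 : 'rV[R]_d) 0.
  by split => [j|]; rewrite ?mxE normr0.
apply: in_span_ext (in_spanZ 2 (in_span_monomial_sigmoid al i0)) => x _.
rewrite /sigmoid_pow dot0l addr0 expr1 /sigmoid oppr0 expR0.
by rewrite mulrCA divff// mulr1.
Qed.

End uniform_span.

Section bernstein.
Context (R : realType) (d : nat).
Implicit Types (phi psi : 'rV[R]_d -> R) (x y : 'rV[R]_d) (l : seq 'I_d).
Variable h : R.
Hypothesis h0 : 0 <= h.

(* The mean of [phi] after a random walk from [y] which, for each entry [i] of [l], moves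
   by [h] along the axis [i] with probability [x ord0 i]. *)
Fixpoint bernstein l phi y x : R :=
  if l is i :: l' then
    x ord0 i * bernstein l' phi (y + h *: delta_mx ord0 i) x +
    (1 - x ord0 i) * bernstein l' phi y x
  else phi y.

Lemma in_span_bernstein l phi y al :
  in_span (fun x => monomial al x * bernstein l phi y x).
Proof.
elim: l y al => [|i l IH] y al /=.
  by apply: in_span_ext (in_spanZ (phi y) (in_span_monomial al)) => x _; rewrite mulrC.
apply: in_span_ext (in_spanD (IH (y + h *: delta_mx ord0 i) (i :: al))
  (in_spanD (IH y al) (in_spanZ (-1) (IH y (i :: al))))) => x _.
by rewrite /monomial !big_cons; ring.
Qed.

Lemma bernstein_le l phi psi x y : cube x -> (forall z, phi z <= psi z) ->
  bernstein l phi y x <= bernstein l psi y x.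
Proof.
move=> cx le; elim: l y => [|i l IH] y //=.
by have /andP[x0 x1] := cx i; apply: lerD; apply: ler_wpM2l; rewrite ?subr_ge0.
Qed.

Lemma bernstein_affine l phi a b x y :
  bernstein l (fun z => a + b * phi z) y x = a + b * bernstein l phi y x.
Proof. by elim: l y => [|i l IH] y //=; rewrite !IH; ring. Qed.

Lemma bernsteinD l phi psi x y :
  bernstein l (fun z => phi z + psi z) y x = bernstein l phi y x + bernstein l psi y x.
Proof. by elim: l y => [|i l IH] y //=; rewrite !IH; ring. Qed.

Lemma bernstein_sum l (F : 'I_d -> 'rV[R]_d -> R) x y :
  bernstein l (fun z => \sum_j F j z) y x = \sum_j bernstein l (F j) y x.
Proof.
suff H (r : seq 'I_d) : bernstein l (fun z => \sum_(j <- r) F j z) y x =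
    \sum_(j <- r) bernstein l (F j) y x by exact: H.
elim: r => [|j r IH].
  under [X in bernstein _ X]funext do rewrite big_nil -(mulr0 0) -[0 * _]add0r.
  by rewrite (bernstein_affine l (fun=> 0)) big_nil mul0r addr0.
under [X in bernstein _ X]funext do rewrite big_cons.
by rewrite bernsteinD IH big_cons.
Qed.

(** Squared bias plus variance of the end point of the walk: its coordinate j is y_j plus h times a
    binomial variable. *)
Lemma bernstein_sqr l j c x y :
  bernstein l (fun z => (z ord0 j - c) ^+ 2) y x =
  (y ord0 j + (count_mem j l)%:R * (h * x ord0 j) - c) ^+ 2 +
  (count_mem j l)%:R * (h ^+ 2 * (x ord0 j * (1 - x ord0 j))).
Proof.
elim: l y => [|i l IH] y /=; first by rewrite !mul0r !addr0.
rewrite !IH !mxE eqxx /= [j == i]eq_sym natrD.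
by case: eqP => [->|_]; rewrite ?mulr1n ?mulr0n; ring.
Qed.

End bernstein.

Section uniform_modulus.
Context (R : realType) (d : nat) (f : 'rV[R]_d -> R).
Hypothesis cf : {within @cube R d, continuous f}.

Lemma compact_cube : compact (@cube R d).
Proof.
rewrite (_ : cube (d:=d) = [set v : 'rV[R]_d | forall i, `[0, 1]%classic (v ord0 i)]).
  by apply: (@rV_compact R d (fun=> `[0, 1]%classic)) => _; exact: segment_compact.
by apply/seteqP; split => x /= H j; have := H j; rewrite in_itv.
Qed.

Lemma uniform_continuity_cube (eta : R) : 0 < eta -> exists2 delta : R, 0 < delta &
  forall x z, cube x -> cube z -> (forall j, `|x ord0 j - z ord0 j| < delta) ->
    `|f x - f z| <= eta.
Proof.
move=> eta0.
have /compact_near_coveringP/near_covering_withinP H := compact_cube.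
have {H} := H R (0^'+) (fun delta x => forall z, cube z ->
   (forall j, `|x ord0 j - z ord0 j| < delta) -> `|f x - f z| <= eta) _ _.
case=> [x0 cx0|delta /= delta0 H]; last first.
  have p : 0 < delta / 2 by rewrite divr_gt0.
  exists (delta / 2) => // x z cx cz; apply: (H (delta / 2)) => //.
  by rewrite /= sub0r normrN gtr0_norm// ltr_pdivrMr// ltr_pMr// ltr1n.
move/subspace_continuousP : cf => /(_ x0 cx0) /cvgrPdist_le/(_ (eta / 2)).
rewrite divr_gt0// => /(_ isT) /nbhs_ballP[r /= r0 hr].
have {}hr z : cube z -> (forall j, `|x0 ord0 j - z ord0 j| < r) -> `|f x0 - f z| <= eta / 2.
  by move=> cz zr; apply: (hr z _ cz); split => // i j; rewrite ord1; exact: zr.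
have r2 : 0 < r / 2 by rewrite divr_gt0.
exists (ball x0 (r / 2), [set e | e < r / 2]).
  by split; [exact: nbhsx_ballx|exact: nbhs_right_lt].
move=> [x e] /= [[_ xr] er] cx z cz ze.
rewrite -[f x](subrK (f x0)) -addrA [eta]splitr.
have {}xr j : `|x0 ord0 j - x ord0 j| < r / 2 by exact: xr.
apply: le_trans (ler_normD _ _) (lerD _ _).
  rewrite distrC; apply: hr => // j; apply: lt_trans (xr j) _.
  by rewrite ltr_pdivrMr// ltr_pMr// ltr1n.
apply: hr => // j; rewrite -[x0 ord0 j](subrK (x ord0 j)) -addrA.
apply: le_lt_trans (ler_normD _ _) _.
by rewrite [r]splitr ltrD// (lt_trans (ze j)).
Qed.

(** Uniform continuity handles close points, and at distance at least delta the quadratic term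
    already exceeds twice the bound on |f|. A quadratic majorant can be averaged exactly along the
    walk. *)
Lemma quadratic_modulus (eta : R) : 0 < eta -> exists2 K : R, 0 <= K &
  forall x z, cube x -> cube z ->
    `|f x - f z| <= eta + K * \sum_j (z ord0 j - x ord0 j) ^+ 2.
Proof.
move=> eta0; have [delta delta0 hd] := uniform_continuity_cube eta0.
have [M [_ hM]] := compact_bounded (continuous_compact cf compact_cube).
have {}hM x : cube x -> `|f x| <= `|M| + 1.
  by move=> cx; apply: (hM (`|M| + 1)); [rewrite ltr_pwDr// ler_norm|exists x].
exists (2 * (`|M| + 1) / delta ^+ 2).
  by rewrite divr_ge0 ?mulr_ge0 ?addr_ge0 ?exprn_ge0// ltW.
move=> x z cx cz; case: (pselect (forall j, `|x ord0 j - z ord0 j| < delta)) => [H|].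
  rewrite (le_trans (hd x z cx cz H))// lerDl mulr_ge0//.
    by rewrite divr_ge0 ?mulr_ge0 ?addr_ge0 ?exprn_ge0// ltW.
  by apply: sumr_ge0 => j _; exact: sqr_ge0.
move=> /existsNP[j /negP]; rewrite -leNgt => hj.
apply: (@le_trans _ _ (0 + 2 * (`|M| + 1))).
  rewrite add0r; apply: le_trans (ler_normB _ _) _; rewrite mulr_natl mulr2n.
  by rewrite lerD ?hM.
apply: lerD; first exact: ltW.
rewrite -[leRHS]mulrA ler_peMr ?mulr_ge0 ?addr_ge0//.
rewrite ler_pdivlMl ?exprn_gt0// mulr1 (bigD1 j)//=.
rewrite -[leLHS]addr0 lerD ?sumr_ge0//; last by move=> i _; exact: sqr_ge0.
by rewrite -[leRHS]real_normK ?num_real// distrC ler_pXn2r ?nnegrE// ltW.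
Qed.

(** [bernstein_le] compares functions on the whole space, whereas f is controlled on the cube only;
    this projection does not increase coordinate distances to points of the cube. *)
Definition clamp (x : 'rV[R]_d) : 'rV[R]_d := \row_j Num.max 0 (Num.min 1 (x ord0 j)).

Lemma cube_clamp x : cube (clamp x).
Proof. by move=> j; rewrite mxE le_max lexx ge_max ler01 ge_min lexx. Qed.

Lemma clamp_dist x z j : cube x ->
  (clamp z ord0 j - x ord0 j) ^+ 2 <= (z ord0 j - x ord0 j) ^+ 2.
Proof.
move=> cx; have /andP[] := cx j; rewrite mxE.
by case: (leP 1 (z ord0 j)) => h1; [rewrite max_r//|case: (leP 0 (z ord0 j)) => h2]; nra.
Qed.

Lemma in_span_continuous : in_span f.
Proof.
apply: in_span_lim => e e0.
have e2 : 0 < e / 2 by rewrite divr_gt0.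
have [K K0 hK] := quadratic_modulus e2.
have [N hN] : exists N : nat, K * d%:R / (e / 2) <= N.+1%:R.
  by exists (Num.truncn (K * d%:R / (e / 2))); exact/ltW/truncnS_gt.
pose h : R := N.+1%:R^-1.
have h0 : 0 <= h by rewrite invr_ge0.
(* N + 1 moves of length 1 / (N + 1) along each axis, from 0: the walk has mean x and variance at
   most 1 / (N + 1) per axis. *)
pose l : seq 'I_d := flatten (nseq N.+1 (enum 'I_d)).
have cl j : count_mem j l = N.+1.
  rewrite count_flatten map_nseq sumn_nseq count_uniq_mem ?enum_uniq//.
  by rewrite mem_enum mul1n.
pose phi z := f (clamp z).
exists (fun x => bernstein h l phi 0 x).
  apply: in_span_ext (in_span_bernstein h l phi 0 [::]) => x _.
  by rewrite /monomial big_nil mul1r.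
move=> x cx.
pose q (z : 'rV[R]_d) := \sum_j (z ord0 j - x ord0 j) ^+ 2.
have bq : K * bernstein h l q 0 x <= e / 2.
  rewrite (_ : bernstein h l q 0 x = \sum_j h * (x ord0 j * (1 - x ord0 j))).
    apply: (@le_trans _ _ (K * (h * d%:R))).
      rewrite ler_wpM2l// -mulr_sumr ler_wpM2l//.
      rewrite -[X in _ <= X%:R]card_ord -sum1_card natr_sum; apply: ler_sum => j _.
      by have /andP[x0 x1] := cx j; nra.
    by rewrite mulrCA mulrC /h ler_pdivrMr// [leRHS]mulrC -ler_pdivrMr.
  rewrite bernstein_sum; apply: eq_bigr => j _.
  rewrite bernstein_sqr cl mxE add0r /h mulrA mulfV ?pnatr_eq0// mul1r subrr.
  by rewrite expr0n add0r expr2 !mulrA mulfV ?pnatr_eq0// mul1r.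
have bnd z : `|f x - phi z| <= e / 2 + K * q z.
  apply: le_trans (hK x (clamp z) cx (cube_clamp z)) _; rewrite lerD2l ler_wpM2l//.
  by apply: ler_sum => j _; exact: clamp_dist.
have up := @bernstein_le _ _ h l phi (fun z => (f x + e / 2) + K * q z) x 0 cx.
have lo := @bernstein_le _ _ h l (fun z => (f x - e / 2) + (- K) * q z) phi x 0 cx.
rewrite bernstein_affine in up; rewrite bernstein_affine in lo.
rewrite ler_norml; apply/andP; split.
  have : bernstein h l phi 0 x <= f x + e / 2 + K * bernstein h l q 0 x.
    by apply: up => z; move: (bnd z); rewrite ler_norml => /andP[]; lra.
  lra.
have : f x - e / 2 + - K * bernstein h l q 0 x <= bernstein h l phi 0 x.
  by apply: lo => z; move: (bnd z); rewrite ler_norml => /andP[]; lra.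
lra.
Qed.

End uniform_modulus.

Section universal_networks.
Context (R : realType) (d : nat).

(* Splits each outer weight into many small equal ones. *)
Lemma split_neurons (s : seq ('rV[R]_d * R * R)) : (forall p, p \in s -> small_weights 1 p) ->
  exists2 s', (forall p, p \in s' -> good_neuron 1 1 p) & neuron_sum s' =1 neuron_sum s.
Proof.
elim: s => [|p s IH] H; first by exists [::].
have [s' g' e'] := IH (fun q qs => H q (mem_behead (s := p :: s) qs)).
pose m := (Num.truncn `|p.2|).+1.
have m0 : (0 : R) < m%:R by rewrite ltr0n.
exists (nseq m (p.1, p.2 / m%:R) ++ s') => [q|x].
  rewrite mem_cat mem_nseq => /orP[/andP[_ /eqP ->]|/g']//.
  have [w1 b1] := H p (mem_head _ _); split => //=.
  rewrite normrM [X in _ * X]gtr0_norm ?invr_gt0// ler_pdivrMr// mul1r.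
  exact/ltW/truncnS_gt.
rewrite [LHS]big_cat [RHS]big_cons -/(neuron_sum s' x) e'; congr (_ + _).
rewrite big_nseq iter_addr_0 -[LHS]mulr_natl mulrA; congr (_ * _) => /=.
by rewrite mulrCA mulfV ?gt_eqF// mulr1.
Qed.

Lemma in_span_nn_class (h : 'rV[R]_d -> R) (e : R) : in_span h -> 0 < e ->
  exists k0, forall k, (k0 <= k)%N -> exists2 g, nn_class k 1 1 1 g &
    forall x, cube x -> `|h x - g x| <= e.
Proof.
move=> H e0; have [s [/split_neurons[s' gs' es'] hs]] := H e e0.
exists (size s') => k ks.
(* Beyond the end of the list the default is a neuron of outer weight 0, which pads the network to
   any larger k. *)
pose p (i : nat) := nth (0 : 'rV[R]_d, 0 : R, 0 : R) s' i.
have gp i : good_neuron 1 1 (p i).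
  rewrite /p; case: (ltnP i (size s')) => hi; first exact/gs'/mem_nth.
  by rewrite nth_default//; split => [j||]; rewrite /= ?mxE normr0.
exists (fun x => \sum_(i < k) (p i).2 * sigmoid (dot (p i).1.1 x + (p i).1.2) + 0).
  exists (fun i => (p i).1.1), (fun i => (p i).1.2), (fun i => (p i).2), 0.
  by split => [i j|i|i||]//; rewrite ?normr0//; case: (gp i).
move=> x cx; rewrite addr0 (_ : \sum_(i < k) _ = neuron_sum s' x); last first.
  rewrite /neuron_sum (big_nth (0, 0, 0)) big_mkord.
  rewrite (big_ord_widen k (fun i => (p i).2 * sigmoid (dot (p i).1.1 x + (p i).1.2)) ks).
  rewrite [LHS](bigID (fun i : 'I_k => (i < size s')%N))/=.
  rewrite [X in _ + X]big1 ?addr0// => i; rewrite -leqNgt => hi.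
  by rewrite /p nth_default//= mul0r.
by rewrite es'; exact: hs.
Qed.

End universal_networks.

(** * Almost sure consistency *)

Section almost_sure.
Context (R : realType) dO (Omega : measurableType dO) (Pr : probability Omega R).

Lemma nneseries_inv_sqr_lty :
  (\big[+%E/0%R]_(0 <= n <oo) (n.+1%:R ^- 2)%:E < +oo :> \bar R)%E.
Proof.
apply: le_lt_trans (ltry 2); apply: lime_le.
  by apply: is_cvg_nneseries => n _ _; rewrite lee_fin invr_ge0.
near=> n; rewrite sumEFin lee_fin.
(* Telescoping: 2 / u - 2 / (u + 1) >= 1 / u^2 for u >= 1. *)
suff H : \sum_(0 <= i < n) i.+1%:R ^- 2 <= 2 - 2 * n.+1%:R^-1 :> R.
  by apply: le_trans H _; rewrite gerBl mulr_ge0 ?invr_ge0.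
elim: (n) => [|m IH]; first by rewrite big_geq// invr1 mulr1 subrr.
rewrite big_nat_recr//=; apply: le_trans (lerD IH (lexx _)) _.
have p : (1 : R) <= m.+1%:R by rewrite ler1n.
move: (m.+1%:R) (@natr1 R m.+1) p => u <- u1.
have u0 : 0 < u by lra.
have u2 : 0 < u + 1 by lra.
rewrite -subr_ge0.
have -> : 2 - 2 * (u + 1)^-1 - (2 - 2 * u^-1 + u ^- 2) = (u - 1) / (u ^+ 2 * (u + 1)).
  by field; rewrite !gt_eqF.
by rewrite divr_ge0 ?subr_ge0// mulr_ge0 ?exprn_ge0 ?ltW.
Unshelve. all: by end_near. Qed.

Lemma borel_cantelli_inv_sqr (W : nat -> Omega -> R) (c : nat -> R) (a : R) :
  (forall n, bmf (W n)) ->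
  (forall n, (Pr [set w | (c n <= W n w)%R] <= (a * n.+1%:R ^- 2)%:E)%E) ->
  {ae Pr, forall w, \forall n \near \oo, W n w < c n}.
Proof.
move=> bW hW; pose F n := [set w | c n <= W n w].
have mF n : measurable (F n).
  rewrite (_ : F n = W n @^-1` `[c n, +oo[%classic); last first.
    by apply/seteqP; split => w /=; rewrite in_itv/= andbT.
  by rewrite -[X in measurable X]setTI; apply: (bW n).1.
exists (lim_sup_set F); split.
- apply: bigcapT_measurable => n; apply: bigcup_measurable => i _; exact: mF.
- apply: lim_sup_set_cvg0 => //.
  have a0 : 0 <= a.
    have := le_trans (measure_ge0 Pr _) (hW 0%N); rewrite lee_fin expr1n invr1 mulr1//.
  apply: (@le_lt_trans _ _ (\big[+%E/0%R]_(0 <= n <oo) (a%:E * (n.+1%:R ^- 2)%:E))%E).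
    by apply: lee_nneseries => n _ *; [exact: measure_ge0|rewrite -EFinM hW].
  rewrite nneseriesZl//.
  by rewrite lte_mul_pinfty// nneseries_inv_sqr_lty.
- move=> w /= hw n _; apply: contrapT => H; apply: hw; exists n => // i /= ni.
  by rewrite ltNge; apply/negP => h; apply: H; exists i.
Qed.

End almost_sure.

Section power_rates.
Context (R : realType).

Lemma powRN_small (p e : R) : 0 < p -> 0 < e -> \forall n \near \oo, n%:R `^ (- p) <= e.
Proof.
move=> p0 e0; pose E := e `^ (- p^-1).
have E0 : 0 < E by exact: powR_gt0.
exists (Num.truncn E).+1 => // n /= hn.
have En : E <= n%:R.
  apply/ltW; apply: lt_le_trans (truncnS_gt E) _; by rewrite ler_nat.
have n0 : (0 : R) < n%:R by exact: lt_le_trans En.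
have -> : e = E `^ (- p) by rewrite /E -powRrM mulrNN mulVf ?gt_eqF// powRr1// ltW.
rewrite !powRN lef_pV2 ?posrE ?powR_gt0//.
by rewrite ge0_ler_powR ?nnegrE// ltW.
Qed.

Lemma sqrt_ln_le_powR (a : R) n : 0 < a -> (0 < n)%N ->
  Num.sqrt (ln n%:R) <= Num.sqrt (2 * a^-1) * n%:R `^ (a / 4).
Proof.
move=> a0 n0; have n0' : (0 : R) < n%:R by rewrite ltr0n.
have h : ln n%:R <= 2 * a^-1 * n%:R `^ (a / 2) :> R.
  have := ln_le_id (powR_gt0 (a / 2) n0'); rewrite ln_powR => h.
  have -> : ln n%:R = 2 * a^-1 * (a / 2 * ln n%:R) :> R by field; rewrite gt_eqF.
  by rewrite ler_wpM2l// mulr_ge0// invr_ge0 ltW.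
rewrite -[X in _ * X]ger0_norm ?powR_ge0// -sqrtr_sqr -sqrtrM ?mulr_ge0 ?invr_ge0 ?(ltW a0)//.
rewrite ler_wsqrtr// (le_trans h)// le_eqVlt; apply/orP; left; apply/eqP; congr (_ * _).
rewrite -powR_mulrn ?powR_ge0// -powRrM; congr (_ `^ _); by field.
Qed.

(** The growth condition leaves a factor n^(-al/2); the logarithm costs at most n^(al/4) up to a
    constant, and n^(-al/4) still tends to 0. *)
Lemma deviation_rate_small (al A K e : R) : 0 < al -> 0 <= A -> 0 <= K -> 0 < e ->
  \forall n \near \oo, forall c, 0 <= c <= K * n%:R `^ ((1 - al) / 2) ->
    c * (A + 4 * Num.sqrt (ln n%:R)) / Num.sqrt n%:R <= e.
Proof.
move=> al0 A0 K0 e0; set B := A + 4 * Num.sqrt (2 * al^-1).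
have B0 : 0 <= B by rewrite addr_ge0// mulr_ge0 ?sqrtr_ge0.
have KB : 0 < K * B + 1 by rewrite ltr_wpDl// mulr_ge0.
have := powRN_small (divr_gt0 al0 (ltr0n R 4)) (divr_gt0 e0 KB).
apply: filter_app; exists 1%N => // n /= n1 hn c /andP[c0 cK].
have n0 : (0 : R) < n%:R by rewrite ltr0n.
have s0 : 0 < Num.sqrt n%:R :> R by rewrite sqrtr_gt0.
have q1 : 1 <= n%:R `^ (al / 4) :> R.
  by rewrite -[leLHS](powRr0 n%:R) ler_powR ?ler1n// divr_ge0 ?ltW.
have hB : A + 4 * Num.sqrt (ln n%:R) <= B * n%:R `^ (al / 4).
  rewrite /B [leRHS]mulrDl lerD ?ler_peMr// -mulrA ler_wpM2l//; exact: sqrt_ln_le_powR.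
have sE : Num.sqrt n%:R = n%:R `^ 2^-1 :> R by rewrite powR12_sqrt.
apply: (@le_trans _ _ ((K * n%:R `^ ((1 - al) / 2)) * (B * n%:R `^ (al / 4)) / Num.sqrt n%:R)).
  rewrite ler_wpM2r ?invr_ge0 ?(ltW s0)// ler_pM// addr_ge0// mulr_ge0// sqrtr_ge0.
have -> : (K * n%:R `^ ((1 - al) / 2)) * (B * n%:R `^ (al / 4)) / Num.sqrt n%:R =
    K * B * n%:R `^ (- (al / 4)).
  rewrite sE -powRN mulrACA -[LHS]mulrA -!powRD ?pnatr_eq0 -?lt0n ?n1 ?implybT//.
  by congr (_ * _ `^ _); field.
apply: (@le_trans _ _ ((K * B + 1) * (e / (K * B + 1)))).
  by rewrite ler_pM ?powR_ge0 ?mulr_ge0// lerDl.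
by rewrite mulrCA mulfV ?gt_eqF// mulr1.
Qed.

End power_rates.

Lemma near_infty_succ (P : set nat) :
  (\forall n \near \oo, P n) -> \forall n \near \oo, P n.+1.
Proof. by move=> [N _ hN]; exists N => // n /= /leqW; exact: hN. Qed.

Section consistency.
Context (R : realType) (d : nat) (P Q : probability (borel_rV R d) R).
Hypothesis PQ : hellinger_pair P Q.
Context (dO : measure_display) (Omega : measurableType dO) (Pr : probability Omega R).
Variables X Y : nat -> {RV Pr >-> borel_rV R d}.
Hypotheses (hX : iid_from P X) (hY : iid_from Q Y).

Lemma small_bias (f : 'rV[R]_d -> R) (s : R) : f_hellinger_version P Q f ->
  {within @cube R d, continuous f} -> 0 < s -> exists k0, forall k t, (k0 <= k)%N ->
  0 < t -> t <= s / 2 -> exists2 g, nn_class k 1 1 1 g &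
    bias P Q (fun x => trunc t (g (to_cube x))) <= 5 * s.
Proof.
move=> hf cf s0; have [PC QC dom] := PQ.
have cm : {within @cube R d, continuous (fun x => Num.min (f x) (1 - s))}.
  move=> x; apply: (@continuous_min R (subspace (@cube R d)) f (fun=> 1 - s)); first exact: cf.
  exact: cst_continuous.
have s2 : 0 < s / 2 by rewrite divr_gt0.
have [k0 hk0] := in_span_nn_class (in_span_continuous cm) s2.
exists k0 => k t kk t0 ts; have [g hg gf] := hk0 k kk; exists g => //.
apply: (bias_le_truncation dom hf t0) => //.
- exact: bmf_net_of hg.
- by move=> x; exact: trunc_le.
apply: (ae_mono (ae_cube QC)) => x cx; rewrite to_cube_id//.
have := gf x cx; rewrite distrC => h.
(* The truncation is inactive here: g <= 1 - s + s / 2 <= 1 - t on the cube. *)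
rewrite /trunc min_r//; move: h; rewrite ler_norml => /andP[_ h].
have : Num.min (f x) (1 - s) <= 1 - s by rewrite ge_min lexx orbT.
move: h ts; lra.
Qed.

Lemma consistency (f : 'rV[R]_d -> R) (k : nat -> nat) (t : nat -> R) (al : R) :
  f_hellinger_version P Q f -> {within @cube R d, continuous f} -> 0 < al ->
  k n @[n --> \oo] --> \oo -> (forall n, 0 < t n) -> t n @[n --> \oo] --> (0 : R) ->
  ((fun n => (k n)%:R `^ (3 / 2) * (t n) ^- 2 : R^o) =O_\oo
    (fun n => n%:R `^ ((1 - al) / 2) : R^o)) ->
  {ae Pr, forall omega,
    hellinger2_hat (nn_class1 (k n) (t n))
      (fun i : 'I_n => X i omega) (fun i : 'I_n => Y i omega)
      @[n --> \oo] --> hellinger2 P Q}.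
Proof.
move=> hf cf al0 kinf t0 tc hO; have [PC QC dom] := PQ.
have mV m : 0 < m.+1%:R^-1 :> R by rewrite invr_gt0.
(* Indexed by n = m + 1, since the deviation bounds require a nonempty sample. *)
have [W HW] := choice (fun m => sample_deviations PQ hX hY (k m.+1) ler01 ler01 ler01 (t0 m.+1)
  (ltn0Sn m) (mV m)).
have t_small e : 0 < e -> \forall n \near \oo, t n <= e.
  move=> e0; move/cvgrPdist_le : tc => /(_ e e0); apply: filterS => n.
  by rewrite sub0r normrN gtr0_norm.
pose c n : R := 4 * (1 + t n ^- 2) * ((k n)%:R + 1).
have t2 n : 0 <= t n ^- 2 by rewrite invr_ge0 exprn_ge0// ltW.
have c0 n : 0 < c n.
  by apply: mulr_gt0; [apply: mulr_gt0 => //; rewrite ltr_pwDl|rewrite ltr_wpDl].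
(* Makes the exponent eta^2 / (8 c^2 n) equal to 2 ln n, so the tail probabilities are at most 2
   n^-2 and summable. *)
pose eta n := 4 * c n * Num.sqrt (n%:R * ln n%:R).
pose A : R := chain_cst R d.+1 * Num.sqrt (2 * 1 + 1) + 3.
have A0 : 0 <= A by rewrite addr_ge0// mulr_ge0 ?sqrtr_ge0// mulr_ge0 ?exprn_ge0.
pose rate n := 4 * (1 + t n ^- 2) * (Num.sqrt n%:R * network_rate d.+1 1 1 1 (k n)).
have W_ev : {ae Pr, forall w, \forall m \near \oo, W m w < 2 * (rate m.+1 + eta m.+1)}.
  apply: (borel_cantelli_inv_sqr (a := 2)) => m; first by have [] := HW m.
  have [_ _ _ _ /(_ (eta m.+1))] := HW m.
  have l0 : 0 <= ln m.+1%:R :> R by rewrite ln_ge0// ler1n.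
  have m0 : (0 : R) < m.+1%:R by [].
  move=> TW; apply: le_trans (TW _ _) _.
  - by rewrite mulr_ge0 ?sqrtr_ge0// mulr_ge0// ltW.
  - by rewrite mulr1 ltr_wpDl.
  rewrite lee_fin mulr1 -/(c _) ler_wpM2l//.
  have -> : eta m.+1 ^+ 2 / (8 * (c m.+1 ^+ 2 * m.+1%:R)) = ln (m.+1%:R ^+ 2).
    rewrite lnXn// exprMn sqr_sqrtr; last by rewrite mulr_ge0// ltW.
    by rewrite -[RHS]mulr_natl; field; rewrite !gt_eqF.
  by rewrite expRN lnK ?posrE ?exprn_gt0.
have dev_small e : 0 < e -> \forall m \near \oo,
    m.+1%:R^-1 * (2 * (rate m.+1 + eta m.+1)) + m.+1%:R^-1 <= e.
  move=> e0; have [K K0 hK] : exists2 K : R, 0 <= K & \forall n \near \oo,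
      (k n)%:R `^ (3 / 2) * t n ^- 2 <= K * n%:R `^ ((1 - al) / 2).
    move/eqOP : hO => [K0 [_ hK]]; exists (`|K0| + 1); first by rewrite addr_ge0.
    apply: filterS (hK (`|K0| + 1) _) => [n|]; last by rewrite ltr_pwDr// ler_norm.
    by rewrite (ger0_norm (powR_ge0 _ _)) => h; apply: le_trans h; exact: ler_norm.
  have e4 : 0 < e / 4 by rewrite divr_gt0.
  have e2 : 0 < e / 2 by rewrite divr_gt0.
  have rate_n := deviation_rate_small al0 A0 (mulr_ge0 (ler0n R 16) K0) e4.
  have inv_n := near_infty_natSinv_lt (PosNum e2).
  have k1 : \forall n \near \oo, (1 <= k n)%N by move/cvgnyPge : (kinf); exact.
  have t1 := t_small 1 ltr01.
  apply: filterS2 inv_n (near_infty_succ (filterI rate_n (filterI hK (filterI k1 t1)))) => m.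
  move: m.+1 (ltn0Sn m) => n n0 /= inv_n' [rn [Kn [k1n t1n]]].
  have n0' : (0 : R) < n%:R by rewrite ltr0n.
  have s0 : 0 < Num.sqrt n%:R :> R by rewrite sqrtr_gt0.
  have kR : 1 <= (k n)%:R :> R by rewrite ler1n.
  have ti : 1 <= t n ^- 2.
    by rewrite invf_ge1 ?exprn_gt0// exprn_ile1// ltW.
  have kp : (k n)%:R <= (k n)%:R `^ (3 / 2) :> R.
    rewrite -[leLHS]powRr1 ?ler0n// ler_powR//; lra.
  (* For k >= 1 and t <= 1 one has 1 + t^-2 <= 2 t^-2 and k + 1 <= 2 k, so c is at most 16 k t^-2,
     and k <= k^(3/2). *)
  have cn : 0 <= c n <= 16 * K * n%:R `^ ((1 - al) / 2).
    rewrite ltW//= -mulrA; apply: (@le_trans _ _ (16 * ((k n)%:R `^ (3 / 2) * t n ^- 2))).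
      rewrite /c; move: (t n ^- 2) ((k n)%:R : R) (_ `^ _) ti kR kp => a b b' a1 b1 bb.
      by apply: (@le_trans _ _ (16 * (b * a))); nra.
    by rewrite ler_wpM2l.
  have {}rn := rn _ cn.
  have rate_le : rate n <= c n * A * Num.sqrt n%:R.
    have -> : c n * A * Num.sqrt n%:R =
        4 * (1 + t n ^- 2) * (Num.sqrt n%:R * (((k n)%:R + 1) * A)) by rewrite /c; ring.
    rewrite /rate; apply: ler_wpM2l; first by rewrite mulr_ge0// addr_ge0// (le_trans ler01).
    apply: ler_wpM2l; first exact: ltW.
    rewrite /network_rate /A !mulr1.
    have : 0 <= chain_cst R d.+1 * Num.sqrt (2 + 1).
      by rewrite mulr_ge0 ?sqrtr_ge0// mulr_ge0 ?exprn_ge0.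
    by move: (_ * Num.sqrt _) kR => B; nra.
  have -> : e = 2 * (e / 4) + e / 2 by field.
  apply: lerD; last exact: ltW.
  rewrite mulrCA ler_wpM2l//; apply: le_trans rn.
  rewrite ler_pdivlMr// -mulrA ler_pdivrMl//.
  apply: (@le_trans _ _ ((c n * A * Num.sqrt n%:R + eta n) * Num.sqrt n%:R)).
    by rewrite ler_wpM2r ?lerD2r// ltW.
  rewrite /eta sqrtrM ?ler0n//.
  rewrite (_ : _ * Num.sqrt n%:R =
     Num.sqrt n%:R ^+ 2 * (c n * (A + 4 * Num.sqrt (ln n%:R)))).
    by rewrite sqr_sqrtr// ltW.
  by ring.
apply: (ae_mono (ae_and W_ev (ae_and (ae_iid_cube PC hX) (ae_iid_cube QC hY)))).
move=> w [Ww [Xw Yw]]; rewrite hellinger2_fin//.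
have key (e : R) : 0 < e -> \forall n \near \oo,
    let hat := hellinger2_hat (nn_class1 (k n) (t n))
      (fun i : 'I_n => X i w) (fun i : 'I_n => Y i w) in
    ((hell P Q - e)%:E <= hat)%E /\ (hat <= (hell P Q + e)%:E)%E.
  move=> e0; pose s := Num.min 1 (e / 10).
  have s0 : 0 < s by rewrite lt_min ltr01 divr_gt0.
  have se : 5 * s <= e / 2.
    have : s <= e / 10 by rewrite ge_min lexx orbT.
    by lra.
  have [k0 hk0] := small_bias hf cf s0.
  have e2 : 0 < e / 2 by rewrite divr_gt0.
  have kk : \forall n \near \oo, (k0 <= k n)%N by move/cvgnyPge : (kinf); exact.
  have ts := t_small _ (divr_gt0 s0 (ltr0n R 2)).
  apply: near_inftyS; apply: filterS3 Ww (dev_small _ e2) (near_infty_succ (filterI kk ts)) => m.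
  have [_ _ /(_ w Xw Yw) + _ _] := HW m.
  move=> [up lo] Wm dm [km tm].
  have {}dm : m.+1%:R^-1 * W m w + m.+1%:R^-1 <= e / 2.
    by apply: le_trans dm; rewrite lerD2r ler_wpM2l ?invr_ge0// ltW.
  have [g hg bg] := hk0 _ _ km (t0 _) tm.
  split.
    apply: le_trans (lo g hg); rewrite lee_fin; move: bg se dm.
    by move: (bias _ _ _) (_ + _) => b W1; lra.
  by apply: le_trans up _; rewrite lee_fin lerD2l; apply: le_trans dm _; move: e0; lra.
apply/fine_cvgP; split.
  apply: filterS (key 1 ltr01) => n /= [h1 h2].
  by rewrite fin_numElt (lt_le_trans _ h1) ?(le_lt_trans h2) ?ltry ?ltNyr.
apply/cvgrPdist_le => e e0; apply: filterS (key e e0) => n /=.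
move: (hellinger2_hat _ _ _) => [r| |] [].
- by rewrite !lee_fin /= distrC ler_norml => h1 h2; apply/andP; split; lra.
- by [].
- by [].
Qed.

End consistency.

Theorem theorem6 (R : realType) (d : nat) (hd : (0 < d)%N)
    (P Q : probability (borel_rV R d) R) (hPQ : hellinger_pair P Q)
    (dO : measure_display) (Omega : measurableType dO) (Pr : probability Omega R)
    (X Y : nat -> {RV Pr >-> borel_rV R d})
    (hX : iid_from P X) (hY : iid_from Q Y)
    (alpha : R) (halpha : 0 < alpha) :
  ((exists2 f : 'rV[R]_d -> R,
      f_hellinger_version P Q f & {within @cube R d, continuous f}) ->
   forall (k : nat -> nat) (t : nat -> R),
     k n @[n --> \oo] --> \oo ->
     (forall n, 0 < t (k n)) ->
     t (k n) @[n --> \oo] --> (0 : R) ->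
     ((fun n => (k n)%:R `^ (3 / 2) * (t (k n)) ^- 2 : R^o) =O_\oo
      (fun n => n%:R `^ ((1 - alpha) / 2) : R^o)) ->
     {ae Pr, forall omega,
       hellinger2_hat (nn_class1 (k n) (t (k n)))
         (fun i : 'I_n => X i omega) (fun i : 'I_n => Y i omega)
         @[n --> \oo] --> hellinger2 P Q})
  /\
  ((exists M : R, exists2 f : 'rV[R]_d -> R,
      f_hellinger_version P Q f & hellinger_class M f) ->
   forall C : R, exists C1 C2 : R, forall k n : nat, (2 <= k)%N -> (1 <= n)%N ->
     Num.sqrt k%:R * ln k%:R ^+ 3 <= C * n%:R `^ ((1 - alpha) / 2) ->
     (\int[Pr]_omega `| hellinger2_hat (nn_class2 k (2^-1 * ln k%:R) (ln k%:R)^-1)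
           (fun i : 'I_n => X i omega) (fun i : 'I_n => Y i omega)
         - hellinger2 P Q |
      <= (C1 * (k%:R `^ (- 2^-1) * ln k%:R) +
          C2 * (Num.sqrt k%:R * ln k%:R ^+ 3 * n%:R `^ (- 2^-1)))%:E)%E).
Proof.
split.
- move=> [f hf cf] k t kinf t0 tc hO.
  exact: (consistency hPQ hX hY hf cf halpha kinf t0 tc hO).
- move=> [M [f hf hM]] C.
  have [C1 [C2 h]] := rate_bound hPQ hX hY hf hM.
  by exists C1, C2 => k n k2 n1 _; exact: h.
Qed.
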